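(* Let $E=[-\pi,-\pi/2]\cup[\pi/2,\pi]$. Let $H$ be an entire function whose zero set $\mathcal{Z}_H$ is a complete interpolating sequence for $PW_{\pi/4}$ and which is a generating function for $\mathcal{Z}_H$ in $PW_{\pi/4}$. Suppose that the points of $\mathcal{Z}_H$ are uniformly separated from the set $\frac43\mathbb{Z}$, i.e. $\inf\{|w-\tfrac43 n| : w\in\mathcal{Z}_H,\ n\in\mathbb{Z}\}>0$. Then $\Lambda=\mathcal{Z}_H\cup 4\mathbb{Z}$ is a complete interpolating sequence for $PW_E$.
   Context: For a compact set $S\subset\mathbb{R}$, the Paley-Wiener space $PW_S$ is the space of entire functions $f(z)=\int_S \varphi(t)e^{izt}\,dt$ with $\varphi\in L^2(S)$, with inner product $(f,g)=\frac1{2\pi}\int_{\mathbb{R}} f(x)\overline{g(x)}\,dx$. It is a reproducing kernel Hilbert space with reproducing kernel $\kappa^S_\lambda(z)=\int_S e^{i(z-\bar\lambda)t}\,dt$. We write $PW_c$ for $PW_{[-c,c]}$. A set $\Lambda\subset\mathbb{C}$ is a complete interpolating sequence for $PW_S$ if for every $\{a_\lambda\}\in\ell^2(\Lambda)$ there is a unique $f\in PW_S$ with $f(\lambda)/\|\kappa^S_\lambda\|=a_\lambda$ for all $\lambda\in\Lambda$; equivalently, the normalized kernels $\{\kappa^S_\lambda/\|\kappa^S_\lambda\|\}_{\lambda\in\Lambda}$ form a Riesz basis of $PW_S$. A generating function for a set $M\subset\mathbb{C}$ in $PW_S$ is an entire function $H\not\equiv0$ in $PW_S+z\,PW_S=\{f+zg:f,g\in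 PW_S\}$ vanishing on $M$. (If $S$ is an interval and $M$ is a complete interpolating sequence for $PW_S$, it is unique up to a constant factor and has no zeros other than the points of $M$, which are simple zeros.) *)

(* Defs.v *)
From HB Require Import structures.
From mathcomp Require Import all_boot all_order all_algebra.
From mathcomp Require Import all_classical all_reals all_analysis.
Set Implicit Arguments.
Unset Strict Implicit.
Unset Printing Implicit Defensive.
Import Order.TTheory GRing.Theory Num.Theory numFieldNormedType.Exports.
From mathcomp Require Import complex.

Local Open Scope classical_set_scope.
Local Open Scope ring_scope.
Local Open Scope complex_scope.

Section PaleyWiener.
Context {R : realType}.
Local Notation C := R[i].
Local Notation mu := (@lebesgue_measure R).

(* The scalar field of C^o is C, so this is complex differentiability: the
   increments in the difference quotient range over C. *)
Definition entire (f : C -> C) : Prop :=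
  forall z : C, derivable (f : C^o -> C^o) z 1.

Definition zero_set (f : C -> C) : set C := [set z | f z = 0].

Definition cexp (z : C) : C :=
  (expR (Re z) * cos (Im z)) +i* (expR (Re z) * sin (Im z)).

Definition cintegral (D : set R) (f : R -> C) : C :=
  (\int[mu]_(t in D) Re (f t)) +i* (\int[mu]_(t in D) Im (f t)).

(* The norm of C is C-valued, with nonnegative real values; Re recovers the
   element of R. *)
Definition square_integrable (S : set R) (phi : R -> C) : Prop :=
  [/\ measurable_fun S (fun t => Re (phi t)),
      measurable_fun S (fun t => Im (phi t)) &
      (\int[mu]_(t in S) ((Re `|phi t|) ^+ 2)%:E < +oo)%E].

(* Meant for compact S. Then every phi in L^2(S) is integrable on S, and the
   functions so defined on C are automatically entire. *)
Definition PW (S : set R) : set (C -> C) :=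
  [set f | exists2 phi : R -> C, square_integrable S phi &
     forall z : C, f z = cintegral S (fun t => phi t * cexp ('i * z * t%:C))].

Definition PWdot (f g : C -> C) : C :=
  ((2 * pi)^-1)%:C * cintegral setT (fun x => f x%:C * conjc (g x%:C)).

Definition PWnorm (f : C -> C) : R := Num.sqrt (Re (PWdot f f)).

Definition PWkernel (S : set R) (lam z : C) : C :=
  cintegral S (fun t => cexp ('i * (z - conjc lam) * t%:C)).

(* An element of l^2(Lam) is given by a function on C of which only the values
   on Lam matter. *)
Definition ell2 (Lam : set C) (a : C -> C) : Prop :=
  (\esum_(lam in Lam) ((Re `|a lam|) ^+ 2)%:E < +oo)%E.

Definition complete_interpolating (S : set R) (Lam : set C) : Prop :=
  forall a : C -> C, ell2 Lam a ->
    exists! f : C -> C, PW S f /\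
      forall lam, Lam lam -> f lam / (PWnorm (PWkernel S lam))%:C = a lam.

Definition generating_function (S : set R) (M : set C) (H : C -> C) : Prop :=
  [/\ entire H,
      exists z, H z != 0,
      exists f g : C -> C,
        [/\ PW S f, PW S g & forall z, H z = f z + z * g z] &
      forall w, M w -> H w = 0].

End PaleyWiener.

(* Main.v *)
Require Import Defs.
From mathcomp Require Import all_boot all_order all_algebra.
From mathcomp Require Import all_classical all_reals all_analysis.
Import Order.TTheory GRing.Theory Num.Theory numFieldNormedType.Exports.
From mathcomp Require Import complex measurable_realfun.
From mathcomp Require Import ring lra.
Local Open Scope classical_set_scope.
Local Open Scope ring_scope.
Local Open Scope complex_scope.
Set Implicit Arguments.
Unset Strict Implicit.
Unset Printing Implicit Defensive.
Local Notation "z ^*" := (conjc z) : ring_scope.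
Local Notation "'i" := Num.imaginary : complex_scope.

(** Write I = [-pi/4, pi/4] and al = 3 pi / 4. A function of PW_E splits as
    f(z) = e^{-i al z} g1(z) + e^{i al z} g2(z) with g1, g2 in PW_I. The two
    exponentials agree at the points 4 n (the quotient is e^{6 pi i n} there), so
    the values f(4 n) determine those of g1 + g2, hence g1 + g2 itself, the 4 n
    being the Fourier nodes of PW_I. The remaining values, at the zeros w of H,
    prescribe sin(al w) g1(w), and |sin(al w)| is comparable to e^{al |Im w|}
    because w stays away from the zeros 4 n / 3 of sin(al w). The interpolation
    problem so obtained for g1 on the zeros of H is solved by hypothesis.

    That its data are square summable amounts to a Bessel inequality for the
    normalized kernels at the zeros of H. The hypothesis gives interpolation,
    hence by uniform boundedness a lower bound for the energy of exponential
    sums; the upper bound follows by inverting the Cauchy matrix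
    1 / (w_j - conj w_k) through its displacement equation, after restriction to
    a half plane and a vertical shift. *)


(** * Complex numbers and exponentials *)

Section ComplexNumbers.
Context {R : realType}.
Local Notation C := R[i].
Implicit Types (z w : C) (x y : R).

(** The definition of a complete interpolating sequence supplies interpolants; it does not say that
    the normalized values of a function at the nodes are square summable. That second half is what
    has to be earned: after division by sin(al w) the data for g1 contain e^{i al w} (g1 + g2)(w) /
    sin(al w), and g1 + g2, fixed by the values at 4 n, is an arbitrary function of PW_I as far as
    the zeros of H can tell. The division is harmless because kappa^E is kappa^I times 2 cos(al
    theta), theta = z - conj w, so that the squared kernel norm grows by at most 4 e^{2 al |Im w|},
    the order of |sin(al w)|^2. The Cauchy matrix is the Gram matrix of exponentials on a half-line,
    whereas PW_I lives on [-c, c]. The shift makes the half-line integrals converge even for real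
    zeros. Energy on [-c, c] is at most energy on [-c, oo), and this one inequality serves both ends
    of the duality: it turns the given lower bound into one for the Cauchy form, and the dual upper
    bound for the form into one for the interval. *)

Definition abs2 z : R := Re z ^+ 2 + Im z ^+ 2.

Lemma complexP z w : Re z = Re w -> Im z = Im w -> z = w.
Proof. by case: z w => a b [c d] /= -> ->. Qed.

Lemma ReD z w : Re (z + w) = Re z + Re w. Proof. by case: z w => ? ? []. Qed.
Lemma ImD z w : Im (z + w) = Im z + Im w. Proof. by case: z w => ? ? []. Qed.
Lemma ReN z : Re (- z) = - Re z. Proof. by case: z. Qed.
Lemma ImN z : Im (- z) = - Im z. Proof. by case: z. Qed.
Lemma ReM z w : Re (z * w) = Re z * Re w - Im z * Im w.
Proof. by case: z w => ? ? []. Qed.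
Lemma ImM z w : Im (z * w) = Re z * Im w + Im z * Re w.
Proof. by case: z w => a b [c d] /=; rewrite addrC. Qed.
Lemma Re_conj z : Re z^* = Re z. Proof. by case: z. Qed.
Lemma Im_conj z : Im z^* = - Im z. Proof. by case: z. Qed.

Lemma Re_i : Re ('i : C) = 0. Proof. by rewrite -complexiE. Qed.
Lemma Im_i : Im ('i : C) = 1. Proof. by rewrite -complexiE. Qed.

Definition ReImE :=
  (ReD, ImD, ReN, ImN, ReM, ImM, Re_conj, Im_conj, Re_i, Im_i).

Lemma Re_sum (I : Type) (r : seq I) (P : pred I) (F : I -> C) :
  Re (\sum_(i <- r | P i) F i) = \sum_(i <- r | P i) Re (F i).
Proof. by elim/big_rec2: _ => // i x z _ <-; rewrite ReD. Qed.

Lemma sqr_Re_norm z : Re `|z| ^+ 2 = abs2 z.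
Proof. by rewrite normc_def /= sqr_sqrtr// addr_ge0// sqr_ge0. Qed.

Lemma abs2_ge0 z : 0 <= abs2 z.
Proof. by rewrite addr_ge0// sqr_ge0. Qed.

Lemma abs2_eq0 z : (abs2 z == 0) = (z == 0).
Proof.
rewrite paddr_eq0 ?sqr_ge0// !sqrf_eq0.
by case: z => a b /=; rewrite eq_complex.
Qed.

Lemma abs2_gt0 z : (0 < abs2 z) = (z != 0).
Proof. by rewrite lt_def abs2_ge0 abs2_eq0 andbT. Qed.

Lemma abs20 : abs2 0 = 0. Proof. by rewrite /abs2 /= expr0n addr0. Qed.

Lemma abs2M z w : abs2 (z * w) = abs2 z * abs2 w.
Proof. by rewrite /abs2 !ReImE; ring. Qed.

Lemma abs2N z : abs2 (- z) = abs2 z.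
Proof. by rewrite /abs2 !ReImE !sqrrN. Qed.

Lemma abs2V z : abs2 z^-1 = (abs2 z)^-1.
Proof.
have [->|z0] := eqVneq z 0; first by rewrite invr0 abs20 invr0.
apply: (@mulIf _ (abs2 z)); rewrite ?abs2_eq0// mulVf ?abs2_eq0//.
by rewrite -abs2M mulVf// /abs2 /= expr1n expr0n addr0.
Qed.

Lemma abs2_real x : abs2 x%:C = x ^+ 2.
Proof. by rewrite /abs2 /= expr0n addr0. Qed.

Lemma abs2_conj z : abs2 z^* = abs2 z.
Proof. by rewrite /abs2 !ReImE sqrrN. Qed.

Lemma mul_conj z : z * z^* = (abs2 z)%:C.
Proof. by apply: complexP; rewrite !ReImE /abs2 /=; ring. Qed.

Lemma abs2D z w : abs2 (z + w) <= 2 * abs2 z + 2 * abs2 w.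
Proof.
rewrite /abs2 !ReImE.
have := sqr_ge0 (Re z - Re w); have := sqr_ge0 (Im z - Im w); nra.
Qed.

Lemma abs2B z w : abs2 (z - w) <= 2 * abs2 z + 2 * abs2 w.
Proof. by rewrite -[abs2 w]abs2N abs2D. Qed.

(* the parameter [r] makes the two-term inequality usable as Minkowski's *)
Lemma abs2D_weighted (r : R) z w : 0 < r ->
  abs2 (z + w) <= (1 + r) * abs2 z + (1 + r^-1) * abs2 w.
Proof.
move=> r0; have rV : r * r^-1 = 1 by rewrite mulfV ?gt_eqF.
have V0 : 0 < r^-1 by rewrite invr_gt0.
have E a b : 2 * (a * b) <= r * a ^+ 2 + r^-1 * b ^+ 2.
  have : 0 <= r^-1 * (r * a - b) ^+ 2 by rewrite mulr_ge0 ?sqr_ge0 ?ltW.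
  have -> : r^-1 * (r * a - b) ^+ 2 =
    (r * r^-1) * (r * a ^+ 2) - 2 * ((r * r^-1) * (a * b)) + r^-1 * b ^+ 2.
    by ring.
  by rewrite rV; lra.
have := E (Re z) (Re w); have := E (Im z) (Im w).
rewrite /abs2 !ReImE; nra.
Qed.

Lemma Re_le_abs2 (r : R) z w : 0 < r ->
  2 * Re (z * w) <= r * abs2 z + r^-1 * abs2 w.
Proof.
move=> r0; rewrite -subr_ge0.
(* The second summand is zero since [r * r^-1 = 1]; it is written out because [ring] treats [r^-1]
   as an unrelated variable. *)
have -> : r * abs2 z + r^-1 * abs2 w - 2 * Re (z * w) =
  r^-1 * abs2 (r%:C * z - w^*) + (1 - r * r^-1) *
  (r * abs2 z - 2 * Re (z * w)).
  by rewrite /abs2 !ReImE /=; ring.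
by rewrite mulfV ?gt_eqF// subrr mul0r addr0 mulr_ge0 ?abs2_ge0 ?invr_ge0 ?ltW.
Qed.

(* the conclusion of Cauchy-Schwarz, from the family of arithmetic-geometric
   mean inequalities that [Re_le_abs2] gives when applied to [z^* * w] *)
Lemma le_mul_of_weighted (X A B : R) : 0 <= X -> 0 <= A -> 0 <= B ->
  (forall s, 0 < s -> 2 * X <= s * A + s^-1 * (X * B)) -> X <= A * B.
Proof.
move=> X0 A0; rewrite le_eqVlt => /predU1P[<-|B0] H; last first.
  have := H _ B0; rewrite mulrCA mulVf ?gt_eqF// mulr1.
  by rewrite mulrC; lra.
rewrite mulr0 leNgt; apply/negP => Xgt0.
have A1 : 0 < A + 1 by lra.
have := H (X / (A + 1)) (divr_gt0 Xgt0 A1).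
have : X / (A + 1) * (A + 1) = X by rewrite divfK ?gt_eqF.
have := divr_gt0 Xgt0 A1; rewrite !mulr0; nra.
Qed.

Lemma cauchy_schwarz_sum (I : Type) (r : seq I) (F G : I -> C) :
  abs2 (\sum_(i <- r) F i * G i) <=
  (\sum_(i <- r) abs2 (F i)) * (\sum_(i <- r) abs2 (G i)).
Proof.
set z := \sum_(i <- r) _.
apply: le_mul_of_weighted => [||| s s0]; rewrite ?abs2_ge0 ?sumr_ge0//.
- by move=> i _; rewrite abs2_ge0.
- by move=> i _; rewrite abs2_ge0.
have -> : 2 * abs2 z = \sum_(i <- r) 2 * Re (F i * (z^* * G i)).
  have -> : abs2 z = Re (z^* * z) by rewrite mulrC mul_conj.
  rewrite {2}/z mulr_sumr Re_sum mulr_sumr; apply: eq_bigr => i _.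
  by rewrite mulrCA.
rewrite 2!mulr_sumr mulr_sumr -big_split /=; apply: ler_sum => i _.
by rewrite -[abs2 z]abs2_conj -abs2M Re_le_abs2.
Qed.

Lemma conj_real x : x%:C^* = x%:C. Proof. exact: conjc_real. Qed.

Lemma conj_sum (I : Type) (r : seq I) (P : pred I) (F : I -> C) :
  (\sum_(i <- r | P i) F i)^* = \sum_(i <- r | P i) (F i)^*.
Proof. exact: (raddf_sum (@conjc R)). Qed.

Lemma conjM z w : (z * w)^* = z^* * w^*. Proof. exact: rmorphM. Qed.
Lemma conjB z w : (z - w)^* = z^* - w^*. Proof. exact: rmorphB. Qed.

Lemma cexpD z w : cexp (z + w) = cexp z * cexp w.
Proof.
by apply: complexP; rewrite !ReImE /cexp /= !ReImE expRD ?cosD ?sinD; ring.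
Qed.

Lemma cexp0 : cexp 0 = 1 :> C.
Proof. by apply: complexP; rewrite /= expR0 ?cos0 ?sin0 ?mulr1 ?mulr0. Qed.

Lemma cexp_neq0 z : cexp z != 0.
Proof.
apply/eqP => z0; have := cexpD z (- z); rewrite subrr cexp0 z0 mul0r.
by move/eqP; rewrite oner_eq0.
Qed.

Lemma conj_cexp z : (cexp z)^* = cexp z^*.
Proof. by apply: complexP; rewrite !ReImE /cexp /= !ReImE ?cosN ?sinN ?mulrN. Qed.

Lemma abs2_cexp z : abs2 (cexp z) = expR (2 * Re z).
Proof.
rewrite /abs2 /cexp /= !exprMn -mulrDr cos2Dsin2 mulr1.
by rewrite expr2 -expRD; congr expR; ring.
Qed.

Lemma Re_imul z : Re ('i * z) = - Im z. Proof. by rewrite !ReImE; ring. Qed.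
Lemma Im_imul z : Im ('i * z) = Re z. Proof. by rewrite !ReImE; ring. Qed.

Lemma Re_mulr_real z x : Re (z * x%:C) = Re z * x.
Proof. by rewrite ReM /= mulr0 subr0. Qed.
Lemma Im_mulr_real z x : Im (z * x%:C) = Im z * x.
Proof. by rewrite ImM /= mulr0 add0r. Qed.

End ComplexNumbers.

(** * Matrices of Cauchy kernels *)

Section CauchyMatrix.
Context {R : realType}.
Local Notation C := R[i].

(** Multiplying the displacement equation by [N] on both sides moves it to the inverse, and
    [N *m K *m N] has rank at most that of [K]. For a Cauchy matrix this rank is one, which makes
    the inverse explicit up to a single vector. *)
Lemma displacement_inv (F : fieldType) n (M N Z W K : 'M[F]_n) :
  N *m M = 1%:M -> M *m N = 1%:M -> Z *m M - M *m W = K ->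
  N *m Z - W *m N = N *m K *m N.
Proof.
move=> NM MN <-; rewrite mulmxBr mulmxBl; congr (_ - _).
  by rewrite -!mulmxA MN mulmx1.
by rewrite !mulmxA NM mul1mx.
Qed.

(** For [Im a > 0] the integral of e^{i a t} over t >= 0 is ['i / a], so this is the energy on the
    half-line of the exponential sum with frequencies [zeta] and coefficients [b]. The double sum is
    real; [Re] only changes its type. *)
Definition cauchy_form n (zeta b : 'I_n -> C) : R :=
  Re (\sum_j \sum_k b j * (b k)^* * ('i / (zeta j - (zeta k)^*))).

Section Dual.
Variables (n : nat) (zeta : 'I_n -> C).
Hypothesis zeta_gt0 : forall j, 0 < Im (zeta j).

Let M : 'M[C]_n := \matrix_(j, k) ('i / (zeta j - (zeta k)^*)).
Let eta j : R := 2 * Im (zeta j).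
Let q (u : 'rV[C]_n) : C := \sum_j (u *m M) 0 j * (u 0 j)^*.

Let eta_gt0 j : 0 < eta j. Proof. by rewrite mulr_gt0. Qed.

Let den_neq0 j k : zeta j - (zeta k)^* != 0.
Proof.
apply/eqP => /(congr1 (@Im R)); rewrite !ReImE opprK /= => /eqP.
by rewrite gt_eqF// addr_gt0.
Qed.

Let M_conj j k : (M k j)^* = M j k.
Proof.
rewrite !mxE conjM conjc_inv conjB conjcK.
have -> : ('i : C)^* = - 'i by apply: complexP; rewrite !ReImE ?oppr0.
by rewrite mulNr -mulrN -invrN opprB.
Qed.

Let M_diag j : M j j = ((eta j)^-1)%:C.
Proof.
rewrite mxE; have -> : zeta j - (zeta j)^* = 'i * (eta j)%:C.
  by apply: complexP; rewrite !ReImE /= /eta; ring.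
have i0 : ('i : C) != 0.
  by apply/eqP => /(congr1 (@Im R)) /eqP; rewrite Im_i oner_eq0.
by rewrite invfM mulrA mulfV// mul1r fmorphV.
Qed.

Let qE u : Re (q u) = cauchy_form zeta (fun j => u 0 j).
Proof.
congr Re; rewrite /q exchange_big; apply: eq_bigr => j _.
rewrite mxE mulr_suml; apply: eq_bigr => k _.
by rewrite mxE mulrAC.
Qed.

Variable delta : R.
Hypothesis delta_gt0 : 0 < delta.
Hypothesis form_ge : forall b,
  delta * \sum_j abs2 (b j) / eta j <= cauchy_form zeta b.

Let q_ge (u : 'rV[C]_n) : delta * \sum_j abs2 (u 0 j) / eta j <= Re (q u).
Proof. by rewrite qE form_ge. Qed.

Let M_unit : M \in unitmx.
Proof.
rewrite -row_free_unit; apply: inj_row_free => u uM0.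
have q0 : q u = 0 by rewrite /q uM0 big1// => j _; rewrite mxE mul0r.
have := q_ge u; rewrite q0 /= pmulr_rle0// => le0.
have ge0 j : true -> 0 <= abs2 (u 0 j) / eta j.
  by rewrite divr_ge0 ?abs2_ge0 ?ltW.
have /eqP/psumr_eq0P u0 : \sum_j abs2 (u 0 j) / eta j == 0.
  by rewrite eq_le le0 sumr_ge0.
apply/rowP => j; rewrite mxE; apply/eqP; rewrite -abs2_eq0.
have /eqP := u0 ge0 j isT; rewrite mulf_eq0 invr_eq0 => /orP[//|].
by rewrite gt_eqF.
Qed.

Let N := invmx M.

Let q_inv (x : 'rV[C]_n) : q (x *m N) = \sum_j x 0 j * ((x *m N) 0 j)^*.
Proof. by rewrite /q -mulmxA mulVmx// mulmx1. Qed.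

(** With [u := x *m N], the weighted mean inequality bounds [2 * Re (q u)] by the right side plus
    [delta * \sum_j abs2 (u 0 j) / eta j], and [q_ge] absorbs that last term into one of the two
    copies of [Re (q u)]. *)
Let q_inv_le (x : 'rV[C]_n) :
  Re (q (x *m N)) <= delta^-1 * \sum_j eta j * abs2 (x 0 j).
Proof.
have := q_ge (x *m N); rewrite q_inv; set u := x *m N => qu.
suff : 2 * Re (\sum_j x 0 j * (u 0 j)^*) <=
    delta^-1 * (\sum_j eta j * abs2 (x 0 j)) +
    delta * \sum_j abs2 (u 0 j) / eta j by lra.
rewrite Re_sum 3!mulr_sumr -big_split /=; apply: ler_sum => j _.
set t := delta^-1 * eta j; have t0 : 0 < t by rewrite mulr_gt0 ?invr_gt0.
have -> : delta * (abs2 (u 0 j) / eta j) = t^-1 * abs2 (u 0 j).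
  by rewrite /t [(delta^-1 * _)^-1]invfM invrK; ring.
rewrite mulrA -/t.
by rewrite -[abs2 (u 0 j)]abs2_conj Re_le_abs2.
Qed.

(** The displacement of [M] is ['i] times the all-ones matrix, so that of [N] is ['i] times the
    product of this column of row sums with its conjugate transpose. *)
Let v j : C := \sum_k N j k.

Let N_conj j k : (N k j)^* = N j k.
Proof.
suff : map_mx (@conjc R) N^T = N.
  by move=> /matrixP/(_ j k); rewrite !mxE.
rewrite /N trmx_inv map_invmx; congr invmx.
by apply/matrixP => a b; rewrite 2!mxE; exact: M_conj.
Qed.

(* The displacement identity [Z M - M Z^* = i 1 1^T], [Z] diagonal, turns into
   a displacement identity for the inverse, which is thus again of Cauchy
   type. *)
Let N_cauchy j k : N j k = v j * (v k)^* * M k j.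
Proof.
pose Z := diag_mx (\row_a zeta a); pose Zc := diag_mx (\row_a (zeta a)^*).
have disp : Z *m M - M *m Zc = const_mx 'i.
  apply/matrixP => a b; rewrite mul_diag_mx mul_mx_diag !mxE.
  by rewrite [X in _ - X]mulrC -mulrBl mulrCA mulfV// mulr1.
have := displacement_inv (mulVmx M_unit) (mulmxV M_unit) disp; rewrite -/N.
move=> /matrixP/(_ j k).
rewrite mul_diag_mx mul_mx_diag !mxE => NZ.
have vk : (v k)^* = \sum_a N a k.
  by rewrite /v conj_sum; apply: eq_bigr => a _; rewrite N_conj.
have S : \sum_a (N *m const_mx 'i) j a * N a k = 'i * v j * (v k)^*.
  rewrite vk mulr_sumr; apply: eq_bigr => a _; congr (_ * _).
  rewrite mxE /v mulr_sumr; apply: eq_bigr => b _.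
  by rewrite [const_mx _ _ _]mxE mulrC.
apply: (@mulIf _ (zeta k - (zeta j)^*)) => //.
rewrite -[RHS]mulrA divfK//.
by rewrite mulrBr [N j k * (zeta j)^*]mulrC NZ S; ring.
Qed.

(** For a positive definite matrix the diagonal entries satisfy [M j j * N j j >= 1]. Here [M j j]
    is [1 / eta j], and the Cauchy shape of the inverse makes [N j j] equal to
    [abs2 (v j) / eta j]. *)
Let v_ge j : eta j ^+ 2 <= abs2 (v j).
Proof.
have Njj : N j j = (abs2 (v j) / eta j)%:C.
  by rewrite N_cauchy mul_conj M_diag -rmorphM.
pose e : 'rV[C]_n := delta_mx 0 j.
pose w := (eta j)%:C *: e - e *m N.
have : 0 <= Re (q w).
  apply: le_trans (q_ge w); apply: mulr_ge0; first exact: ltW.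
  by apply: sumr_ge0 => k _; rewrite divr_ge0 ?abs2_ge0 ?ltW.
have eN k : (e *m N) 0 k = N j k by rewrite -rowE mxE.
have eM k : (e *m M) 0 k = M j k by rewrite -rowE mxE.
have sumdelta (F : 'I_n -> C) : \sum_k e 0 k * F k = F j.
  rewrite (bigD1 j)//= big1 => [|k kj]; last first.
    by rewrite mxE eqxx (negPf kj) mul0r.
  by rewrite mxE !eqxx mul1r addr0.
have wM : w *m M = (eta j)%:C *: (e *m M) - e.
  by rewrite mulmxBl -scalemxAl -mulmxA mulVmx// mulmx1.
suff -> : q w = (abs2 (v j) / eta j - eta j)%:C.
  by rewrite /= subr_ge0 ler_pdivlMr// -expr2.
transitivity (\sum_k ((eta j)%:C * M j k - e 0 k) *
    ((eta j)%:C * e 0 k - N k j)).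
  rewrite /q wM; apply: eq_bigr => k _.
  have entry (a : C) (A B : 'rV[C]_n) :
    (a *: A - B) 0 k = a * A 0 k - B 0 k by rewrite !mxE.
  rewrite !entry eN eM conjB conjM conj_real N_conj; congr (_ * (_ * _ - _)).
  by rewrite mxE eqxx andTb; case: eqP; rewrite ?conjc1 ?conjc0.
transitivity (\sum_k (e 0 k * ((eta j)%:C * (eta j)%:C * M j k -
   (eta j)%:C * e 0 k + N k j)) - (eta j)%:C * \sum_k M j k * N k j).
  rewrite mulr_sumr -sumrB; apply: eq_bigr => k _; ring.
rewrite sumdelta; have -> : \sum_k M j k * N k j = 1.
  have : (M *m N) j j = 1 by rewrite mulmxV// mxE eqxx.
  by rewrite mxE.
rewrite Njj M_diag mxE !eqxx !mulr1 -mulrA -rmorphM mulfV ?gt_eqF//.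
by rewrite rmorph1 rmorphB; ring.
Qed.

(** By [N_cauchy] the inverse is the same Cauchy matrix, transposed and rescaled by [v]. Hence the
    form at [b] is the form of the inverse at [conj b / v], which [q_inv_le] bounds from above;
    [v_ge] removes [v] from the result. *)
Lemma cauchy_form_dual b :
  cauchy_form zeta b <= delta^-1 * \sum_j abs2 (b j) / (2 * Im (zeta j)).
Proof.
have v0 j : v j != 0.
  by rewrite -abs2_gt0 (lt_le_trans _ (v_ge j))// exprn_gt0.
pose x : 'rV[C]_n := \row_k ((b k)^* / v k).
have -> : cauchy_form zeta b = Re (q (x *m N)).
  rewrite q_inv /cauchy_form; congr Re.
  rewrite exchange_big /=; apply: eq_bigr => k _.
  rewrite [(x *m N) 0 k]mxE conj_sum mulr_sumr; apply: eq_bigr => j _.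
  rewrite conjM N_conj N_cauchy !mxE conjM conjc_inv conjcK.
  rewrite [RHS](_ : _ = (v k / v k) * ((v j)^* / (v j)^*) * b j * (b k)^* *
    ('i / (zeta j - (zeta k)^*))); last by ring.
  by rewrite !mulfV ?conjc_eq0// !mul1r.
apply: (le_trans (q_inv_le x)).
rewrite ler_pM2l ?invr_gt0//; apply: ler_sum => j _.
rewrite mxE abs2M abs2_conj abs2V -/(eta j) mulrCA ler_wpM2l ?abs2_ge0//.
by rewrite ler_pdivrMr ?abs2_gt0// ler_pdivlMl// -expr2.
Qed.

End Dual.
End CauchyMatrix.

(** * Square integrable complex functions *)

Section ComplexIntegral.
Context {R : realType}.
Local Notation C := R[i].
Local Notation mu := (@lebesgue_measure R).
Implicit Types (D : set R) (f g : R -> C) (phi psi : R -> C).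

Lemma integrableM_cst D (k : R) (f : R -> R) : measurable D ->
  mu.-integrable D (EFin \o f) -> mu.-integrable D (EFin \o (fun t => k * f t)).
Proof.
move=> mD fi.
by apply: (eq_integrable _ _ _ _ (@integrableZl _ _ _ mu D mD k _ fi)).
Qed.

Lemma integrableD_real D (f g : R -> R) : measurable D ->
  mu.-integrable D (EFin \o f) -> mu.-integrable D (EFin \o g) ->
  mu.-integrable D (EFin \o (fun t => f t + g t)).
Proof.
move=> mD fi gi.
by apply: (eq_integrable _ _ _ _ (@integrableD _ _ _ mu D mD _ _ fi gi)).
Qed.

Lemma integrableB_real D (f g : R -> R) : measurable D ->
  mu.-integrable D (EFin \o f) -> mu.-integrable D (EFin \o g) ->
  mu.-integrable D (EFin \o (fun t => f t - g t)).
Proof.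
move=> mD fi gi.
by apply: (eq_integrable _ _ _ _ (@integrableB _ _ _ mu D mD _ _ fi gi)).
Qed.

Lemma le_integrable_real D (f g : R -> R) : measurable D ->
  measurable_fun D f -> (forall x, D x -> `|f x| <= g x) ->
  mu.-integrable D (EFin \o g) -> mu.-integrable D (EFin \o f).
Proof.
move=> mD mf fg; apply: le_integrable => //; first exact/measurable_EFinP.
by move=> x Dx /=; rewrite lee_fin (le_trans (fg _ Dx))// ler_norm.
Qed.

Lemma Rintegral_scale D (k : R) (f : R -> R) : measurable D ->
  mu.-integrable D (EFin \o f) ->
  \int[mu]_(t in D) (k * f t) = k * \int[mu]_(t in D) f t.
Proof. by move=> mD fi; rewrite RintegralZl. Qed.

Lemma integrable_measurable D (f : R -> R) :
  mu.-integrable D (EFin \o f) -> measurable_fun D f.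
Proof. by move=> /(measurable_int mu)/measurable_EFinP. Qed.

Definition cintegrable D f :=
  mu.-integrable D (EFin \o (fun t => Re (f t))) /\
  mu.-integrable D (EFin \o (fun t => Im (f t))).

Lemma cintegrableD D f g : measurable D -> cintegrable D f ->
  cintegrable D g -> cintegrable D (fun t => f t + g t).
Proof.
move=> mD [f1 f2] [g1 g2]; split; [under eq_fun do rewrite ReD|
  under eq_fun do rewrite ImD]; exact: integrableD_real.
Qed.

Lemma cintegrableZ D (k : C) f : measurable D -> cintegrable D f ->
  cintegrable D (fun t => k * f t).
Proof.
move=> mD [f1 f2]; split.
- under eq_fun do rewrite ReM.
  by apply: integrableB_real => //; exact: integrableM_cst.
- under eq_fun do rewrite ImM.
  by apply: integrableD_real => //; exact: integrableM_cst.
Qed.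

Lemma cintegrable0 D : measurable D -> cintegrable D (fun=> 0).
Proof. by move=> mD; split; exact: integrable0. Qed.

Lemma cintegrable_sum D (I : Type) (r : seq I) (F : I -> R -> C) :
  measurable D -> (forall i, cintegrable D (F i)) ->
  cintegrable D (fun t => \sum_(i <- r) F i t).
Proof.
move=> mD FI; elim: r => [|i r IH].
  by under eq_fun do rewrite big_nil; exact: cintegrable0.
by under eq_fun do rewrite big_cons; exact: cintegrableD.
Qed.

Lemma eq_cintegral D f g : (forall t, D t -> f t = g t) ->
  cintegral D f = cintegral D g.
Proof.
by move=> fg; apply: complexP; apply: eq_Rintegral => t /set_mem Dt; rewrite fg.
Qed.

Lemma cintegralD D f g : measurable D -> cintegrable D f -> cintegrable D g ->
  cintegral D (fun t => f t + g t) = cintegral D f + cintegral D g.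
Proof.
move=> mD [f1 f2] [g1 g2]; apply: complexP; rewrite ?ReD ?ImD /=.
  by rewrite -RintegralD//; apply: eq_Rintegral => t _; rewrite ReD.
by rewrite -RintegralD//; apply: eq_Rintegral => t _; rewrite ImD.
Qed.

Lemma cintegralZ D (k : C) f : measurable D -> cintegrable D f ->
  cintegral D (fun t => k * f t) = k * cintegral D f.
Proof.
move=> mD [f1 f2].
apply: complexP; rewrite ?ReM ?ImM /= -!RintegralZl//.
- rewrite -RintegralB//; try exact: integrableM_cst.
  by apply: eq_Rintegral => t _; rewrite ReM.
- rewrite -RintegralD//; try exact: integrableM_cst.
  by apply: eq_Rintegral => t _; rewrite ImM.
Qed.

Lemma cintegral0 D : cintegral D (fun=> 0) = 0.
Proof.
by apply: complexP; rewrite /= /Rintegral integral0_eq.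
Qed.

Lemma cintegral_sum D (I : Type) (r : seq I) (F : I -> R -> C) :
  measurable D -> (forall i, cintegrable D (F i)) ->
  cintegral D (fun t => \sum_(i <- r) F i t) =
  \sum_(i <- r) cintegral D (F i).
Proof.
move=> mD FI; elim: r => [|i r IH].
  by rewrite big_nil; under eq_fun do rewrite big_nil; exact: cintegral0.
rewrite big_cons -IH; under eq_fun do rewrite big_cons.
by rewrite cintegralD//; exact: cintegrable_sum.
Qed.

Lemma cintegral_setU D E f : measurable D -> measurable E ->
  cintegrable (D `|` E) f -> [disjoint D & E] ->
  cintegral (D `|` E) f = cintegral D f + cintegral E f.
Proof.
move=> mD mE [f1 f2] DE.
by apply: complexP; rewrite ?ReD ?ImD /= Rintegral_setU.
Qed.

Definition energy D phi : R := \int[mu]_(t in D) abs2 (phi t).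

Lemma energy_ge0 D phi : 0 <= energy D phi.
Proof. by apply: Rintegral_ge0 => t _; exact: abs2_ge0. Qed.

Lemma measurable_abs2 D phi : measurable_fun D (fun t => Re (phi t)) ->
  measurable_fun D (fun t => Im (phi t)) ->
  measurable_fun D (fun t => abs2 (phi t)).
Proof.
by move=> m1 m2; apply: measurable_funD; exact: measurable_funX.
Qed.

Lemma square_integrableP D phi : measurable D -> square_integrable D phi <->
  [/\ measurable_fun D (fun t => Re (phi t)),
    measurable_fun D (fun t => Im (phi t)) &
    mu.-integrable D (EFin \o (fun t => abs2 (phi t)))].
Proof.
move=> mD; split=> -[m1 m2 fi]; split=> //.
- apply/integrableP; split.
    by apply/measurable_EFinP; exact: (measurable_abs2 m1 m2).
  apply: le_lt_trans fi; rewrite le_eqVlt; apply/orP; left; apply/eqP.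
  by apply: eq_integral => t _ /=; rewrite sqr_Re_norm ger0_norm ?abs2_ge0.
- move/integrableP: fi => [_]; apply: le_lt_trans.
  rewrite le_eqVlt; apply/orP; left; apply/eqP.
  by apply: eq_integral => t _ /=; rewrite sqr_Re_norm ger0_norm ?abs2_ge0.
Qed.

Lemma square_integrable_le D phi psi (k : R) : measurable D ->
  measurable_fun D (fun t => Re (phi t)) ->
  measurable_fun D (fun t => Im (phi t)) ->
  (forall t, D t -> abs2 (phi t) <= k * abs2 (psi t)) ->
  square_integrable D psi -> square_integrable D phi.
Proof.
move=> mD m1 m2 le /(square_integrableP psi mD)[_ _ psii].
apply/square_integrableP => //; split=> //.
apply: (le_integrable_real (g := fun t => k * abs2 (psi t))) => //.
- exact: measurable_abs2.
- by move=> t Dt; rewrite ger0_norm ?abs2_ge0// le.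
- exact: integrableM_cst.
Qed.

Lemma square_integrableD D phi psi : measurable D ->
  square_integrable D phi -> square_integrable D psi ->
  square_integrable D (fun t => phi t + psi t).
Proof.
move=> mD /(square_integrableP phi mD)[m1 m2 fi].
move=> /(square_integrableP psi mD)[m3 m4 gi].
have n1 : measurable_fun D (fun t => Re (phi t + psi t)).
  by under eq_fun do rewrite ReD; exact: measurable_funD.
have n2 : measurable_fun D (fun t => Im (phi t + psi t)).
  by under eq_fun do rewrite ImD; exact: measurable_funD.
apply/square_integrableP => //; split=> //.
apply: (le_integrable_real
    (g := fun t => 2 * abs2 (phi t) + 2 * abs2 (psi t))) => //.
- exact: measurable_abs2.
- by move=> t Dt; rewrite ger0_norm ?abs2_ge0// abs2D.
- by apply: integrableD_real => //; exact: integrableM_cst.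
Qed.

Lemma square_integrableZ D (k : C) phi : measurable D ->
  square_integrable D phi -> square_integrable D (fun t => k * phi t).
Proof.
move=> mD phiS; have [m1 m2 _] := phiS.
apply: (square_integrable_le (k := abs2 k)) phiS => //.
- by under eq_fun do rewrite ReM; apply: measurable_funB; exact: measurable_funM.
- by under eq_fun do rewrite ImM; apply: measurable_funD; exact: measurable_funM.
- by move=> t _; rewrite abs2M.
Qed.

Lemma cintegrableM D phi psi : measurable D ->
  square_integrable D phi -> square_integrable D psi ->
  cintegrable D (fun t => phi t * psi t).
Proof.
move=> mD /(square_integrableP phi mD)[m1 m2 fi].
move=> /(square_integrableP psi mD)[m3 m4 gi].
have dom := integrableD_real mD fi gi.
split; apply: (le_integrable_real _ _ _ dom) => //.
- by under eq_fun do rewrite ReM; apply: measurable_funB; exact: measurable_funM.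
- move=> t _; rewrite ReM /abs2 ler_norml; apply/andP.
  have := sqr_ge0 (Re (phi t) - Re (psi t)).
  have := sqr_ge0 (Re (phi t) + Re (psi t)).
  have := sqr_ge0 (Im (phi t) - Im (psi t)).
  have := sqr_ge0 (Im (phi t) + Im (psi t)).
  rewrite !sqrrD !sqrrN; split; nra.
- by under eq_fun do rewrite ImM; apply: measurable_funD; exact: measurable_funM.
- move=> t _; rewrite ImM /abs2 ler_norml; apply/andP.
  have := sqr_ge0 (Re (phi t) - Im (psi t)).
  have := sqr_ge0 (Re (phi t) + Im (psi t)).
  have := sqr_ge0 (Im (phi t) - Re (psi t)).
  have := sqr_ge0 (Im (phi t) + Re (psi t)).
  rewrite !sqrrD !sqrrN; split; nra.
Qed.

Lemma cauchy_schwarz_cintegral D phi psi : measurable D ->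
  square_integrable D phi -> square_integrable D psi ->
  abs2 (cintegral D (fun t => phi t * psi t)) <= energy D phi * energy D psi.
Proof.
move=> mD phiS psiS; have prodI := cintegrableM mD phiS psiS.
set z := cintegral _ _.
apply: le_mul_of_weighted => [||| s s0]; rewrite ?abs2_ge0 ?energy_ge0//.
have -> : 2 * abs2 z = \int[mu]_(t in D) (2 * Re (z^* * (phi t * psi t))).
  have -> : abs2 z = Re (z^* * z) by rewrite mulrC mul_conj.
  rewrite {2}/z -cintegralZ// RintegralZl//.
  exact: (cintegrableZ z^* mD prodI).1.
have [_ _ fi] := (square_integrableP phi mD).1 phiS.
have [_ _ gi] := (square_integrableP psi mD).1 psiS.
have zi := integrableM_cst (abs2 z) mD gi.
rewrite /energy -(Rintegral_scale _ mD gi) -(Rintegral_scale _ mD zi).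
rewrite -(Rintegral_scale _ mD fi).
have sfi := integrableM_cst s mD fi.
have szi := integrableM_cst s^-1 mD zi.
rewrite -RintegralD//.
apply: le_Rintegral => //.
- by apply: integrableM_cst => //; exact: (cintegrableZ z^* mD prodI).1.
- exact: integrableD_real.
- move=> t _; rewrite -[abs2 z]abs2_conj -abs2M mulrCA.
  exact: Re_le_abs2.
Qed.

Definition ccontinuous f :=
  continuous (fun t => Re (f t)) /\ continuous (fun t => Im (f t)).

Lemma continuous_integrable_itv (f : R -> R) (a b : R) :
  continuous f -> mu.-integrable `[a, b] (EFin \o f).
Proof.
move=> cf; apply: continuous_compact_integrable; first exact: segment_compact.
exact: continuous_subspaceT.
Qed.

Lemma continuous_abs2 f : ccontinuous f -> continuous (fun t => abs2 (f t)).
Proof.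
move=> [c1 c2] t; rewrite /abs2; under eq_fun do rewrite !expr2.
by apply: cvgD; apply: cvgM; do ? [exact: c1|exact: c2].
Qed.

Lemma ccontinuous_square_integrable f (a b : R) :
  ccontinuous f -> square_integrable `[a, b] f.
Proof.
move=> cf; apply/square_integrableP => //; split.
- exact: integrable_measurable (continuous_integrable_itv a b cf.1).
- exact: integrable_measurable (continuous_integrable_itv a b cf.2).
- exact: continuous_integrable_itv (continuous_abs2 cf).
Qed.

Lemma ccontinuousD f g : ccontinuous f -> ccontinuous g ->
  ccontinuous (fun t => f t + g t).
Proof.
move=> [f1 f2] [g1 g2]; split => t.
- by under eq_fun do rewrite ReD; rewrite ?ReD; apply: cvgD; [exact: f1|exact: g1].
- by under eq_fun do rewrite ImD; rewrite ?ImD; apply: cvgD; [exact: f2|exact: g2].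
Qed.

Lemma ccontinuousM f g : ccontinuous f -> ccontinuous g ->
  ccontinuous (fun t => f t * g t).
Proof.
move=> [f1 f2] [g1 g2]; split => t.
- under eq_fun do rewrite ReM.
  by rewrite ?ReM; apply: cvgB; apply: cvgM; do ? [exact: f1|exact: g1|exact: f2|exact: g2].
- under eq_fun do rewrite ImM.
  by rewrite ?ImM; apply: cvgD; apply: cvgM; do ? [exact: f1|exact: g1|exact: f2|exact: g2].
Qed.

Lemma ccontinuous_cst (k : C) : ccontinuous (fun=> k).
Proof. by split=> t; exact: cvg_cst. Qed.

Lemma ccontinuous_sum (I : Type) (r : seq I) (F : I -> R -> C) :
  (forall i, ccontinuous (F i)) -> ccontinuous (fun t => \sum_(i <- r) F i t).
Proof.
move=> FI; elim: r => [|i r IH].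
  by under eq_fun do rewrite big_nil; exact: ccontinuous_cst.
by under eq_fun do rewrite big_cons; exact: ccontinuousD.
Qed.

Lemma ccontinuous_cexp (z : C) : ccontinuous (fun t => cexp (z * t%:C)).
Proof.
have L (k : R) : continuous (fun t : R => k * t).
  by move=> t; apply: cvgM; [exact: cvg_cst|exact: cvg_id].
have E t : {for t, continuous (fun t => expR (Re z * t))}.
  by apply: continuous_comp; [exact: L|exact: continuous_expR].
split=> t; rewrite /cexp /=;
    under eq_fun do rewrite Re_mulr_real Im_mulr_real;
    apply: cvgM; do ? exact: E.
- by apply: continuous_comp; [exact: L|exact: continuous_cos].
- by apply: continuous_comp; [exact: L|exact: continuous_sin].
Qed.

End ComplexIntegral.

(** * Exponential sums *)

Section Exponentials.
Context {R : realType}.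
Local Notation C := R[i].
Local Notation mu := (@lebesgue_measure R).

Lemma Rintegral_derive (F f : R -> R) (a b : R) : a <= b ->
  (forall t : R, is_derive t 1 F (f t)) -> continuous f ->
  \int[mu]_(t in `[a, b]) f t = F b - F a.
Proof.
rewrite le_eqVlt => /predU1P[<-|ab] dF cf.
  by rewrite set_itv1 Rintegral_set1 subrr.
have cF : continuous F.
  by move=> t; apply/differentiable_continuous/derivable1_diffP/ex_derive.
rewrite /Rintegral (continuous_FTC2 (F := F) ab)//.
- exact: continuous_subspaceT.
- split; first by move=> x _; exact: ex_derive.
  + exact/cvg_at_right_filter/cF.
  + exact/cvg_at_left_filter/cF.
- by move=> x _; rewrite derive1E; exact: derive_val.
Qed.

Lemma is_derive_Re_cexp (a z : C) (t : R) :
  is_derive t 1 (fun t => Re (a * cexp (z * t%:C)))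
    (Re (a * z * cexp (z * t%:C))).
Proof.
have L k : is_derive t 1 (fun t : R => k * t) k.
  by apply: is_derive_eq; rewrite /GRing.scale /=; ring.
have dE : is_derive t 1 (fun t => expR (Re z * t)) (expR (Re z * t) * Re z).
  exact: (is_derive1_comp (f := expR)).
have dC : is_derive t 1 (fun t => cos (Im z * t)) (- sin (Im z * t) * Im z).
  exact: (is_derive1_comp (f := @cos R)).
have dS : is_derive t 1 (fun t => sin (Im z * t)) (cos (Im z * t) * Im z).
  exact: (is_derive1_comp (f := @sin R)).
have -> : (fun t => Re (a * cexp (z * t%:C))) = (fun t =>
    Re a * (expR (Re z * t) * cos (Im z * t)) -
    Im a * (expR (Re z * t) * sin (Im z * t))).
  by apply/funext => s; rewrite ReM /cexp /= Re_mulr_real Im_mulr_real.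
apply: is_derive_eq; rewrite /cexp Re_mulr_real Im_mulr_real !ReImE.
by rewrite /GRing.scale /=; ring.
Qed.

Lemma cintegral_cexp (z : C) (a b : R) : a <= b -> z != 0 ->
  cintegral `[a, b] (fun t => cexp (z * t%:C)) =
  (cexp (z * b%:C) - cexp (z * a%:C)) / z.
Proof.
move=> ab z0; have [c1 c2] := ccontinuous_cexp z.
(* A factor [- 'i] in the free coefficient of [is_derive_Re_cexp] turns imaginary parts into real
   ones, so one primitive serves both. *)
have ImE (w : C) : Im w = Re (- 'i * w) by rewrite !ReImE; ring.
have dF (k : C) (t : R) : is_derive t 1 (fun t : R => Re (k * z^-1 * cexp (z * t%:C)))
    (Re (k * cexp (z * t%:C))).
  by apply: is_derive_eq (is_derive_Re_cexp _ _ _) _; rewrite divfK.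
have cRe (k : C) : continuous (fun t : R => Re (k * cexp (z * t%:C))).
  exact: (ccontinuousM (ccontinuous_cst k) (ccontinuous_cexp z)).1.
apply: complexP; rewrite /cintegral /=.
- transitivity (\int[mu]_(t in `[a, b]) Re (1 * cexp (z * t%:C))).
    by apply: eq_Rintegral => t _; rewrite mul1r.
  rewrite (Rintegral_derive ab (dF 1) (cRe 1)) -ReN -ReD; congr Re; ring.
- transitivity (\int[mu]_(t in `[a, b]) Re (- 'i * cexp (z * t%:C))).
    by apply: eq_Rintegral => t _; rewrite -ImE.
  rewrite (Rintegral_derive ab (dF (- 'i)) (cRe (- 'i))) ImE -ReN -ReD.
  congr Re; ring.
Qed.

Lemma cvgn_sum (I : Type) (r : seq I) (f : I -> nat -> R) (l : I -> R) :
  (forall i, f i m @[m --> \oo] --> l i) ->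
  \sum_(i <- r) f i m @[m --> \oo] --> \sum_(i <- r) l i.
Proof.
move=> fl; elim: r => [|i r IH].
  by rewrite big_nil; under eq_fun do rewrite big_nil; exact: cvg_cst.
by rewrite big_cons; under eq_fun do rewrite big_cons; exact: cvgD.
Qed.

Lemma abs2_sum n (b : 'I_n -> C) :
  abs2 (\sum_j b j) = Re (\sum_j \sum_k b j * (b k)^*).
Proof.
rewrite -[abs2 _]/(Re (abs2 _)%:C) -mul_conj conj_sum mulr_suml.
by congr Re; apply: eq_bigr => j _; rewrite mulr_sumr.
Qed.

Section CauchyForm.
Variables (n : nat) (zeta : 'I_n -> C).
Hypothesis zeta_gt0 : forall j, 0 < Im (zeta j).
Implicit Type b : 'I_n -> C.

Let den_neq0 j k : zeta j - (zeta k)^* != 0.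
Proof.
apply/eqP => /(congr1 (@Im R)); rewrite !ReImE opprK /= => /eqP.
by rewrite gt_eqF// addr_gt0.
Qed.

Let form_cexp b (t : R) :
  cauchy_form zeta (fun j => b j * cexp ('i * zeta j * t%:C)) =
  \sum_j \sum_k Re (b j * (b k)^* * ('i / (zeta j - (zeta k)^*)) *
    cexp ('i * (zeta j - (zeta k)^*) * t%:C)).
Proof.
rewrite /cauchy_form Re_sum; apply: eq_bigr => j _; rewrite Re_sum.
apply: eq_bigr => k _; rewrite conjM conj_cexp !conjM conj_real.
have -> : ('i : C)^* = - 'i by apply: complexP; rewrite !ReImE ?oppr0.
have -> : 'i * (zeta j - (zeta k)^*) * t%:C =
  'i * zeta j * t%:C + - 'i * (zeta k)^* * t%:C by ring.
by rewrite cexpD; congr Re; ring.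
Qed.

Lemma ccontinuous_expsum b :
  ccontinuous (fun t => \sum_j b j * cexp ('i * zeta j * t%:C)).
Proof.
apply: ccontinuous_sum => j; apply: ccontinuousM (ccontinuous_cexp _).
exact: ccontinuous_cst.
Qed.

(** Minus the form of the coefficients evolved to time [t] is a primitive of the energy density:
    differentiating an entry yields the factor ['i * (zeta j - conj (zeta k))], which cancels the
    Cauchy denominator. *)
Lemma energy_expsum b (x y : R) : x <= y ->
  energy `[x, y] (fun t => \sum_j b j * cexp ('i * zeta j * t%:C)) =
  cauchy_form zeta (fun j => b j * cexp ('i * zeta j * x%:C)) -
  cauchy_form zeta (fun j => b j * cexp ('i * zeta j * y%:C)).
Proof.
move=> xy; pose F t := - cauchy_form zeta (fun j => b j * cexp ('i * zeta j * t%:C)).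
have dF (t : R) : is_derive t 1 F
    (abs2 (\sum_j b j * cexp ('i * zeta j * t%:C))).
  pose h j k (t : R) := Re (- (b j * (b k)^* * ('i / (zeta j - (zeta k)^*))) *
    cexp ('i * (zeta j - (zeta k)^*) * t%:C)).
  have -> : F = \sum_j \sum_k h j k.
    apply/funext => s; rewrite /F form_cexp -sumrN fct_sumE; apply: eq_bigr => j _.
    rewrite fct_sumE -sumrN; apply: eq_bigr => k _.
    by rewrite /h mulNr ReN.
  apply: is_derive_eq.
    apply: is_derive_sum => j; apply: is_derive_sum => k.
    exact: is_derive_Re_cexp.
  rewrite abs2_sum Re_sum; apply: eq_bigr => j _; rewrite Re_sum.
  apply: eq_bigr => k _; congr Re; rewrite conjM conj_cexp !conjM conj_real.
  have -> : ('i : C)^* = - 'i by apply: complexP; rewrite !ReImE ?oppr0.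
  have -> : 'i * (zeta j - (zeta k)^*) * t%:C =
    'i * zeta j * t%:C + - 'i * (zeta k)^* * t%:C by ring.
  have i2 : ('i : C) * 'i = -1 by rewrite -expr2 sqrCi.
  rewrite cexpD; set e1 := cexp _; set e2 := cexp _.
  set d := zeta j - _.
  have -> : - (b j * (b k)^* * ('i / d)) * ('i * d) * (e1 * e2) =
    - (('i * 'i) * (d / d)) * (b j * e1 * ((b k)^* * e2)) by ring.
  by rewrite i2 mulfV ?den_neq0// mulr1 opprK mul1r.
have cF := continuous_abs2 (ccontinuous_expsum b).
by rewrite /energy (Rintegral_derive xy dF cF) /F opprK addrC.
Qed.

(** By [energy_expsum] the form of the evolved coefficients never exceeds its initial value, and
    along integer times it tends to 0. *)
Lemma cauchy_form_ge0 b : 0 <= cauchy_form zeta b.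
Proof.
pose F (m : nat) :=
  cauchy_form zeta (fun j => b j * cexp ('i * zeta j * (m%:R : R)%:C)).
have F0 : F 0%N = cauchy_form zeta b.
  rewrite /F; congr (cauchy_form _ _); apply/funext => j.
  by rewrite mulr0 cexp0 mulr1.
have Fle m : F m <= F 0%N.
  rewrite -subr_ge0 -(energy_expsum b (ler0n R m)).
  exact: energy_ge0.
suff cvgF : F m @[m --> \oo] --> (0 : R).
  have cF : cvg (F m @[m --> \oo]) by apply/cvg_ex; exists 0.
  rewrite -F0 -(cvg_lim (@Rhausdorff R) cvgF).
  by apply: limr_le => //; exact: nearW.
have -> : F = fun m => \sum_j \sum_k Re (b j * (b k)^* *
    ('i / (zeta j - (zeta k)^*)) * cexp ('i * (zeta j - (zeta k)^*) * m%:R%:C)).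
  by apply/funext => m; exact: form_cexp.
have S0 : \sum_(j < n) \sum_(k < n) 0 = 0 :> R.
  by rewrite big1// => j _; rewrite big1.
rewrite -[X in _ --> X]S0.
apply: cvgn_sum => j; apply: cvgn_sum => k.
set a := _ * ('i / _); set d := zeta j - _.
(* [Im d] is the sum of two positive imaginary parts, so each entry decays geometrically with ratio
   [q]. *)
pose q := expR (- Im d).
have q1 : `|q| < 1.
  rewrite ger0_norm ?expR_ge0// expR_lt1 oppr_lt0 /d !ReImE opprK.
  by rewrite addr_gt0.
have bound m : `|Re (a * cexp ('i * d * m%:R%:C))| <=
    geometric (Num.sqrt (abs2 a)) q m.
  rewrite /geometric /= -sqrtr_sqr -[q ^+ m]ger0_norm ?exprn_ge0 ?expR_ge0//.
  rewrite -(sqrtr_sqr (q ^+ m)) -sqrtrM ?abs2_ge0//; apply: ler_wsqrtr.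
  have -> : abs2 a * (q ^+ m) ^+ 2 = abs2 (a * cexp ('i * d * m%:R%:C)).
    rewrite [abs2 (a * cexp _)]abs2M abs2_cexp Re_mulr_real Re_imul -expRM_natr -expRM_natl.
    by congr (_ * expR _); ring.
  by rewrite /abs2 lerDl sqr_ge0.
have g0 := cvg_geometric (Num.sqrt (abs2 a)) q1.
apply: (squeeze_cvgr (f := fun m => - geometric (Num.sqrt (abs2 a)) q m)
  (h := geometric (Num.sqrt (abs2 a)) q)) => //.
- by apply: nearW => m; rewrite -ler_norml; exact: bound.
- by rewrite -oppr0; exact: cvgN.
Qed.

End CauchyForm.

Lemma energy_le (phi psi : R -> C) (k x y : R) :
  ccontinuous phi -> ccontinuous psi ->
  (forall t, x <= t <= y -> abs2 (phi t) <= k * abs2 (psi t)) ->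
  energy `[x, y] phi <= k * energy `[x, y] psi.
Proof.
move=> cphi cpsi le.
have i1 := continuous_integrable_itv x y (continuous_abs2 cphi).
have i2 := continuous_integrable_itv x y (continuous_abs2 cpsi).
rewrite /energy -Rintegral_scale//; apply: le_Rintegral => //.
exact: integrableM_cst.
Qed.

(* Shifting the points [w j] up by [i] changes the energy on [[-c, c]] by a
   bounded factor and replaces it by a difference of two Cauchy forms; then
   [cauchy_form_dual] turns the lower bound into an upper bound. *)
Lemma energy_expsum_dual (c K M : R) n (w : 'I_n -> C) (N : 'I_n -> R) :
  0 <= c -> 0 < K -> 0 < M -> (forall j, 0 <= Im (w j)) ->
  (forall j, expR (2 * c * (Im (w j) + 1)) / (2 * (Im (w j) + 1)) <= K * N j) ->
  (forall b : 'I_n -> C, \sum_j abs2 (b j) * N j <=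
    M * energy `[- c, c] (fun t => \sum_j b j * cexp ('i * w j * t%:C))) ->
  forall b : 'I_n -> C,
    energy `[- c, c] (fun t => \sum_j b j * cexp ('i * w j * t%:C)) <=
    expR (4 * c) * K ^+ 2 * M * \sum_j abs2 (b j) * N j.
Proof.
move=> c0 K0 M0 w0 N_ge low.
pose zeta j := w j + 'i.
have zeta_gt0 j : 0 < Im (zeta j) by rewrite !ReImE; have := w0 j; lra.
have cc : - c <= c by lra.
pose S (v : 'I_n -> C) b t := \sum_j b j * cexp ('i * v j * t%:C).
have cS v b : ccontinuous (S v b) by exact: ccontinuous_expsum.
have shiftE b t : S zeta b t = S w b t * (expR (- t))%:C.
  rewrite /S mulr_suml; apply: eq_bigr => j _.
  have -> : 'i * zeta j * t%:C = 'i * w j * t%:C + (- t)%:C.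
    have i2 : ('i : C) * 'i = -1 by rewrite -expr2 sqrCi.
    by rewrite /zeta mulrDr i2 rmorphN; ring.
  rewrite cexpD mulrA; congr (_ * _).
  by apply: complexP; rewrite /cexp /= ?cos0 ?sin0 ?mulr1 ?mulr0.
have abs2_shift b t : abs2 (S zeta b t) = abs2 (S w b t) * expR (- (2 * t)).
  by rewrite shiftE abs2M abs2_real expr2 -expRD; congr (_ * expR _); ring.
have le_shift b : energy `[- c, c] (S w b) <=
    expR (2 * c) * energy `[- c, c] (S zeta b).
  apply: energy_le => // t /andP[_ tc].
  rewrite abs2_shift mulrCA -expRD ler_peMr ?abs2_ge0//.
  by rewrite -[leLHS]expR0 ler_expR; lra.
(* Moves the origin of time: the sum with coefficients [down b] has coefficients [b] at [t = - c].
   Thus [cauchy_form zeta b] is its energy on [-c, oo), which dominates the energy on [-c, c]. *)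
pose down b (j : 'I_n) : C := b j * cexp ('i * zeta j * c%:C).
have form_ge b : energy `[- c, c] (S zeta (down b)) <= cauchy_form zeta b.
  rewrite energy_expsum//.
  have -> : (fun j => down b j * cexp ('i * zeta j * (- c)%:C)) = b.
    apply/funext => j; rewrite /down -mulrA -cexpD rmorphN mulrN subrr.
    by rewrite cexp0 mulr1.
  by rewrite gerBl cauchy_form_ge0.
have down_ge b j : abs2 (b j) / (2 * Im (zeta j)) <=
    K * (abs2 (down b j) * N j).
  have -> : abs2 (b j) = abs2 (down b j) * expR (2 * c * (Im (w j) + 1)).
    rewrite abs2M abs2_cexp -mulrA -expRD Re_mulr_real Re_imul.
    rewrite [X in expR X](_ : _ = 0) ?expR0 ?mulr1//.
    by rewrite /zeta !ReImE; ring.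
  rewrite -mulrA [leRHS]mulrCA; apply: ler_wpM2l; first exact: abs2_ge0.
  by rewrite /zeta !ReImE N_ge.
have sum_down_ge b : \sum_j abs2 (b j) / (2 * Im (zeta j)) <=
    K * \sum_j abs2 (down b j) * N j.
  by rewrite mulr_sumr; apply: ler_sum => j _; exact: down_ge.
pose T := K * M * expR (2 * c).
have T0 : 0 < T by rewrite !mulr_gt0 ?expR_gt0.
have lower b : T^-1 * \sum_j abs2 (b j) / (2 * Im (zeta j)) <=
    cauchy_form zeta b.
  rewrite ler_pdivrMl//; apply: (le_trans (sum_down_ge b)).
  rewrite /T -!mulrA ler_pM2l//; apply: (le_trans (low _)).
  rewrite ler_pM2l//; apply: (le_trans (le_shift _)).
  by rewrite ler_pM2l ?expR_gt0.
have TV0 : 0 < T^-1 by rewrite invr_gt0.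
have upper := cauchy_form_dual zeta_gt0 TV0 lower.
rewrite invrK in upper.
move=> b; pose up j := b j * cexp ('i * zeta j * (- c)%:C).
have upK : down up = b.
  apply/funext => j; rewrite /down /up -mulrA -cexpD rmorphN mulrN addrC subrr.
  by rewrite cexp0 mulr1.
apply: (le_trans (le_shift b)); rewrite -{1}upK.
(* [K] and [expR (2 * c)] are each lost twice: once inside [T], when the lower bound is carried to
   the form, and once on the way back to the unshifted sum. *)
have -> : expR (4 * c) * K ^+ 2 * M = expR (2 * c) * (T * K).
  rewrite /T (_ : 4 * c = 2 * c + 2 * c); first by rewrite expRD; ring.
  by ring.
rewrite -mulrA ler_pM2l ?expR_gt0// -(mulrA T).
apply: (le_trans (form_ge up)); apply: (le_trans (upper up)).
by rewrite ler_pM2l// (le_trans (sum_down_ge up))// upK.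
Qed.

(** Conjugation combined with [t -> - t] preserves the symmetric interval and reflects the
    frequencies, which carries the lower half plane to the upper one. *)
Lemma energy_expsum_conj (c : R) n (w b : 'I_n -> C) : 0 <= c ->
  energy `[- c, c] (fun t => \sum_j b j * cexp ('i * w j * t%:C)) =
  energy `[- c, c] (fun t => \sum_j (b j)^* * cexp ('i * (w j)^* * t%:C)).
Proof.
move=> c0; have cF v a := continuous_abs2 (@ccontinuous_expsum n v a).
have cc : - c <= c by lra.
rewrite /energy /Rintegral.
have := integration_by_substitution_oppr cc
  (continuous_subspaceT (cF w b) : {within `[- c, - - c], continuous _}).
rewrite opprK => ->; congr fine; apply: eq_integral => t _ /=.
rewrite -abs2_conj conj_sum; congr (abs2 _)%:E; apply: eq_bigr => j _.
rewrite conjM conj_cexp !conjM conj_real.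
have -> : ('i : C)^* = - 'i by apply: complexP; rewrite !ReImE ?oppr0.
by rewrite rmorphN mulrN !mulNr opprK.
Qed.

End Exponentials.

(** * Square summable families *)

Section SquareSummable.
Context {R : realType}.
Local Notation C := R[i].
Implicit Types (Lam : set C) (a : C -> C).

Lemma sum_uniq_le (I : eqType) (r s : seq I) (F : I -> R) :
  uniq r -> uniq s -> (forall i, 0 <= F i) -> (forall i, i \notin s -> F i = 0) ->
  \sum_(i <- r) F i <= \sum_(i <- s) F i.
Proof.
move=> ur us F0 Fs.
have -> : \sum_(i <- r) F i = \sum_(i <- s | i \in r) F i.
  rewrite (bigID (mem s))/= [X in _ + X]big1 ?addr0 => [|i /Fs//].
  rewrite -big_filter -[RHS]big_filter; apply: perm_big.
  apply: uniq_perm; rewrite ?filter_uniq// => i.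
  by rewrite !mem_filter andbC.
by rewrite [leRHS](bigID (mem r))/= lerDl sumr_ge0.
Qed.

(** Square summability is used throughout as a uniform bound over finite lists without repetition,
    on which all estimates are made. *)
Lemma ell2P Lam a : ell2 Lam a <-> exists K : R, forall r : seq C, uniq r ->
  (forall w, w \in r -> Lam w) -> \sum_(w <- r) abs2 (a w) <= K.
Proof.
have sumE (r : seq C) : uniq r ->
    (\sum_(x \in [set` r]) ((Re `|a x|) ^+ 2)%:E)%E =
    (\sum_(w <- r) abs2 (a w))%:E.
  move=> ur; rewrite -fsbig_seq// sumEFin; congr _%:E.
  by apply: eq_bigr => w _; rewrite sqr_Re_norm.
split => [l|[K bound]].
- have fin : \esum_(w in Lam) ((Re `|a w|) ^+ 2)%:E \is a fin_num.
    by rewrite ge0_fin_numE// esum_ge0// => w _; rewrite lee_fin sqr_ge0.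
  exists (fine (\esum_(w in Lam) ((Re `|a w|) ^+ 2)%:E)) => r ur rL.
  rewrite -lee_fin fineK// -sumE//; apply: ereal_sup_ubound.
  by exists [set` r] => //; split; [exact: finite_seq|exact: rL].
- apply: (@le_lt_trans _ _ K%:E); last exact: ltry.
  apply: ge_ereal_sup => _ [A [finA AL] <-].
  have -> : A = [set` finmap.enum_fset (fset_set A)].
    by apply/seteqP; split => x /=; rewrite in_fset_set// inE.
  rewrite sumE ?finmap.fset_uniq// lee_fin bound ?finmap.fset_uniq//.
  by move=> w; rewrite in_fset_set// inE; exact: AL.
Qed.

(** Minkowski's inequality, from [abs2D_weighted] at the optimal weight [q / p]; strict positivity
    is there because the weight and its inverse both occur. *)
Lemma sum_abs2D (r : seq C) (u v : C -> C) (p q : R) : 0 < p -> 0 < q ->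
  \sum_(w <- r) abs2 (u w) <= p ^+ 2 -> \sum_(w <- r) abs2 (v w) <= q ^+ 2 ->
  \sum_(w <- r) abs2 (u w + v w) <= (p + q) ^+ 2.
Proof.
move=> p0 q0 up vq; have qp0 : 0 < q / p by rewrite divr_gt0.
apply: (@le_trans _ _ ((1 + q / p) * \sum_(w <- r) abs2 (u w) +
   (1 + (q / p)^-1) * \sum_(w <- r) abs2 (v w))).
  rewrite 2!mulr_sumr -big_split /=; apply: ler_sum => w _.
  exact: abs2D_weighted.
have -> : (p + q) ^+ 2 = (1 + q / p) * p ^+ 2 + (1 + (q / p)^-1) * q ^+ 2.
  by rewrite invf_div; field; rewrite !gt_eqF.
by apply: lerD; rewrite ler_pM2l ?addr_gt0 ?invr_gt0.
Qed.

Section SlidingSigns.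
Variables (s : nat -> seq C) (b : nat -> C -> C).
Hypothesis b_off : forall k w, w \notin s k -> b k w = 0.
Hypothesis s_uniq : forall k, uniq (s k).
Hypothesis b_unit : forall k, \sum_(w <- s k) abs2 (b k w) = 1.

Let e k : R := 3^-1 ^+ k.
Let pairing (u v : C -> C) k : C := \sum_(w <- s k) u w * v w.
Let sgn (x : R) : R := if 0 <= x then 1 else -1.

Let step k (u : C -> C) (w : C) : C :=
  u w + (sgn (Re (pairing u (b k) k)) * e k)%:C * (b k w)^*.

Fixpoint sliding k : C -> C :=
  if k is k'.+1 then step k' (sliding k') else fun=> 0.

Let e_gt0 k : 0 < e k. Proof. by rewrite exprn_gt0. Qed.

Let eS k : e k.+1 = e k / 3. Proof. by rewrite /e exprS mulrC. Qed.

Let sgn2 x : sgn x ^+ 2 = 1.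
Proof. by rewrite /sgn; case: ifP; rewrite ?sqrrN expr1n. Qed.

Let b_le (r : seq C) k : uniq r -> \sum_(w <- r) abs2 (b k w) <= 1.
Proof.
move=> ur; rewrite -(b_unit k); apply: sum_uniq_le => // w.
- exact: abs2_ge0.
- by move=> /b_off ->; rewrite abs20.
Qed.

(** As [b k] has unit norm, the step adds [+- e k] to the pairing. The sign follows the real part
    already present, so the two cannot cancel. *)
Let sliding_pairing k : e k ^+ 2 <= abs2 (pairing (sliding k.+1) (b k) k).
Proof.
rewrite /= /step; set t := Re _; set x := sgn t * e k.
have -> : pairing (fun w => sliding k w + x%:C * (b k w)^*) (b k) k =
    pairing (sliding k) (b k) k + x%:C.
  rewrite /pairing -[in RHS](mulr1 x%:C) -[1 in RHS](rmorph1 (real_complex R)).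
  rewrite -(b_unit k) rmorph_sum mulr_sumr -big_split /=.
  apply: eq_bigr => w _; rewrite mulrDl -mulrA; congr (_ + _ * _).
  by rewrite mulrC mul_conj.
rewrite /abs2 ReD -/t; apply: (@le_trans _ _ ((t + x) ^+ 2)); last first.
  by rewrite lerDl sqr_ge0.
have := e_gt0 k; rewrite /x /sgn; case: ifPn => [t0|]; nra.
Qed.

(** The steps from [k] on have norms summing to [3 / 2 * e k]. Subtracting the part not yet used
    makes the induction close, and the strict inequality keeps the radius positive for
    [sum_abs2D]. *)
Let sliding_tail (r : seq C) k K0 : uniq r -> 3 / 2 * e k < K0 -> forall m,
  \sum_(w <- r) abs2 (sliding (k + m)%N w - sliding k w) <=
  (K0 - 3 / 2 * e (k + m)%N) ^+ 2.
Proof.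
move=> ur kK; elim=> [|m IH].
  rewrite addn0 big1 ?sqr_ge0// => w _; by rewrite subrr abs20.
have em : e (k + m)%N <= e k.
  by rewrite /e exprD ler_piMr ?exprn_ge0// exprn_ile1// invf_le1 ?ler1n.
have -> : K0 - 3 / 2 * e (k + m.+1)%N = (K0 - 3 / 2 * e (k + m)%N) + e (k + m)%N.
  by rewrite addnS eS; field.
rewrite addnS /=; under eq_bigr do rewrite /step addrAC.
apply: sum_abs2D => //; first by have := em; lra.
under eq_bigr do rewrite abs2M abs2_conj abs2_real exprMn sgn2 mul1r.
by rewrite -mulr_sumr ler_piMr ?sqr_ge0// b_le.
Qed.

Let cvg_part (f : C -> R) w : (forall z, f z ^+ 2 <= abs2 z) ->
  (forall z u, f (z + u) = f z + f u) -> f 0 = 0 ->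
  cvg (f (sliding m w) @[m --> \oo]).
Proof.
move=> fle fD f0.
pose u k := f ((sgn (Re (pairing (sliding k) (b k) k)) * e k)%:C * (b k w)^*).
have -> : (fun m => f (sliding m w)) = series u.
  apply/funext; elim=> [|m IH]; first by rewrite /series /= big_geq.
  by rewrite seriesSr -IH -fD.
apply: normed_cvg; apply: (@series_le_cvg _ _ (geometric 1 3^-1)).
- by move=> k; exact: normr_ge0.
- by move=> k; rewrite /geometric /= mul1r exprn_ge0.
- move=> k; rewrite /geometric /= mul1r -/(e k).
  rewrite -ler_sqr ?nnegrE ?normr_ge0 ?(ltW (e_gt0 k))// real_normK ?num_real//.
  apply: (le_trans (fle _)).
  rewrite abs2M abs2_conj abs2_real exprMn sgn2 mul1r ler_piMr ?sqr_ge0//.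
  by have := @b_le [:: w] k isT; rewrite big_seq1.
- by apply: is_cvg_geometric_series; rewrite ger0_norm// invf_lt1 ?ltr1n.
Qed.

Let limit w : C := (lim (Re (sliding m w) @[m --> \oo])) +i*
  (lim (Im (sliding m w) @[m --> \oo])).

Let limit_tail (r : seq C) k K0 : uniq r -> 3 / 2 * e k < K0 ->
  \sum_(w <- r) abs2 (limit w - sliding k w) <= K0 ^+ 2.
Proof.
move=> ur kK.
have cvg_term w : abs2 (sliding (k + m)%N w - sliding k w) @[m --> \oo] -->
    abs2 (limit w - sliding k w).
  have shift (f : nat -> R) (l : R) : f m @[m --> \oo] --> l ->
      f (k + m)%N @[m --> \oo] --> l.
    by move=> fl; exact: (cvg_comp _ _ (@cvg_addnl k) fl).
  have cR : Re (sliding (k + m)%N w) @[m --> \oo] --> Re (limit w).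
    have h : Re (sliding m w) @[m --> \oo] --> Re (limit w).
      apply: (@cvg_part (@Re R)) => //; last exact: ReD.
      by move=> z; rewrite lerDl sqr_ge0.
    exact: (shift _ _ h).
  have cI : Im (sliding (k + m)%N w) @[m --> \oo] --> Im (limit w).
    have h : Im (sliding m w) @[m --> \oo] --> Im (limit w).
      apply: (@cvg_part (@Im R)) => //; last exact: ImD.
      by move=> z; rewrite lerDr sqr_ge0.
    exact: (shift _ _ h).
  rewrite /abs2 !ReImE; under eq_fun do rewrite !ReImE !expr2.
  rewrite !expr2; apply: cvgD; apply: cvgM; apply: cvgB => //; exact: cvg_cst.
have cvgS : \sum_(w <- r) abs2 (sliding (k + m)%N w - sliding k w) @[m --> \oo]
    --> \sum_(w <- r) abs2 (limit w - sliding k w) by exact: cvgn_sum.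
have cS : cvg (\sum_(w <- r) abs2 (sliding (k + m)%N w - sliding k w)
    @[m --> \oo]) by apply/cvg_ex; eexists; exact: cvgS.
rewrite -(cvg_lim (@Rhausdorff R) cvgS); apply: limr_le => //.
apply: nearW => m; apply: (le_trans (sliding_tail ur kK m)).
have em : e (k + m)%N <= e k.
  by rewrite /e exprD ler_piMr ?exprn_ge0// exprn_ile1// invf_le1 ?ler1n.
have p1 := e_gt0 (k + m); have p2 := e_gt0 k.
by rewrite ler_sqr ?nnegrE; lra.
Qed.

(* The uniform boundedness principle on [l^2], in the form of Sokal: signs
   [sgn] are chosen one after the other so that the [k]-th functional is not
   small at the [k]-th partial sum of [\sum_k +-3^-k conj (b k)]; the tail of
   the series is too short to spoil this. *)
Lemma exists_ell2_large_pairing : exists2 a : C -> C, ell2 setT a &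
  forall k, (9^-1) ^+ k / 9 <= abs2 (\sum_(w <- s k) a w * b k w).
Proof.
exists limit.
  apply/ell2P; exists (2 ^+ 2) => r ur _.
  have lt2 : 3 / 2 * e 0 < 2 by rewrite /e expr0; lra.
  apply: le_trans (limit_tail ur lt2); rewrite le_eqVlt; apply/orP; left.
  by apply/eqP; apply: eq_bigr => w _; rewrite subr0.
move=> k; set z := \sum_(w <- s k) _.
have zE : pairing (sliding k.+1) (b k) k =
    z + \sum_(w <- s k) (sliding k.+1 w - limit w) * b k w.
  by rewrite -big_split /=; apply: eq_bigr => w _; rewrite -mulrDl addrC subrK.
set y := \sum_(w <- s k) (sliding k.+1 w - limit w) * b k w in zE.
have ek := e_gt0 k.
(* The tail after step [k] has norm at most [3 / 2 * e k.+1], which is [e k / 2]; any constant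
   strictly between 1/2 and 1 leaves room on both sides. *)
have y_le : abs2 y <= (2 / 3 * e k) ^+ 2.
  apply: (le_trans (cauchy_schwarz_sum _ _ _)); rewrite b_unit mulr1.
  under eq_bigr do rewrite -abs2N opprB.
  by apply: limit_tail => //; rewrite eS; lra.
have := sliding_pairing k; rewrite zE => H.
have e9 : (9^-1) ^+ k = e k ^+ 2.
  by rewrite /e exprAC; congr (_ ^+ _); rewrite expr2; field.
rewrite e9.
(* With weight 2, [e^2 <= 3 |z|^2 + (3/2) (4/9) e^2], hence [|z|^2 >= e^2 / 9]. *)
have /(le_trans H) := @abs2D_weighted R 2 z y (ltr0Sn _ 1).
have -> : (2^-1 : R) = 1 / 2 by rewrite div1r.
move: y_le; rewrite exprMn; nra.
Qed.

End SlidingSigns.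
End SquareSummable.

(** * Bessel bound for interpolating sequences *)

Section Bessel.
Context {R : realType}.
Local Notation C := R[i].
Variables (c : R) (Z : set C) (N : C -> R) (K : R).
Local Notation I := `[- c, c]%classic.
Local Notation transform phi w :=
  (cintegral I (fun t => phi t * cexp ('i * w * t%:C))).

Definition expsum (r : seq C) (b : C -> C) (t : R) : C :=
  \sum_(w <- r) b w * cexp ('i * w * t%:C).

Lemma ccontinuous_expsum_seq r b : ccontinuous (expsum r b).
Proof.
apply: ccontinuous_sum => w; apply: ccontinuousM (ccontinuous_cexp _).
exact: ccontinuous_cst.
Qed.

Lemma square_integrable_cexp (z : C) (x y : R) :
  square_integrable `[x, y] (fun t => cexp (z * t%:C)).
Proof. exact/ccontinuous_square_integrable/ccontinuous_cexp. Qed.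

Lemma transform_expsum (phi : R -> C) r b : square_integrable I phi ->
  \sum_(w <- r) b w * transform phi w =
  cintegral I (fun t => phi t * expsum r b t).
Proof.
move=> phiS.
have F w : cintegrable I (fun t => phi t * cexp ('i * w * t%:C)).
  by apply: cintegrableM => //; exact: square_integrable_cexp.
transitivity (cintegral I
    (fun t => \sum_(w <- r) b w * (phi t * cexp ('i * w * t%:C)))).
  rewrite cintegral_sum// => [|w]; last exact: cintegrableZ.
  by apply: eq_bigr => w _; rewrite cintegralZ.
apply: eq_cintegral => t _; rewrite /expsum mulr_sumr.
by apply: eq_bigr => w _; rewrite mulrCA.
Qed.

Hypothesis c_ge0 : 0 <= c.
Hypothesis K_gt0 : 0 < K.
Hypothesis N_ge : forall w, Z w ->
  expR (2 * c * (`|Im w| + 1)) / (2 * (`|Im w| + 1)) <= K * N w.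
Hypothesis interpolation : forall a : C -> C, ell2 Z a ->
  exists2 phi : R -> C, square_integrable I phi &
    forall w, Z w -> transform phi w = a w * (Num.sqrt (N w))%:C.

Let N_gt0 w : Z w -> 0 < N w.
Proof.
move=> Zw; rewrite -(pmulr_rgt0 _ K_gt0); apply: lt_le_trans (N_ge Zw).
by rewrite divr_gt0 ?expR_gt0// mulr_gt0// ltr_wpDl.
Qed.

Let sub (r : seq C) := forall w, w \in r -> Z w.

(** If no [M] works, then for each [k] some sum has energy too small by a factor [16 ^+ k].
    Normalized, these are the functionals of [exists_ell2_large_pairing]; interpolating the
    resulting family by [phi] bounds the [k]-th pairing by [energy I phi / 16 ^+ k], against the
    lower bound of order [9 ^- k]. The base 16 only has to exceed 9. *)
Lemma expsum_lower_bound : exists2 M : R, 0 < M &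
  forall (r : seq C) (b : C -> C), uniq r -> sub r ->
  \sum_(w <- r) abs2 (b w) * N w <= M * energy I (expsum r b).
Proof.
apply: contrapT => nbound.
have /choice[p pP] : forall k : nat, exists p : seq C * (C -> C),
    [/\ uniq p.1, sub p.1 &
      16 ^+ k * energy I (expsum p.1 p.2) <
      \sum_(w <- p.1) abs2 (p.2 w) * N w].
  move=> k; apply: contrapT => np; apply: nbound; exists (16 ^+ k).
    by rewrite exprn_gt0.
  move=> r b ur rZ; rewrite leNgt; apply/negP => lt; apply: np.
  by exists (r, b).
pose T k := \sum_(w <- (p k).1) abs2 ((p k).2 w) * N w.
have T_gt0 k : 0 < T k.
  have [_ _] := pP k; apply: le_lt_trans.
  by rewrite mulr_ge0 ?exprn_ge0 ?energy_ge0.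
(* The denominator gives [b k] unit norm; the numerator matches the factor [Num.sqrt (N w)] of the
   interpolated data, so that pairing with [a] becomes pairing with the transforms of [phi]. *)
pose rt k w : R := Num.sqrt (N w) / Num.sqrt (T k).
pose b k w := if w \in (p k).1 then (p k).2 w * (rt k w)%:C else 0.
have rt2 k w : Z w -> rt k w ^+ 2 = N w / T k.
  by move=> Zw; rewrite exprMn exprVn !sqr_sqrtr ?ltW// N_gt0.
have b_off k w : w \notin (p k).1 -> b k w = 0 by rewrite /b => /negPf ->.
have s_uniq k : uniq (p k).1 by have [] := pP k.
have b_unit k : \sum_(w <- (p k).1) abs2 (b k w) = 1.
  have [_ pZ _] := pP k.
  transitivity (\sum_(w <- (p k).1) abs2 ((p k).2 w) * N w / T k).
    rewrite big_seq [RHS]big_seq; apply: eq_bigr => w wp.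
    by rewrite /b wp abs2M abs2_real rt2 ?mulrA//; exact: pZ.
  by rewrite -mulr_suml -/(T k) mulfV// gt_eqF.
have [a a2 large] := exists_ell2_large_pairing b_off s_uniq b_unit.
have [|phi phiS phiP] := @interpolation a.
  have /ell2P[B aB] := a2; apply/ell2P; exists B => r ur _; exact: aB.
have small k : abs2 (\sum_(w <- (p k).1) a w * b k w) <=
    energy I phi / 16 ^+ k.
  have [_ pZ lt] := pP k.
  have -> : \sum_(w <- (p k).1) a w * b k w = ((Num.sqrt (T k))^-1)%:C *
      \sum_(w <- (p k).1) (p k).2 w * transform phi w.
    rewrite mulr_sumr big_seq [RHS]big_seq; apply: eq_bigr => w wp.
    by rewrite /b wp (phiP _ (pZ _ wp)) /rt rmorphM; ring.
  rewrite transform_expsum// abs2M abs2_real exprVn sqr_sqrtr; last exact: ltW.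
  have /(le_trans _) cs : energy I phi * energy I (expsum (p k).1 (p k).2) <=
      energy I phi * (T k / 16 ^+ k).
    rewrite ler_wpM2l ?energy_ge0// ler_pdivlMr ?exprn_gt0// mulrC.
    exact: ltW.
  rewrite ler_pdivrMl// mulrCA; apply: cs.
  apply: cauchy_schwarz_cintegral => //.
  exact/ccontinuous_square_integrable/ccontinuous_expsum_seq.
have growth k : (16 / 9) ^+ k <= 9 * energy I phi.
  have := le_trans (large k) (small k).
  rewrite ler_pdivrMr// mulrAC ler_pdivlMr ?exprn_gt0// -exprMn.
  by rewrite [_ * 9]mulrC [9^-1 * 16]mulrC.
have linear k : k%:R * (7 / 9) <= (16 / 9) ^+ k :> R.
  elim: k => [|k IH]; first by rewrite mul0r expr0.
  have ge1 : 1 <= (16 / 9) ^+ k :> R by apply: exprn_ege1; lra.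
  by rewrite exprS -natr1; move: ((16 / 9) ^+ k) ge1 IH => q ge1 IH; lra.
have E0 := energy_ge0 I phi.
have arch : 0 <= 9 / 7 * (9 * energy I phi) by rewrite !mulr_ge0.
have := archi_boundP arch.
have := le_trans (linear (Num.bound (9 / 7 * (9 * energy I phi)))) (growth _).
by move: (energy I phi) (_%:R) => x y; lra.
Qed.

Let big_tnth_seq (r : seq C) (F : C -> R) :
  \sum_(w <- r) F w = \sum_(j < size r) F (nth 0 r j).
Proof. by rewrite (big_nth 0) big_mkord. Qed.

Let expsum_ord (r : seq C) b :
  expsum r b = (fun t => \sum_(j < size r) b (nth 0 r j) *
    cexp ('i * nth 0 r j * t%:C)).
Proof. by apply/funext => t; rewrite /expsum (big_nth 0) big_mkord. Qed.

(** Turns coefficients attached to positions, as in the matrix part, into coefficients attached to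
    nodes; on a list without repetition [index] undoes [nth]. Off the list the value is 0. *)
Let ofords (r : seq C) (b : 'I_(size r) -> C) (w : C) : C :=
  if insub (index w r) is Some j then b j else 0.

Let ofordsE (r : seq C) (b : 'I_(size r) -> C) (j : 'I_(size r)) :
  uniq r -> ofords b (nth 0 r j) = b j.
Proof. by move=> ur; rewrite /ofords index_uniq// valK. Qed.

(** The nodes lie in one closed half plane because the Cauchy form requires positive imaginary parts
    after a shift by ['i]. In the lower half plane both the lower bound fed to the duality and the
    upper bound it returns are reflected by [energy_expsum_conj]. *)
Lemma expsum_upper_bound : exists2 U : R, 0 < U &
  forall (r : seq C) (b : C -> C), uniq r -> sub r ->
  (forall w, w \in r -> 0 <= Im w) \/ (forall w, w \in r -> Im w <= 0) ->
  energy I (expsum r b) <= U * \sum_(w <- r) abs2 (b w) * N w.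
Proof.
have [M M0 low] := expsum_lower_bound.
exists (expR (4 * c) * K ^+ 2 * M).
  by rewrite !mulr_gt0 ?expR_gt0 ?exprn_gt0.
move=> r b ur rZ sign; rewrite big_tnth_seq expsum_ord.
pose w (j : 'I_(size r)) := nth 0 r j.
have wr j : w j \in r by exact: mem_nth.
have lowI (a : 'I_(size r) -> C) : \sum_j abs2 (a j) * N (w j) <=
    M * energy I (fun t => \sum_j a j * cexp ('i * w j * t%:C)).
  have := low r (ofords a) ur rZ; rewrite big_tnth_seq expsum_ord.
  under eq_bigr do rewrite ofordsE//.
  by under [X in energy _ X]eq_fun do under eq_bigr do rewrite ofordsE//.
case: sign => sign.
- apply: (energy_expsum_dual (w := w) (N := fun j => N (w j))
      c_ge0 K_gt0 M0) lowI _ => j; first exact: sign.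
  by have := N_ge (rZ _ (wr j)); rewrite ger0_norm// sign.
- rewrite (energy_expsum_conj w (fun j => b (w j)) c_ge0).
  under eq_bigr do rewrite -abs2_conj.
  apply: (energy_expsum_dual (w := fun j => (w j)^*) (N := fun j => N (w j))
      c_ge0 K_gt0 M0) => j.
  + by rewrite Im_conj oppr_ge0; exact: sign.
  + by have := N_ge (rZ _ (wr j)); rewrite Im_conj ler0_norm// sign.
  + have := lowI (fun k => (j k)^*); rewrite energy_expsum_conj//.
    under eq_bigr do rewrite abs2_conj.
    by under [X in energy _ X]eq_fun do under eq_bigr do rewrite conjcK.
Qed.

(** The adjoint form of [expsum_upper_bound], on each half plane separately; adding the halves gives
    [U + U]. *)
Lemma bessel : exists B : R, forall (phi : R -> C) (r : seq C),
  square_integrable I phi -> uniq r -> sub r ->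
  \sum_(w <- r) abs2 (transform phi w) / N w <= B * energy I phi.
Proof.
have [U U0 up] := expsum_upper_bound.
have half (phi : R -> C) (r : seq C) : square_integrable I phi -> uniq r ->
  sub r ->
  (forall w, w \in r -> 0 <= Im w) \/ (forall w, w \in r -> Im w <= 0) ->
  \sum_(w <- r) abs2 (transform phi w) / N w <= U * energy I phi.
  move=> phiS ur rZ sign; set X := \sum_(w <- r) _.
  (* With these coefficients both the pairing with the transforms and the weighted sum of
     [abs2 (b w)] equal [X], so Cauchy-Schwarz reads [X ^+ 2 <= U * energy I phi * X]. *)
  pose b w := (transform phi w)^* / (N w)%:C.
  have X0 : 0 <= X.
    rewrite /X big_seq sumr_ge0// => w wr.
    by rewrite divr_ge0 ?abs2_ge0// ltW// N_gt0//; exact: rZ.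
  have sumb : \sum_(w <- r) b w * transform phi w = X%:C.
    rewrite /X rmorph_sum; apply: eq_bigr => w _.
    by rewrite /b mulrAC mulrC [_^* * _]mulrC mul_conj rmorphM fmorphV mulrC.
  have sumbN : \sum_(w <- r) abs2 (b w) * N w = X.
    rewrite /X big_seq [RHS]big_seq; apply: eq_bigr => w wr.
    have N0 := N_gt0 (rZ _ wr).
    rewrite /b abs2M abs2_conj abs2V abs2_real.
    by field; rewrite gt_eqF.
  have : X ^+ 2 <= U * energy I phi * X.
    rewrite -abs2_real -sumb transform_expsum//.
    apply: (le_trans (cauchy_schwarz_cintegral _ phiS _)) => //.
      exact/ccontinuous_square_integrable/ccontinuous_expsum_seq.
    rewrite mulrAC [leRHS]mulrC ler_wpM2l ?energy_ge0//.
    by rewrite -sumbN; exact: up.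
  have [->|Xn0] := eqVneq X 0; first by rewrite mulr_ge0 ?energy_ge0// ltW.
  by rewrite expr2 ler_pM2r// lt_def Xn0.
exists (U + U) => phi r phiS ur rZ.
rewrite (bigID (fun w : C => 0 <= Im w)) /= mulrDl; apply: lerD.
- rewrite -big_filter; apply: half => //; first exact: filter_uniq.
  + by move=> w; rewrite mem_filter => /andP[_ /rZ].
  + by left=> w; rewrite mem_filter => /andP[].
- rewrite -big_filter; apply: half => //; first exact: filter_uniq.
  + by move=> w; rewrite mem_filter => /andP[_ /rZ].
  + by right=> w; rewrite mem_filter -ltNge => /andP[/ltW].
Qed.

End Bessel.

(** * Translation of integrals *)

Section Translation.
Context {R : realType}.
Local Notation C := R[i].
Local Notation mu := (@lebesgue_measure R).
Implicit Types (D : set R) (h : R).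

Let shiftR h : R -> measurableTypeR R := fun x => x + h.

Let measurable_shift h : measurable_fun [set: measurableTypeR R] (shiftR h).
Proof.
have m : measurable_fun [set: R] (fun x : R => x + h).
  by apply: measurable_funD => //; exact: measurable_cst.
exact: m.
Qed.

(** Lebesgue measure is determined by its values on half-open intervals, whose lengths are unchanged
    by a shift. *)
Lemma lebesgue_measure_shift D h : measurable D ->
  pushforward mu (shiftR h) D = mu D.
Proof.
move=> mD; apply/esym/lebesgue_measure_unique => //= _ [[a b]] _ <-.
rewrite /pushforward.
have -> : shiftR h @^-1` `]a, b]%classic = `](a - h), (b - h)]%classic.
  by apply/seteqP; split=> x /=; rewrite !in_itv /= /shiftR ltrBlDr lerBrDr.
rewrite !lebesgue_measure_itv /= !lte_fin ltrD2r.
by case: ifP => // _; rewrite -!EFinB; congr _%:E; ring.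
Qed.

Lemma ge0_integral_shift D h (f : R -> \bar R) : measurable D ->
  measurable_fun D f -> (forall x, D x -> (0 <= f x)%E) ->
  (\int[mu]_(x in D) f x =
   \int[mu]_(x in [set x | D (x + h)%R]) f (x + h)%R)%E.
Proof.
move=> mD mf f0.
transitivity (\int[pushforward mu (shiftR h)]_(x in D) f x)%E.
  apply: eq_measure_integral => //= A mA _.
  exact/esym/lebesgue_measure_shift.
rewrite (ge0_integral_pushforward (measurable_shift h))//.
by move=> x /set_mem; exact: f0.
Qed.

Lemma integral_shift D h (f : R -> \bar R) : measurable D ->
  measurable_fun D f ->
  (\int[mu]_(x in D) f x =
   \int[mu]_(x in [set x | D (x + h)%R]) f (x + h)%R)%E.
Proof.
move=> mD mf; rewrite integralE [RHS]integralE.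
rewrite (ge0_integral_shift h mD (measurable_funepos mf))//.
rewrite (ge0_integral_shift h mD (measurable_funeneg mf))//.
by congr (_ - _)%E; apply: eq_integral => x _; rewrite ?funeposE ?funenegE.
Qed.

Lemma Rintegral_shift D h (f : R -> R) : measurable D -> measurable_fun D f ->
  \int[mu]_(x in D) f x = \int[mu]_(x in [set x | D (x + h)]) f (x + h).
Proof.
move=> mD mf; rewrite /Rintegral (integral_shift h mD)//.
exact/measurable_EFinP.
Qed.

Lemma measurable_preimage_shift D h : measurable D ->
  measurable [set x | D (x + h)].
Proof.
move=> mD; have := measurable_shift h measurableT mD; rewrite setTI; exact.
Qed.

Lemma measurable_fun_shift D h (f : R -> R) : measurable D ->
  measurable_fun D f -> measurable_fun [set x | D (x + h)] (fun x => f (x + h)).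
Proof.
move=> mD mf; apply: (measurable_comp (F := D) _ _ mf) => //.
- by move=> _ [x Dx <-].
- exact: measurable_funS (measurable_shift h).
Qed.

Lemma integrable_shift D h (f : R -> R) : measurable D ->
  mu.-integrable D (EFin \o f) ->
  mu.-integrable [set x | D (x + h)] (EFin \o (fun x => f (x + h))).
Proof.
move=> mD /integrableP[mf fi]; apply/integrableP; split.
  apply/measurable_EFinP; apply: measurable_fun_shift => //.
  exact/measurable_EFinP.
rewrite (ge0_integral_shift h mD) in fi => //.
by apply: measurableT_comp.
Qed.

Lemma square_integrable_shift D h (phi : R -> C) : measurable D ->
  square_integrable D phi ->
  square_integrable [set x | D (x + h)] (fun x => phi (x + h)).
Proof.
move=> mD /square_integrableP[]// m1 m2 fi.
apply/square_integrableP; first exact: measurable_preimage_shift.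
split.
- exact: (@measurable_fun_shift D h (fun x => Re (phi x))).
- exact: (@measurable_fun_shift D h (fun x => Im (phi x))).
- exact: (@integrable_shift D h (fun x => abs2 (phi x))).
Qed.

Lemma cintegral_shift D h (f : R -> C) : measurable D -> cintegrable D f ->
  cintegral D f = cintegral [set x | D (x + h)] (fun x => f (x + h)).
Proof.
move=> mD [f1 f2]; apply: complexP; rewrite /cintegral /=.
- exact: (Rintegral_shift h mD (integrable_measurable f1)).
- exact: (Rintegral_shift h mD (integrable_measurable f2)).
Qed.

Lemma itv_shift (a b h : R) :
  [set x | `[a, b]%classic (x + h)] = `[a - h, b - h]%classic.
Proof.
by apply/seteqP; split=> x /=; rewrite !in_itv /= lerBlDr lerBrDr.
Qed.

End Translation.

(** * Norms of kernels over an interval *)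

Section Kernels.
Context {R : realType}.
Local Notation C := R[i].
Local Notation mu := (@lebesgue_measure R).
Implicit Types (lam z : C) (x u y : R).

Lemma PWnorm_sqr (f : C -> C) :
  PWnorm f ^+ 2 = (2 * pi)^-1 * energy setT (fun x => f x%:C).
Proof.
rewrite /PWnorm; have -> : Re (PWdot f f) = (2 * pi)^-1 * energy setT (fun x => f x%:C).
  rewrite /PWdot ReM /= mul0r subr0; congr (_ * _).
  by apply: eq_Rintegral => x _; rewrite mul_conj.
by rewrite sqr_sqrtr// mulr_ge0 ?energy_ge0// invr_ge0 mulr_ge0 ?pi_ge0.
Qed.

Lemma PWnorm_ge0 (f : C -> C) : 0 <= PWnorm f.
Proof. exact: sqrtr_ge0. Qed.

Lemma PWnorm_sqr_le (f g : C -> C) (k : R) :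
  energy setT (fun x => f x%:C) <= k * energy setT (fun x => g x%:C) ->
  PWnorm f ^+ 2 <= k * PWnorm g ^+ 2.
Proof.
rewrite !PWnorm_sqr mulrCA => fg; apply: ler_wpM2l fg.
by rewrite invr_ge0 mulr_ge0 ?pi_ge0.
Qed.

(** The sign [s] covers sine and cosine at once: [-1] for the kernel of an interval and for the sine
    at the nodes, [1] for the cosine factor of the two bands. *)
Lemma abs2_cexp_pair (s : R) z : s ^+ 2 = 1 ->
  abs2 (cexp z + s%:C * cexp (- z)) =
  expR (2 * Re z) + expR (- (2 * Re z)) + s * (2 * cos (2 * Im z)).
Proof.
move=> s2; rewrite /abs2 /cexp !ReImE /= cosN sinN.
have E1 : expR (2 * Re z) = expR (Re z) ^+ 2 by rewrite expRM_natl.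
have E2 : expR (- (2 * Re z)) = expR (- Re z) ^+ 2 by rewrite -mulrN expRM_natl.
have E3 : expR (Re z) * expR (- Re z) = 1 by rewrite -expRD subrr expR0.
have C2 : cos (2 * Im z) = cos (Im z) ^+ 2 - sin (Im z) ^+ 2.
  by rewrite mulr_natl mulr2n cosD !expr2.
rewrite E1 E2 C2; have CS := cos2Dsin2 (Im z).
transitivity ((expR (Re z) ^+ 2 + s ^+ 2 * expR (- Re z) ^+ 2) *
   (cos (Im z) ^+ 2 + sin (Im z) ^+ 2) +
   (expR (Re z) * expR (- Re z)) * (s * (2 * (cos (Im z) ^+ 2 - sin (Im z) ^+ 2)))).
  by ring.
by rewrite CS E3 s2; ring.
Qed.

Lemma integrable_oneDsqrV : mu.-integrable setT (EFin \o (fun u => (oneDsqr u)^-1)).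
Proof.
have V0 u : 0 <= (oneDsqr u)^-1.
  by rewrite invr_ge0 (le_trans ler01)// oneDsqr_ge1.
apply/integrableP; split.
  by apply/measurable_EFinP; apply: continuous_measurable_fun continuous_oneDsqrV.
under eq_integral do rewrite /= ger0_norm//.
rewrite ge0_symfun_integralT//; last 2 first.
- exact: continuous_oneDsqrV.
- by move=> u; rewrite /oneDsqr /= sqrrN.
by rewrite -set_itvcy integral0y_oneDsqr -EFinM ltry.
Qed.

Lemma Rintegral_ge_itv (g : R -> R) (a b k : R) : a <= b ->
  (forall x, 0 <= g x) -> mu.-integrable setT (EFin \o g) ->
  (forall x, a <= x <= b -> k <= g x) -> k * (b - a) <= \int[mu]_x g x.
Proof.
move=> ab g0 gi kg.
have giab : mu.-integrable `[a, b] (EFin \o g).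
  exact: (integrableS (measurableT : measurable (setT : set (measurableTypeR R)))).
apply: (@le_trans _ _ (\int[mu]_(x in `[a, b]) g x)).
  have -> : k * (b - a) = \int[mu]_(x in `[a, b]) k.
    rewrite Rintegral_cst//= lebesgue_measure_itv /= lte_fin.
    by case: ltgtP ab => //= ->; rewrite subrr.
  apply: le_Rintegral => //.
  by apply: continuous_integrable_itv => x; exact: cvg_cst.
apply: fine_le.
- exact: (integrable_fin_num _ giab).
- exact: (integrable_fin_num _ gi).
- apply: ge0_subset_integral => //; last by move=> x _; rewrite lee_fin.
  exact: (measurable_int mu gi).
Qed.

Section IntervalKernel.
Variable c : R.
Hypothesis c_ge0 : 0 <= c.
Local Notation I := `[- c, c]%classic.

Let nodes_neq lam x : (x != Re lam) || (Im lam != 0) -> x%:C - lam^* != 0.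
Proof.
apply: contraTneq => /eqP; rewrite subr_eq0 eq_sym => /eqP lamx.
have := congr1 (@Re R) lamx; have := congr1 (@Im R) lamx.
rewrite Re_conj Im_conj /= => /eqP; rewrite oppr_eq0 => /eqP -> ->.
by rewrite !eqxx.
Qed.

Lemma abs2_kernelE lam x : (x != Re lam) || (Im lam != 0) ->
  abs2 (PWkernel I lam x%:C) =
  (expR (2 * (c * Im lam)) + expR (- (2 * (c * Im lam))) -
     2 * cos (2 * (c * (x - Re lam)))) /
  ((x - Re lam) ^+ 2 + Im lam ^+ 2).
Proof.
move=> /nodes_neq; rewrite /PWkernel; set th := x%:C - _ => th0.
have i0 : ('i : C) != 0.
  by apply/eqP => /(congr1 (@Im R)) /eqP; rewrite Im_i oner_eq0.
have cc : - c <= c by move: c_ge0; lra.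
rewrite (cintegral_cexp cc) ?mulf_neq0//.
rewrite abs2M abs2V abs2M.
have -> : abs2 ('i : C) = 1 by rewrite /abs2 Re_i Im_i expr0n expr1n add0r.
rewrite rmorphN mulrN.
have := @abs2_cexp_pair (-1) ('i * th * c%:C).
rewrite rmorphN rmorph1 mulN1r => ->; last by rewrite sqrrN expr1n.
rewrite Re_mulr_real Im_mulr_real Re_imul Im_imul mul1r.
congr (_ / _).
- rewrite /th !ReImE /= opprK add0r mulN1r.
  rewrite mulNr mulrN opprK [Im lam * c]mulrC [_ * c]mulrC.
  by rewrite [expR (- _) + _]addrC.
- by rewrite /abs2 /th !ReImE /= opprK add0r.
Qed.

(** Sum of two bounds: Cauchy-Schwarz gives [4 * c ^+ 2 * E], also at the point where the closed
    formula degenerates, and the closed formula gives [4 * E / u ^+ 2] elsewhere. *)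
Lemma abs2_kernel_le lam x : abs2 (PWkernel I lam x%:C) <=
  4 * (c ^+ 2 + 1) * expR (2 * (c * `|Im lam|)) * (oneDsqr (x - Re lam))^-1.
Proof.
set E := expR _; set u := x - Re lam.
have E0 : 0 < E by exact: expR_gt0.
have bound1 : abs2 (PWkernel I lam x%:C) <= 4 * c ^+ 2 * E.
  have one := @ccontinuous_cst R 1.
  have cc : - c <= c by move: c_ge0; lra.
  have energy1 : energy I (fun=> 1 : C) = 2 * c.
    rewrite /energy; have -> : abs2 (1 : C) = 1.
      by rewrite /abs2 /= expr1n expr0n addr0.
    rewrite Rintegral_cst//= lebesgue_measure_itv /= lte_fin mul1r.
    by move: cc; case: ltgtP => //= [_|e] _; lra.
  have := cauchy_schwarz_cintegral (D := I) _ (ccontinuous_square_integrable _ _ one)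
    (square_integrable_cexp ('i * (x%:C - lam^*)) _ _).
  rewrite energy1.
  have -> : cintegral I (fun t => 1 * cexp ('i * (x%:C - lam^*) * t%:C)) =
      PWkernel I lam x%:C.
    by apply: eq_cintegral => t _; rewrite mul1r.
  move=> /(_ (measurable_itv _))/le_trans; apply.
  have le2 : energy I (fun t => cexp ('i * (x%:C - lam^*) * t%:C)) <= E * (2 * c).
    rewrite -energy1; apply: energy_le one _ => [|t tc]; first exact: ccontinuous_cexp.
    rewrite abs2_cexp Re_mulr_real Re_imul !ReImE /= opprK add0r.
    have -> : abs2 (1 : C) = 1 by rewrite /abs2 /= expr1n expr0n addr0.
    rewrite mulr1 ler_expR ler_pM2l// mulNr -mulrN [leRHS]mulrC.
    apply: (le_trans (ler_norm _)); rewrite normrM normrN ler_wpM2l//.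
    by rewrite ler_norml.
  have c2 : 0 <= 2 * c by rewrite mulr_ge0.
  have -> : 4 * c ^+ 2 * E = 2 * c * (E * (2 * c)) by ring.
  by rewrite ler_wpM2l.
have bound2 : abs2 (PWkernel I lam x%:C) * u ^+ 2 <= 4 * E.
  have [u0|u0] := eqVneq u 0; first by rewrite u0 expr0n mulr0 mulr_ge0 ?ltW.
  have xl : (x != Re lam) || (Im lam != 0) by rewrite -subr_eq0 u0.
  rewrite abs2_kernelE// -/u.
  have u2 : 0 < u ^+ 2 by rewrite exprn_even_gt0.
  have y2 := sqr_ge0 (Im lam).
  rewrite mulrAC ler_pdivrMr; last by lra.
  have E1 : 1 <= E by rewrite -[leLHS]expR0 ler_expR !mulr_ge0.
  have le1 : expR (2 * (c * Im lam)) <= E.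
    by rewrite ler_expR ler_pM2l// ler_wpM2l// ler_norm.
  have le2 : expR (- (2 * (c * Im lam))) <= E.
    by rewrite -!mulrN ler_expR ler_pM2l// ler_wpM2l// -normrN ler_norm.
  have := cos_geN1 (2 * (c * u)).
  have e1 := expR_gt0 (2 * (c * Im lam)).
  have e2 := expR_gt0 (- (2 * (c * Im lam))).
  move=> cosg; apply: (@le_trans _ _ (4 * E * u ^+ 2)).
    by rewrite ler_pM2r//; lra.
  by rewrite ler_pM2l ?mulr_gt0//; lra.
rewrite ler_pdivlMr; last by rewrite (lt_le_trans ltr01)// oneDsqr_ge1.
by rewrite /oneDsqr mulrDr mulr1; lra.
Qed.

(** The closed formula is continuous off [Re lam]. That one point is split off since the formula
    divides by zero there when [lam] is real. *)
Lemma measurable_abs2_kernel lam :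
  measurable_fun setT (fun x => abs2 (PWkernel I lam x%:C)).
Proof.
have mC : measurable (~` [set Re lam]) by exact: measurableC.
rewrite -(setUv [set Re lam]); apply/measurable_funU => //.
split; first exact: measurable_fun_set1.
pose g x := (expR (2 * (c * Im lam)) + expR (- (2 * (c * Im lam))) -
     2 * cos (2 * (c * (x - Re lam)))) /
  ((x - Re lam) ^+ 2 + Im lam ^+ 2).
apply: (@eq_measurable_fun _ _ _ _ _ g).
  by move=> x /set_mem /eqP xl; rewrite abs2_kernelE ?xl.
apply: open_continuous_measurable_fun.
  exact/closed_openC/accessible_closed_set1/hausdorff_accessible/Rhausdorff.
move=> x /set_mem /eqP xl.
have sub : (fun x => x - Re lam) x @[x --> x] --> x - Re lam.
  by apply: cvgB; [exact: cvg_id|exact: cvg_cst].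
apply: cvgM.
- apply: cvgB; first exact: cvg_cst.
  apply: cvgM; first exact: cvg_cst.
  have lin : 2 * (c * (t - Re lam)) @[t --> x] --> 2 * (c * (x - Re lam)).
    by do 2 (apply: cvgM; first exact: cvg_cst).
  exact: (cvg_comp _ _ lin (@continuous_cos R _)).
- apply: cvgV.
    by rewrite gt_eqF// ltr_pwDl ?sqr_ge0// exprn_even_gt0//= subr_eq0.
  apply: cvgD; last exact: cvg_cst.
  by under eq_fun do rewrite expr2; rewrite expr2; exact: cvgM.
Qed.

Let kernel_bound lam x := 4 * (c ^+ 2 + 1) * expR (2 * (c * `|Im lam|)) *
  (oneDsqr (x - Re lam))^-1.

Let integrable_shift_oneDsqrV lam :
  mu.-integrable setT (EFin \o (fun x => (oneDsqr (x - Re lam))^-1)).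
Proof.
have := integrable_shift (- Re lam) measurableT integrable_oneDsqrV.
by rewrite (_ : [set x | setT (x - Re lam)] = setT)//; apply/seteqP.
Qed.

Lemma integrable_kernel lam :
  mu.-integrable setT (EFin \o (fun x => abs2 (PWkernel I lam x%:C))).
Proof.
apply: (le_integrable_real (g := kernel_bound lam)) => //.
- exact: measurable_abs2_kernel.
- by move=> x _; rewrite ger0_norm ?abs2_ge0// abs2_kernel_le.
- exact: integrableM_cst.
Qed.

Lemma energy_kernel_le lam :
  energy setT (fun x => PWkernel I lam x%:C) <=
  4 * (c ^+ 2 + 1) * expR (2 * (c * `|Im lam|)) * \int[mu]_u (oneDsqr u)^-1.
Proof.
have -> : \int[mu]_u (oneDsqr u)^-1 = \int[mu]_x (oneDsqr (x - Re lam))^-1.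
  rewrite (Rintegral_shift (- Re lam) measurableT).
    by rewrite (_ : [set x | setT (x - Re lam)] = setT)//; apply/seteqP.
  exact: integrable_measurable integrable_oneDsqrV.
rewrite -Rintegral_scale//; apply: le_Rintegral => //.
- exact: integrable_kernel.
- exact: integrableM_cst.
- by move=> x _; exact: abs2_kernel_le.
Qed.

End IntervalKernel.
End Kernels.

(** * The two bands as translates of an interval *)

Section TwoBands.
Context {R : realType}.
Local Notation C := R[i].
Local Notation mu := (@lebesgue_measure R).
Local Notation I := (`[- (pi / 4), pi / 4]%classic : set R).
Local Notation E1 := (`[- pi, - (pi / 2)]%classic : set R).
Local Notation E2 := (`[pi / 2, pi]%classic : set R).
Local Notation E := (`[- pi, - (pi / 2)] `|` `[pi / 2, pi] : set R).
Local Notation al := (3 * (pi / 4) : R).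
Implicit Types (lam z : C) (f phi : R -> C).

Let pi0 : 0 < pi :> R. Proof. exact: pi_gt0. Qed.

Let disjE : [disjoint E1 & E2].
Proof.
apply/disj_setPS => x [/=]; rewrite !in_itv /= => /andP[_ x1] /andP[x2 _].
by have := pi0; lra.
Qed.

Let shift1 : [set x | E1 (x + - al)] = I.
Proof.
rewrite itv_shift (_ : - pi - - al = - (pi / 4)); last by lra.
by rewrite (_ : - (pi / 2) - - al = pi / 4); last lra.
Qed.

Let shift2 : [set x | E2 (x + al)] = I.
Proof.
rewrite itv_shift (_ : pi / 2 - al = - (pi / 4)); last by lra.
by rewrite (_ : pi - al = pi / 4); last lra.
Qed.

Lemma measurable_bands : measurable E.
Proof. exact: measurableU. Qed.

Lemma cintegral_bands f : cintegrable E f ->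
  cintegral E f = cintegral I (fun t => f (t - al)) +
    cintegral I (fun t => f (t + al)).
Proof.
move=> fE; have [fE1 fE2] := fE.
have sub D : measurable D -> D `<=` E -> cintegrable D f.
  move=> mD DE; split; [apply: integrableS fE1|apply: integrableS fE2] => //;
  exact: measurable_bands.
have sub1 : cintegrable E1 f by apply: sub => //; exact: subsetUl.
have sub2 : cintegrable E2 f by apply: sub => //; exact: subsetUr.
rewrite cintegral_setU// (cintegral_shift (- al) _ sub1)//.
by rewrite (cintegral_shift al _ sub2)// shift1 shift2.
Qed.

Lemma square_integrable_bands phi : square_integrable E phi ->
  square_integrable I (fun t => phi (t - al)) /\
  square_integrable I (fun t => phi (t + al)).
Proof.
move=> /(square_integrableP phi measurable_bands)[m1 m2 fi].
have sub D : measurable D -> D `<=` E -> square_integrable D phi.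
  move=> mD DE; apply/square_integrableP => //; split.
  - exact: measurable_funS measurable_bands DE m1.
  - exact: measurable_funS measurable_bands DE m2.
  - by apply: integrableS fi => //; exact: measurable_bands.
split.
- rewrite -shift1; apply: square_integrable_shift => //.
  by apply: sub => //; exact: subsetUl.
- rewrite -shift2; apply: square_integrable_shift => //.
  by apply: sub => //; exact: subsetUr.
Qed.

Definition glue phi1 phi2 : R -> C :=
  fun t => if t < 0 then phi1 (t + al) else phi2 (t - al).

Lemma glue1 phi1 phi2 t : I t -> glue phi1 phi2 (t - al) = phi1 t.
Proof.
rewrite /= in_itv /= => /andP[t1 t2]; rewrite /glue subrK.
by rewrite ifT//; have := pi0; lra.
Qed.

Lemma glue2 phi1 phi2 t : I t -> glue phi1 phi2 (t + al) = phi2 t.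
Proof.
rewrite /= in_itv /= => /andP[t1 t2]; rewrite /glue addrK.
by rewrite ifF//; apply/negbTE; rewrite -leNgt; have := pi0; lra.
Qed.

Lemma square_integrable_setU (D D' : set R) phi : measurable D -> measurable D' ->
  [disjoint D & D'] -> square_integrable D phi -> square_integrable D' phi ->
  square_integrable (D `|` D') phi.
Proof.
move=> mD mD' DD' [m1 m2 fi] [m3 m4 gi].
have m13 : measurable_fun (D `|` D') (fun t => Re (phi t)).
  by apply/measurable_funU.
have m24 : measurable_fun (D `|` D') (fun t => Im (phi t)).
  by apply/measurable_funU.
split=> //; rewrite ge0_integral_setU//.
- exact: lte_add_pinfty.
- apply/measurable_EFinP; under eq_fun do rewrite sqr_Re_norm.
  exact: (measurable_abs2 m13 m24).
- by move=> t _; rewrite lee_fin sqr_ge0.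
Qed.

Lemma square_integrable_glue phi1 phi2 : square_integrable I phi1 ->
  square_integrable I phi2 -> square_integrable E (glue phi1 phi2).
Proof.
have eqS (D : set R) f g : {in D, f =1 g} -> square_integrable D f ->
    square_integrable D g.
  move=> fg [m1 m2 fi]; split.
  - by apply: eq_measurable_fun m1 => t /fg ->.
  - by apply: eq_measurable_fun m2 => t /fg ->.
  - by apply: le_lt_trans fi; rewrite le_eqVlt; apply/orP; left; apply/eqP;
      apply: eq_integral => t /fg ->.
have unshift1 : [set x | I (x + al)] = E1.
  rewrite itv_shift (_ : - (pi / 4) - al = - pi); last by lra.
  by rewrite (_ : pi / 4 - al = - (pi / 2)); last lra.
have unshift2 : [set x | I (x + - al)] = E2.
  rewrite itv_shift (_ : - (pi / 4) - - al = pi / 2); last by lra.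
  by rewrite (_ : pi / 4 - - al = pi); last lra.
move=> /(square_integrable_shift al (measurable_itv _)); rewrite unshift1 => S1.
move=> /(square_integrable_shift (- al) (measurable_itv _)).
rewrite unshift2 => S2.
apply: square_integrable_setU => //.
- apply: eqS S1 => t /set_mem; rewrite /= in_itv /= => /andP[_ t1].
  by rewrite /glue ifT//; have := pi0; lra.
- apply: eqS S2 => t /set_mem; rewrite /= in_itv /= => /andP[t1 _].
  by rewrite /glue ifF//; apply/negbTE; rewrite -leNgt; have := pi0; lra.
Qed.

Lemma transform_bands phi z : square_integrable E phi ->
  cintegral E (fun t => phi t * cexp ('i * z * t%:C)) =
  cexp (- ('i * z * al%:C)) *
    cintegral I (fun t => phi (t - al) * cexp ('i * z * t%:C)) +
  cexp ('i * z * al%:C) *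
    cintegral I (fun t => phi (t + al) * cexp ('i * z * t%:C)).
Proof.
move=> phiE; have [phi1 phi2] := square_integrable_bands phiE.
have expI (x y : R) := square_integrable_cexp ('i * z) x y.
have expE : square_integrable E (fun t => cexp ('i * z * t%:C)).
  by apply: square_integrable_setU.
rewrite cintegral_bands; last exact: cintegrableM measurable_bands phiE expE.
congr (_ + _); rewrite -cintegralZ//; try exact: cintegrableM.
- apply: eq_cintegral => t _; rewrite [RHS]mulrCA -cexpD; congr (_ * cexp _).
  by rewrite rmorphB; ring.
- apply: eq_cintegral => t _; rewrite [RHS]mulrCA -cexpD; congr (_ * cexp _).
  by rewrite rmorphD; ring.
Qed.

Lemma kernel_bands lam z : PWkernel E lam z =
  (cexp ('i * (z - lam^*) * al%:C) + cexp (- ('i * (z - lam^*) * al%:C))) *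
  PWkernel I lam z.
Proof.
have oneE : square_integrable E (fun=> 1).
  by apply: square_integrable_setU => //;
    exact/ccontinuous_square_integrable/ccontinuous_cst.
have := transform_bands (z - lam^*) oneE.
have -> : cintegral E (fun t => 1 * cexp ('i * (z - lam^*) * t%:C)) =
    PWkernel E lam z.
  by apply: eq_cintegral => t _; rewrite mul1r.
have -> : cintegral I (fun t => 1 * cexp ('i * (z - lam^*) * t%:C)) =
    PWkernel I lam z.
  by apply: eq_cintegral => t _; rewrite mul1r.
by move=> ->; ring.
Qed.

(* |2 cos (al theta)|^2 for theta = x - lam^* *)
Let factor lam (x : R) : R :=
  expR (2 * (al * Im lam)) + expR (- (2 * (al * Im lam))) +
  2 * cos (2 * (al * (x - Re lam))).

Let abs2_kernel_bands lam (x : R) : abs2 (PWkernel E lam x%:C) =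
  factor lam x * abs2 (PWkernel I lam x%:C).
Proof.
rewrite kernel_bands abs2M; congr (_ * _).
have := @abs2_cexp_pair R 1 ('i * (x%:C - lam^*) * al%:C).
rewrite rmorph1 !mul1r => ->; last by rewrite expr1n.
rewrite Re_mulr_real Im_mulr_real Re_imul Im_imul.
rewrite !ReImE /= opprK add0r mulNr mulrN opprK.
by rewrite /factor [Im lam * _]mulrC [(x - _) * _]mulrC [X in X + 2 * _]addrC.
Qed.

Let factor_le lam x : 0 <= factor lam x <= 4 * expR (2 * (al * `|Im lam|)).
Proof.
have al0 : 0 <= al by have := pi0; lra.
have E1' : 1 <= expR (2 * (al * `|Im lam|)).
  by rewrite -[leLHS]expR0 ler_expR mulr_ge0// mulr_ge0.
have le1 : expR (2 * (al * Im lam)) <= expR (2 * (al * `|Im lam|)).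
  by rewrite ler_expR ler_pM2l// ler_wpM2l// ler_norm.
have le2 : expR (- (2 * (al * Im lam))) <= expR (2 * (al * `|Im lam|)).
  by rewrite -!mulrN ler_expR ler_pM2l// ler_wpM2l// -normrN ler_norm.
have c1 := cos_le1 (2 * (al * (x - Re lam))).
have c2 := cos_geN1 (2 * (al * (x - Re lam))).
have prod : expR (2 * (al * Im lam)) * expR (- (2 * (al * Im lam))) = 1.
  by rewrite -expRD subrr expR0.
have e1 := expR_gt0 (2 * (al * Im lam)).
have e2 := expR_gt0 (- (2 * (al * Im lam))).
rewrite /factor; apply/andP; split; last by lra.
have := sqr_ge0 (expR (2 * (al * Im lam)) - expR (- (2 * (al * Im lam)))).
move: (expR (2 * (al * Im lam))) (expR (- (2 * (al * Im lam)))) prod e1 e2.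
move=> p q pq p0 q0; rewrite sqrrB => _.
suff : 2 <= p + q by lra.
have pq2 : 2 ^+ 2 <= (p + q) ^+ 2.
  by have := sqr_ge0 (p - q); rewrite !expr2; lra.
by rewrite -ler_sqr ?nnegrE//; lra.
Qed.

Let pi4_ge0 : 0 <= pi / 4 :> R. Proof. by have := pi0; lra. Qed.

Let measurable_factor lam : measurable_fun setT (factor lam).
Proof.
apply: continuous_measurable_fun => x; rewrite /factor.
apply: cvgD; first exact: cvg_cst.
apply: cvgM; first exact: cvg_cst.
have lin : 2 * (al * (t - Re lam)) @[t --> x] --> 2 * (al * (x - Re lam)).
  do 2 (apply: cvgM; first exact: cvg_cst).
  by apply: cvgB; [exact: cvg_id|exact: cvg_cst].
exact: (cvg_comp _ _ lin (@continuous_cos R _)).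
Qed.

Let integrable_kernel_bands lam :
  mu.-integrable setT (EFin \o (fun x => abs2 (PWkernel E lam x%:C))).
Proof.
under eq_fun do rewrite abs2_kernel_bands.
apply: (le_integrable_real (g := fun x => 4 * expR (2 * (al * `|Im lam|)) *
  abs2 (PWkernel I lam x%:C))) => //.
- apply: measurable_funM; first exact: measurable_factor.
  exact: measurable_abs2_kernel.
- move=> x _; have /andP[f0 f1] := factor_le lam x.
  by rewrite ger0_norm ?mulr_ge0 ?abs2_ge0// ler_wpM2r ?abs2_ge0.
- by apply: integrableM_cst => //; exact: integrable_kernel.
Qed.

(** A pointwise bound on the cosine factor, integrated. Its growth is the one that [abs2_sine_ge]
    recovers from the division by the sine. *)
Lemma PWnorm_bands_le lam : PWnorm (PWkernel E lam) ^+ 2 <=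
  4 * expR (2 * (al * `|Im lam|)) * PWnorm (PWkernel I lam) ^+ 2.
Proof.
have key : energy setT (fun x => PWkernel E lam x%:C) <=
    4 * expR (2 * (al * `|Im lam|)) * energy setT (fun x => PWkernel I lam x%:C).
  have ki := integrable_kernel pi4_ge0 lam.
  rewrite /energy -Rintegral_scale//; apply: le_Rintegral => //.
  - exact: integrableM_cst.
  - move=> x _; rewrite abs2_kernel_bands; have /andP[_] := factor_le lam x.
    by move=> f1; apply: ler_wpM2r f1; exact: abs2_ge0.
exact: PWnorm_sqr_le key.
Qed.

Let a_ lam : R := `|Im lam|.
(** A lower bound for the kernel on the window from [Re lam + 1] to [Re lam + 2 + a_ lam]. The
    window has length [1 + a_ lam] against a denominator of order its square, which leaves the
    correct order e^{pi a / 2} / (1 + a) for the squared norm. *)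
Let kappa lam : R :=
  4^-1 * expR (2 * (pi / 4 * a_ lam)) / ((2 + a_ lam) ^+ 2 + a_ lam ^+ 2).

Let den_gt0 lam : 0 < (2 + a_ lam) ^+ 2 + a_ lam ^+ 2.
Proof.
have a0 : 0 <= a_ lam by exact: normr_ge0.
by rewrite ltr_pwDl ?sqr_ge0// exprn_gt0//; lra.
Qed.

Let kappa_gt0 lam : 0 < kappa lam.
Proof. by rewrite divr_gt0 ?den_gt0// mulr_gt0 ?expR_gt0. Qed.

(** With X = e^{pi a / 2} the numerator is X + 1/X - 2 cos(pi u / 2). For a <= 1 one has 1 <= u <= 3
    and the cosine is nonpositive. For a > 1 one has X >= 2, hence X + 1/X - 2 >= X/4 with equality
    at X = 2, the origin of the factor 1/4. *)
Let kernel_ge lam x : Re lam + 1 <= x <= Re lam + (2 + a_ lam) ->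
  kappa lam <= abs2 (PWkernel I lam x%:C).
Proof.
move=> /andP[x1 x2]; set u := x - Re lam.
have u1 : 1 <= u by rewrite /u; lra.
have u2 : u <= 2 + a_ lam by rewrite /u; lra.
have a0 : 0 <= a_ lam by exact: normr_ge0.
have neq : (x != Re lam) || (Im lam != 0).
  by rewrite -subr_eq0 -/u gt_eqF//; lra.
rewrite (abs2_kernelE pi4_ge0 neq) -/u /kappa.
have ud : u ^+ 2 + Im lam ^+ 2 <= (2 + a_ lam) ^+ 2 + a_ lam ^+ 2.
  by rewrite /a_ real_normK ?num_real// lerD2r ler_sqr ?nnegrE//; lra.
have u0 : 0 < u ^+ 2 + Im lam ^+ 2.
  by rewrite ltr_pwDl ?sqr_ge0// exprn_gt0//; lra.
set X := expR (2 * (pi / 4 * a_ lam)).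
suff num : 4^-1 * X <= expR (2 * (pi / 4 * Im lam)) +
    expR (- (2 * (pi / 4 * Im lam))) - 2 * cos (2 * (pi / 4 * u)).
  apply: ler_pM => //; first by rewrite mulr_ge0 ?expR_ge0.
    by rewrite invr_ge0 ltW.
  by rewrite lef_pV2 ?posrE.
have -> : expR (2 * (pi / 4 * Im lam)) + expR (- (2 * (pi / 4 * Im lam))) =
    X + X^-1.
  rewrite /X -expRN /a_; case: (ler0P (Im lam)) => _ //.
  by rewrite !mulrN opprK addrC.
have X0 : 0 < X by exact: expR_gt0.
have XV0 : 0 < X^-1 by rewrite invr_gt0.
have [a1|a1] := leP (a_ lam) 1.
- suff : cos (2 * (pi / 4 * u)) <= 0 by lra.
  have -> : 2 * (pi / 4 * u) = (2 * (pi / 4 * u) - pi) + pi by ring.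
  rewrite cosDpi oppr_le0 cos_ge0_pihalf//; have := pi0 => p0.
  by apply/andP; split; nra.
- have X2 : 2 <= X.
    apply: le_trans (expR_ge1Dx _).
    have := @pihalf_ge1 R; nra.
  have XX : X * X^-1 = 1 by rewrite mulfV ?gt_eqF.
  have := cos_le1 (2 * (pi / 4 * u)); nra.
Qed.

(** Puts the kernel norms in the form that [bessel] requires of its weight. In the constant
    [20 * pi * T], [2 * pi] undoes the normalization of the inner product and [T] accounts for the
    shift of the imaginary part by one. *)
Lemma PWnorm_kernel_ge : exists2 K : R, 0 < K & forall lam,
  expR (2 * (pi / 4) * (`|Im lam| + 1)) / (2 * (`|Im lam| + 1)) <=
  K * PWnorm (PWkernel I lam) ^+ 2.
Proof.
pose T := expR (2 * (pi / 4)) : R.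
have T0 : 0 < T by exact: expR_gt0.
exists (20 * pi * T) => [|lam]; first by rewrite !mulr_gt0.
have a0 : 0 <= a_ lam by exact: normr_ge0.
have low : kappa lam * (1 + a_ lam) <=
    energy setT (fun x => PWkernel I lam x%:C).
  have -> : 1 + a_ lam = Re lam + (2 + a_ lam) - (Re lam + 1) by ring.
  apply: Rintegral_ge_itv; first by lra.
  - by move=> x; exact: abs2_ge0.
  - exact: integrable_kernel pi4_ge0 lam.
  - by move=> x; exact: kernel_ge.
rewrite PWnorm_sqr -/(a_ lam).
rewrite [expR _](_ : _ = T * expR (2 * (pi / 4 * a_ lam))); last first.
  by rewrite /T -expRD; congr expR; ring.
set X := expR _; have X0 : 0 < X by exact: expR_gt0.
have p2 : 2 * pi * (2 * pi)^-1 = 1 :> R by rewrite mulfV// gt_eqF ?mulr_gt0 ?pi0.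
move: (energy _ _) low => W low.
have -> : 20 * pi * T * ((2 * pi)^-1 * W) =
    T * (10 * (2 * pi * (2 * pi)^-1) * W) by ring.
rewrite p2 mulr1.
rewrite -mulrA ler_pM2l//.
apply: (@le_trans _ _ (10 * (kappa lam * (1 + a_ lam)))); last first.
  by rewrite ler_pM2l.
rewrite /kappa -/X.
rewrite ler_pdivrMr; last by rewrite mulr_gt0//; lra.
have -> : 10 * (4^-1 * X / ((2 + a_ lam) ^+ 2 + a_ lam ^+ 2) * (1 + a_ lam)) *
   (2 * (a_ lam + 1)) = X * (5 * (1 + a_ lam) ^+ 2 /
     ((2 + a_ lam) ^+ 2 + a_ lam ^+ 2)).
  by field; rewrite gt_eqF ?den_gt0.
apply: ler_peMr; first exact: ltW.
rewrite ler_pdivlMr ?den_gt0// mul1r.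
by rewrite !expr2; nra.
Qed.

Lemma PWnorm_kernel_real_le : exists K : R, forall x : R,
  PWnorm (PWkernel I x%:C) ^+ 2 <= K.
Proof.
exists ((2 * pi)^-1 * (4 * ((pi / 4) ^+ 2 + 1) * \int[mu]_u (oneDsqr u)^-1)).
move=> x; rewrite PWnorm_sqr ler_wpM2l ?invr_ge0 ?mulr_ge0 ?pi_ge0//.
have := energy_kernel_le pi4_ge0 x%:C.
by rewrite /= normr0 !mulr0 expR0 mulr1.
Qed.

Lemma PWnorm_bands_gt0 lam : 0 < PWnorm (PWkernel E lam).
Proof.
rewrite lt_def PWnorm_ge0 andbT -sqrf_eq0 PWnorm_sqr gt_eqF//.
rewrite mulr_gt0 ?invr_gt0 ?mulr_gt0//.
have a0 : 0 <= a_ lam by exact: normr_ge0.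
have k0 := kappa_gt0 lam.
(* On this window [2 * (al * (x - Re lam))] runs from 2 pi to 5 pi / 2, where the cosine is
   nonnegative, so [factor] is at least 1; the window also lies in the range of [kernel_ge]. *)
apply: (@lt_le_trans _ _ (kappa lam * (Re lam + 5 / 3 - (Re lam + 4 / 3)))).
  by rewrite mulr_gt0//; lra.
apply: Rintegral_ge_itv; first by lra.
- by move=> x; exact: abs2_ge0.
- exact: integrable_kernel_bands.
- move=> x /andP[x1 x2]; rewrite abs2_kernel_bands.
  apply: (@le_trans _ _ (abs2 (PWkernel I lam x%:C))).
    by apply: kernel_ge; apply/andP; split; lra.
  rewrite ler_peMl ?abs2_ge0// /factor.
  have cos0 : 0 <= cos (2 * (al * (x - Re lam))).
    have -> : 2 * (al * (x - Re lam)) =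
      (2 * (al * (x - Re lam)) - pi *+ 2) + pi *+ 2 by ring.
    rewrite cosD2pi; apply: cos_ge0_pihalf; rewrite [pi *+ 2]mulr2n.
    have p0 := pi0.
    have v1 : 0 <= pi * (x - Re lam - 4 / 3) by rewrite mulr_ge0 ?pi_ge0//; lra.
    have v2 : 0 <= pi * (5 / 3 - (x - Re lam)) by rewrite mulr_ge0 ?pi_ge0//; lra.
    by apply/andP; split; lra.
  have := expR_ge1Dx (2 * (al * Im lam)).
  have := expR_ge1Dx (- (2 * (al * Im lam))); lra.
Qed.

End TwoBands.

(** * Uniqueness for trigonometric coefficients *)

Section TrigonometricUniqueness.
Context {R : realType}.
Local Notation mu := (@lebesgue_measure R).
Implicit Types (f g h : R -> R) (D : set R).

Lemma integrableM_bounded D h g (B : R) : measurable D ->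
  mu.-integrable D (EFin \o h) -> measurable_fun D g ->
  (forall t, `|g t| <= B) -> mu.-integrable D (EFin \o (fun t => h t * g t)).
Proof.
move=> mD hi mg gB.
apply: (le_integrable_real (g := fun t => B * `|h t|)) => //.
- by apply: measurable_funM => //; exact: integrable_measurable hi.
- by move=> t _; rewrite normrM mulrC ler_wpM2r.
- by apply: integrableM_cst => //; exact: integrable_norm.
Qed.

Lemma Rintegral_dominated_cvg D (F : nat -> R -> R) f g : measurable D ->
  (forall k, measurable_fun D (F k)) ->
  (forall t, D t -> F k t @[k --> \oo] --> f t) ->
  mu.-integrable D (EFin \o g) ->
  (forall k t, D t -> `|F k t| <= g t) ->
  \int[mu]_(t in D) F k t @[k --> \oo] --> \int[mu]_(t in D) f t.
Proof.
move=> mD mF cF gi Fg.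
have mf : measurable_fun D f by exact: measurable_fun_cvg cF.
have fi : mu.-integrable D (EFin \o f).
  apply: (le_integrable_real _ mf _ gi) => // t Dt.
  have cN : `|F k t| @[k --> \oo] --> `|f t| by apply: cvg_norm; exact: cF.
  rewrite -(cvg_lim (@Rhausdorff R) cN); apply: limr_le.
    by apply/cvg_ex; eexists; exact: cN.
  by apply: nearW => k; exact: Fg.
apply: fine_cvg; rewrite fineK; last exact: integrable_fin_num fi.
apply: (@dominated_cvg _ _ _ mu D _ (fun k => EFin \o F k) (EFin \o f)
  (EFin \o g)) => //.
- by move=> k; apply/measurable_EFinP; exact: mF.
- by move=> t Dt; apply: cvg_EFin; [exact: nearW|exact: cF].
Qed.

Lemma bernoulli (a : R) n : -1 <= a -> 1 + n%:R * a <= (1 + a) ^+ n.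
Proof.
move=> a1; elim: n => [|n IH]; first by rewrite mul0r addr0 expr0.
rewrite exprS; have a0 : 0 <= 1 + a by lra.
apply: le_trans (ler_wpM2l a0 IH).
rewrite -natr1; have := sqr_ge0 a; have := ler0n R n; nra.
Qed.

(* the one-dimensional approximation of a step function in the proof of the
   Stone-Weierstrass theorem of Brosowski and Deutsch *)
Lemma step_cvg (y : R) : 0 <= y <= 1 -> y != 2^-1 ->
  (1 - y ^+ k) ^+ (2 ^ k) @[k --> \oo] --> (if y < 2^-1 then 1 else 0 : R).
Proof.
move=> /andP[y0 y1] yn.
have pow01 k : 0 <= y ^+ k <= 1 by rewrite exprn_ge0//= exprn_ile1.
have u01 k : 0 <= (1 - y ^+ k) ^+ (2 ^ k) <= 1.
  have /andP[p0 p1] := pow01 k.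
  by rewrite exprn_ge0 ?exprn_ile1//; lra.
have scale k : (2 ^ k)%:R * y ^+ k = (2 * y) ^+ k by rewrite natrX -exprMn.
case: ifPn => [y2|].
- have c1 : 1 - (2 * y) ^+ k @[k --> \oo] --> (1 : R).
    rewrite -[X in _ --> X]subr0; apply: cvgB; first exact: cvg_cst.
    by apply: cvg_expr; rewrite ger0_norm ?mulr_ge0//; lra.
  apply: squeeze_cvgr c1 (cvg_cst _); apply: nearW => k.
  have /andP[_ ->] := u01 k; rewrite andbT.
  have /andP[p0 p1] := pow01 k.
  by have := @bernoulli (- y ^+ k) (2 ^ k); rewrite mulrN scale; apply; lra.
- rewrite -leNgt le_eqVlt eq_sym (negPf yn) /= => y2.
  have c0 : (2 * y)^-1 ^+ k @[k --> \oo] --> (0 : R).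
    apply: cvg_expr; rewrite ger0_norm ?invr_ge0 ?mulr_ge0//.
    by rewrite invf_lt1; lra.
  apply: squeeze_cvgr (cvg_cst _) c0; apply: nearW => k.
  have /andP[-> _] := u01 k; rewrite andTb.
  have /andP[p0 p1] := pow01 k.
  have q0 : 0 < (2 * y) ^+ k by rewrite exprn_gt0//; lra.
  rewrite exprVn -[leRHS]mul1r ler_pdivlMr//.
  (* By Bernoulli the second factor is at least [(2 * y) ^+ k], while the product is a power of
     [1 - (y ^+ k) ^+ 2] and thus at most 1. *)
  apply: (@le_trans _ _ ((1 - y ^+ k) ^+ (2 ^ k) * (1 + y ^+ k) ^+ (2 ^ k))).
    apply: ler_wpM2l; first by have /andP[] := u01 k.
    have := @bernoulli (y ^+ k) (2 ^ k); rewrite scale => H.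
    by apply: (@le_trans _ _ (1 + (2 * y) ^+ k)); [lra|apply: H; lra].
  rewrite -exprMn exprn_ile1//; have -> : (1 - y ^+ k) * (1 + y ^+ k) =
    1 - (y ^+ k) ^+ 2 by ring.
    by rewrite subr_ge0 exprn_ile1.
  by rewrite gerBl sqr_ge0.
Qed.

Let bcont g := continuous g /\ exists B, forall t, `|g t| <= B.

Let bcont_measurable D g : bcont g -> measurable_fun D g.
Proof.
by move=> [cg _]; apply: measurable_funTS; exact: continuous_measurable_fun.
Qed.

Let bcontM f g : bcont f -> bcont g -> bcont (fun t => f t * g t).
Proof.
move=> [cf [A fA]] [cg [B gB]]; split.
  by move=> t; apply: cvgM; [exact: cf|exact: cg].
by exists (A * B) => t; rewrite normrM ler_pM.
Qed.

Let bcont_lin (a b : R) f g : bcont f -> bcont g ->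
  bcont (fun t => a * f t + b * g t).
Proof.
move=> [cf [A fA]] [cg [B gB]]; split.
  move=> t; apply: cvgD; apply: cvgM; do ? exact: cvg_cst.
  - exact: cf.
  - exact: cg.
exists (`|a| * A + `|b| * B) => t; rewrite (le_trans (ler_normD _ _))//.
by rewrite !normrM lerD// ler_wpM2l.
Qed.

Let bcont_cst (k : R) : bcont (fun=> k).
Proof. by split=> [t|]; [exact: cvg_cst|exists `|k|]. Qed.

Let bcont_cos (k : R) : bcont (fun t => cos (k * t)).
Proof.
split; last by exists 1 => t; exact: cos_max.
move=> t; have lin : k * s @[s --> t] --> k * t.
  by apply: cvgM; [exact: cvg_cst|exact: cvg_id].
exact: (cvg_comp _ _ lin (@continuous_cos R _)).
Qed.

Let bcont_sin (k : R) : bcont (fun t => sin (k * t)).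
Proof.
split; last by exists 1 => t; exact: sin_max.
move=> t; have lin : k * s @[s --> t] --> k * t.
  by apply: cvgM; [exact: cvg_cst|exact: cvg_id].
exact: (cvg_comp _ _ lin (@continuous_sin R _)).
Qed.

Local Notation I := (`[- (pi / 4), pi / 4]%classic : set R).

Variable h : R -> R.
Hypothesis h_int : mu.-integrable I (EFin \o h).
Hypothesis h_cos : forall n : int,
  \int[mu]_(t in I) (h t * cos (4 * n%:~R * t)) = 0.
Hypothesis h_sin : forall n : int,
  \int[mu]_(t in I) (h t * sin (4 * n%:~R * t)) = 0.

Let J g := \int[mu]_(t in I) (h t * g t).

Let J_lin (a b : R) f g : bcont f -> bcont g ->
  J (fun t => a * f t + b * g t) = a * J f + b * J g.
Proof.
move=> bf bg; have [_ [A fA]] := bf; have [_ [B gB]] := bg.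
have fi := integrableM_bounded (measurable_itv _) h_int (bcont_measurable bf) fA.
have gi := integrableM_bounded (measurable_itv _) h_int (bcont_measurable bg) gB.
rewrite /J -!Rintegral_scale//.
rewrite -RintegralD//; try exact: integrableM_cst.
by apply: eq_Rintegral => t _; ring.
Qed.

(** Asking for all frequencies rather than for [J g = 0] alone makes the class stable under
    multiplication by cos(4 t) and sin(4 t), as the product formulas shift [n] by one. So it
    contains all trigonometric polynomials; [n = 0] gives back [J g = 0]. *)
Let annihilated g := [/\ bcont g,
  forall n : int, J (fun t => g t * cos (4 * n%:~R * t)) = 0 &
  forall n : int, J (fun t => g t * sin (4 * n%:~R * t)) = 0].

Let annihilated_lin (a b : R) f g : annihilated f -> annihilated g ->
  annihilated (fun t => a * f t + b * g t).
Proof.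
move=> [bf fc fs] [bg gc gs]; split; first exact: bcont_lin.
- move=> n; rewrite -[RHS](_ : a * 0 + b * 0 = 0); last by ring.
  rewrite -{1}(fc n) -(gc n) -J_lin; do ? exact: bcontM.
  by congr J; apply/funext => t; ring.
- move=> n; rewrite -[RHS](_ : a * 0 + b * 0 = 0); last by ring.
  rewrite -{1}(fs n) -(gs n) -J_lin; do ? exact: bcontM.
  by congr J; apply/funext => t; ring.
Qed.

Let freqD (n : int) (t : R) : 4 * (n + 1)%:~R * t = 4 * n%:~R * t + 4 * t.
Proof. by rewrite intrD; ring. Qed.

Let freqB (n : int) (t : R) : 4 * (n - 1)%:~R * t = 4 * n%:~R * t - 4 * t.
Proof. by rewrite intrB; ring. Qed.

Let annihilated_cos g : annihilated g ->
  annihilated (fun t => g t * cos (4 * t)).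
Proof.
move=> [bg gc gs]; split; first exact: bcontM.
- move=> n; rewrite -[RHS](_ : 2^-1 * 0 + 2^-1 * 0 = 0); last by ring.
  rewrite -{1}(gc (n + 1)) -(gc (n - 1)) -J_lin; do ? exact: bcontM.
  by congr J; apply/funext => t; rewrite freqD freqB cosD cosB; field.
- move=> n; rewrite -[RHS](_ : 2^-1 * 0 + 2^-1 * 0 = 0); last by ring.
  rewrite -{1}(gs (n + 1)) -(gs (n - 1)) -J_lin; do ? exact: bcontM.
  by congr J; apply/funext => t; rewrite freqD freqB sinD sinB; field.
Qed.

Let annihilated_sin g : annihilated g ->
  annihilated (fun t => g t * sin (4 * t)).
Proof.
move=> [bg gc gs]; split; first exact: bcontM.
- move=> n; rewrite -[RHS](_ : 2^-1 * 0 + - 2^-1 * 0 = 0); last by ring.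
  rewrite -{1}(gs (n + 1)) -(gs (n - 1)) -J_lin; do ? exact: bcontM.
  by congr J; apply/funext => t; rewrite freqD freqB sinD sinB; field.
- move=> n; rewrite -[RHS](_ : - 2^-1 * 0 + 2^-1 * 0 = 0); last by ring.
  rewrite -{1}(gc (n + 1)) -(gc (n - 1)) -J_lin; do ? exact: bcontM.
  by congr J; apply/funext => t; rewrite freqD freqB cosD cosB; field.
Qed.

Let annihilated1 : annihilated (fun=> 1).
Proof.
split; first exact: bcont_cst.
- by move=> n; rewrite -[RHS](h_cos n) /J; apply: eq_Rintegral => t _; rewrite mul1r.
- by move=> n; rewrite -[RHS](h_sin n) /J; apply: eq_Rintegral => t _; rewrite mul1r.
Qed.

Section Step.
Variable x : R.
Hypothesis xI : - (pi / 4) < x < pi / 4.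

Let mid : R := (x - pi / 4) / 2.
Let rad : R := (x + pi / 4) / 2.
(** A trigonometric polynomial whose period pi / 2 is the length of [I]. Modulo the period, the
    difference of cosines is positive exactly within [rad] of [mid], i.e. on (-pi/4, x), so [y]
    crosses 1/2 at [x]. Dividing by 4 keeps the values in [0, 1]. *)
Let y (t : R) : R := 2^-1 - (cos (4 * (t - mid)) - cos (4 * rad)) / 4.

Let yE t : y t = (2^-1 + cos (4 * rad) / 4) +
  (- cos (4 * mid) / 4) * cos (4 * t) + (- sin (4 * mid) / 4) * sin (4 * t).
Proof. by rewrite /y mulrBr cosB; field. Qed.

Let y01 t : 0 <= y t <= 1.
Proof.
rewrite /y; have := cos_le1 (4 * (t - mid)); have := cos_geN1 (4 * (t - mid)).
have := cos_le1 (4 * rad); have := cos_geN1 (4 * rad).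
by move=> *; apply/andP; split; lra.
Qed.

Let annihilated_y g : annihilated g -> annihilated (fun t => y t * g t).
Proof.
move=> ag; have := annihilated_lin 1 1
  (annihilated_lin (2^-1 + cos (4 * rad) / 4) (- cos (4 * mid) / 4) ag
    (annihilated_cos ag))
  (annihilated_lin (- sin (4 * mid) / 4) 0 (annihilated_sin ag) ag).
by congr annihilated; apply/funext => t; rewrite yE; ring.
Qed.

Let annihilated_pow g k : annihilated g -> annihilated (fun t => y t ^+ k * g t).
Proof.
move=> ag; elim: k => [|k /annihilated_y].
  by move: ag; congr annihilated; apply/funext => t; rewrite expr0 mul1r.
by congr annihilated; apply/funext => t; rewrite exprS mulrA.
Qed.

Let annihilated_step k m : annihilated (fun t => (1 - y t ^+ k) ^+ m).
Proof.
elim: m => [|m IH].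
  by have := annihilated1; congr annihilated; apply/funext => t; rewrite expr0.
have := annihilated_lin 1 (-1) IH (annihilated_pow k IH).
by congr annihilated; apply/funext => t; rewrite exprS; ring.
Qed.

Let rad_bounds : 0 < 4 * rad < pi.
Proof. by have /andP[x1 x2] := xI; rewrite /rad; apply/andP; split; lra. Qed.

Let y_lt t : - (pi / 4) < t < x -> y t < 2^-1.
Proof.
move=> /andP[t1 t2]; have /andP[x1 x2] := xI; have /andP[r1 r2] := rad_bounds.
have mE : mid = (x - pi / 4) / 2 by [].
have rE : rad = (x + pi / 4) / 2 by [].
suff : cos (4 * rad) < cos `|4 * (t - mid)| by rewrite /y cos_norm; lra.
have v0 : 0 <= `|4 * (t - mid)| by [].
have v1 : `|4 * (t - mid)| < 4 * rad.
  by rewrite ltr_norml; apply/andP; split; lra.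
by rewrite ltr_cos// in_itv /=; apply/andP; split; lra.
Qed.

Let y_gt t : x < t < pi / 4 -> 2^-1 < y t.
Proof.
move=> /andP[t1 t2]; have /andP[x1 x2] := xI; have /andP[r1 r2] := rad_bounds.
have mE : mid = (x - pi / 4) / 2 by [].
have rE : rad = (x + pi / 4) / 2 by [].
suff : cos (4 * (t - mid)) < cos (4 * rad) by rewrite /y; lra.
have [vpi|vpi] := leP (4 * (t - mid)) pi.
  rewrite ltr_cos ?in_itv /=; first by lra.
    by apply/andP; split=> //; lra.
  by apply/andP; split; lra.
(* Past pi the cosine grows again. The reflected angle still exceeds [4 * rad], which is exactly the
   condition [t < pi / 4]. *)
have -> : cos (4 * (t - mid)) = cos (2 * pi - 4 * (t - mid)).
  rewrite -cosN -(cosD2pi (- (4 * (t - mid)))); congr cos.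
  by rewrite mulr2n; ring.
rewrite ltr_cos ?in_itv /=; first by lra.
  by apply/andP; split; lra.
by apply/andP; split; lra.
Qed.

(** The annihilated functions [(1 - y ^+ k) ^+ (2 ^ k)] are bounded by 1 and tend to 1 left of [x]
    and to 0 right of it, so dominated convergence leaves the integral over the left part. The point
    [x], where [y] is 1/2, is removed first. *)
Lemma Rintegral_initial_eq0 : \int[mu]_(t in `]- (pi / 4), x[) h t = 0.
Proof.
have /andP[x1 x2] := xI.
have split3 g : mu.-integrable I (EFin \o g) -> \int[mu]_(t in I) g t =
    \int[mu]_(t in `]- (pi / 4), x[) g t + \int[mu]_(t in `]x, pi / 4[) g t.
  move=> gi.
  have sub D : measurable D -> D `<=` I -> mu.-integrable D (EFin \o g).
    by move=> mD DI; apply: integrableS gi.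
  have := @Rintegral_itvB R g (BLeft (- (pi / 4))) (BRight (pi / 4)) x gi.
  rewrite !bnd_simp => /(_ (ltW x1) (ltW x2)) E.
  have -> : \int[mu]_(t in I) g t = \int[mu]_(t in `[- (pi / 4), x]) g t +
      \int[mu]_(t in `]x, (pi / 4)]) g t by rewrite -E addrC subrK.
  have i1 : mu.-integrable `]- (pi / 4), x[ (EFin \o g).
    apply: sub => // t /=; rewrite !in_itv /= => /andP[? ?]; apply/andP; split; lra.
  have i2 : mu.-integrable `]- (pi / 4), x] (EFin \o g).
    apply: sub => // t /=; rewrite !in_itv /= => /andP[? ?]; apply/andP; split; lra.
  have i3 : mu.-integrable `]x, pi / 4[ (EFin \o g).
    apply: sub => // t /=; rewrite !in_itv /= => /andP[? ?]; apply/andP; split; lra.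
  by rewrite -Rintegral_itv_obnd_cbnd// -Rintegral_itv_bndo_bndc// -[X in _ + X]Rintegral_itv_bndo_bndc.
pose u k t := (1 - y t ^+ k) ^+ (2 ^ k).
have annu k : annihilated (u k) by exact: annihilated_step.
have u01 k t : `|u k t| <= 1.
  have /andP[y0 y1] := y01 t.
  have p0 : 0 <= y t ^+ k by rewrite exprn_ge0.
  have p1 : y t ^+ k <= 1 by rewrite exprn_ile1.
  have v0 : 0 <= 1 - y t ^+ k by lra.
  by rewrite ger0_norm ?exprn_ge0// exprn_ile1//; lra.
have hu k : mu.-integrable I (EFin \o (fun t => h t * u k t)).
  have [[cu _] _ _] := annu k.
  apply: integrableM_bounded (u01 k) => //.
  by apply: measurable_funTS; exact: continuous_measurable_fun.
have zero k : \int[mu]_(t in `]- (pi / 4), x[) (h t * u k t) +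
    \int[mu]_(t in `]x, pi / 4[) (h t * u k t) = 0.
  rewrite -split3//; have [_ uc _] := annu k; rewrite -[RHS](uc 0) /J.
  by apply: eq_Rintegral => t _; rewrite mulr0z mulr0 mul0r cos0 mulr1.
have dct (D : set R) (l : R) : measurable D -> D `<=` I ->
    (forall t, D t -> u k t @[k --> \oo] --> l) ->
    \int[mu]_(t in D) (h t * u k t) @[k --> \oo] --> \int[mu]_(t in D) (h t * l).
  move=> mD DI cu; have hD : mu.-integrable D (EFin \o h) by apply: integrableS h_int.
  apply: (Rintegral_dominated_cvg (g := fun t => `|h t|)) => //.
  - move=> k; apply: integrable_measurable.
    by apply: integrableS (hu k).
  - by move=> t Dt; apply: cvgM; [exact: cvg_cst|exact: cu].
  - exact: integrable_norm.
  - by move=> k t _; rewrite normrM ler_piMr.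
have c1 : \int[mu]_(t in `]- (pi / 4), x[) (h t * u k t) @[k --> \oo] -->
    \int[mu]_(t in `]- (pi / 4), x[) h t.
  under [X in _ --> X]eq_Rintegral do rewrite -[h _]mulr1.
  apply: dct => // t /=; rewrite in_itv /= => /andP[t1 t2].
    by rewrite in_itv /=; apply/andP; split; lra.
  have lt : y t < 2^-1 by apply: y_lt; rewrite t1.
  have := @step_cvg (y t) (y01 t); rewrite lt_eqF// lt; exact.
have c2 : \int[mu]_(t in `]x, pi / 4[) (h t * u k t) @[k --> \oo] --> (0 : R).
  rewrite -[X in _ --> X](_ : \int[mu]_(t in `]x, pi / 4[) (h t * 0) = 0).
    apply: dct => // t /=; rewrite in_itv /= => /andP[t1 t2].
      by rewrite in_itv /=; apply/andP; split; lra.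
    have gt : 2^-1 < y t by apply: y_gt; rewrite t1.
    have := @step_cvg (y t) (y01 t); rewrite gt_eqF//.
    by rewrite ifF; [exact|apply/negbTE; rewrite -leNgt ltW].
  by under eq_Rintegral do rewrite mulr0; rewrite /Rintegral integral0.
have csum : \int[mu]_(t in `]- (pi / 4), x[) (h t * u k t) +
    \int[mu]_(t in `]x, pi / 4[) (h t * u k t) @[k --> \oo] -->
    \int[mu]_(t in `]- (pi / 4), x[) h t + 0 by exact: cvgD.
move: csum; under eq_fun do rewrite zero; rewrite addr0 => csum.
exact: (cvg_unique (@Rhausdorff R) csum (cvg_cst 0)).
Qed.

End Step.

(** Lebesgue differentiation: almost everywhere [h] is the derivative of its indefinite integral,
    which vanishes inside [I] by [Rintegral_initial_eq0]. *)
Lemma annihilated_ae0 :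
  {ae mu, forall t, - (pi / 4) < t < pi / 4 -> h t = 0}.
Proof.
have mI : measurable I by [].
have fi : mu.-integrable setT (EFin \o (h \_ I)).
  have := (@integrable_mkcond _ _ _ mu I (EFin \o h) mI).1 h_int.
  by rewrite restrict_EFin.
have fy (z : R) : mu.-integrable `]-oo, z] (EFin \o (h \_ I)).
  by apply: integrableS fi.
have := FTC1Ny fy (integrable_locally mI h_int).
apply: filterS; first exact: (ae_filter_ringOfSetsType mu).
move=> x H /andP[x1 x2].
have [_ ] := H; have -> : (h \_ I) x = h x.
  by rewrite patchE mem_set//= in_itv /= !ltW.
move=> <-; rewrite derive1E.
set F := (X in 'D_1 X x).
have F0 z : - (pi / 4) < z < pi / 4 -> F z = 0.
  move=> zI; have /andP[z1 z2] := zI; rewrite /F -Rintegral_mkcondr.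
  have -> : `]-oo, z]%classic `&` I = `[- (pi / 4), z]%classic.
    apply/seteqP; split=> t /=; rewrite !in_itv /=.
      by move=> [t1 /andP[t2 t3]]; rewrite t2.
    move=> /andP[t1 t2]; split=> //; apply/andP; split=> //; lra.
  have sub D : measurable D -> D `<=` I -> mu.-integrable D (EFin \o h).
    by move=> mD DI; apply: integrableS h_int.
  rewrite -Rintegral_itv_obnd_cbnd; last first.
    apply: sub => // t /=; rewrite !in_itv /= => /andP[? ?]; apply/andP; split; lra.
  rewrite -Rintegral_itv_bndo_bndc; last first.
    apply: sub => // t /=; rewrite !in_itv /= => /andP[? ?]; apply/andP; split; lra.
  exact: Rintegral_initial_eq0.
rewrite (@near_eq_derive _ _ _ F (cst 0)) ?derive_cst//.
have xI : x \in `]- (pi / 4), pi / 4[ by rewrite in_itv /= x1.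
near=> z; rewrite F0//.
have : z \in `]- (pi / 4), pi / 4[ by near: z; exact: near_in_itvoo.
by rewrite in_itv.
Unshelve. all: by end_near.
Qed.

Lemma Rintegral_annihilated g : measurable_fun I g ->
  \int[mu]_(t in I) (h t * g t) = 0.
Proof.
move=> mg; have mh := integrable_measurable h_int.
have mhg : measurable_fun I (fun t => h t * g t) by exact: measurable_funM.
have cut (f : R -> R) : measurable_fun I f ->
    (\int[mu]_(t in I) (f t)%:E =
     \int[mu]_(t in (`]- (pi / 4), pi / 4[%classic : set R)%R) (f t)%:E)%E.
  move=> mf; have mf' : measurable_fun (I : set (measurableTypeR R)) (EFin \o f).
    by apply/measurable_EFinP; exact: mf.
  have p0 := @pi_gt0 R.
  rewrite -integral_itv_obnd_cbnd//; last first.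
    apply: (measurable_funS _ _ mf') => // t /=; rewrite !in_itv /= => /andP[? ?].
    by apply/andP; split; lra.
  rewrite -integral_itv_bndo_bndc//.
    apply: (measurable_funS _ _ mf') => // t /=; rewrite !in_itv /= => /andP[? ?].
    by apply/andP; split; lra.
rewrite /Rintegral cut//.
rewrite (ae_eq_integral (cst 0%E))//.
- by rewrite integral0.
- have mhg' : measurable_fun (I : set (measurableTypeR R)) (fun t => h t * g t).
    exact: mhg.
  apply/measurable_EFinP; apply: (measurable_funS _ _ mhg') => // t /=.
  by rewrite !in_itv /= => /andP[? ?]; apply/andP; split; lra.
- have := annihilated_ae0.
  apply: filterS; first exact: (ae_filter_ringOfSetsType mu).
  move=> t H /=; rewrite in_itv /= => tI.
  by rewrite H// mul0r.
Qed.

End TrigonometricUniqueness.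

(** * Completeness of square integrable functions *)

Section SquareIntegrableLimit.
Context {R : realType}.
Local Notation mu := (@lebesgue_measure R).
Implicit Types (D : set R).

(** The induction step of Cauchy-Schwarz for finite sums: [(x y)^2 <= (A Y) (B X)] bounds the cross
    term [2 x y] by [A Y + B X]. *)
Lemma cauchy_schwarz_step (A B X Y x y : R) :
  0 <= A -> 0 <= B -> 0 <= X -> 0 <= Y ->
  x ^+ 2 <= A * X -> y ^+ 2 <= B * Y -> (x + y) ^+ 2 <= (A + B) * (X + Y).
Proof.
move=> A0 B0 X0 Y0 xA yB.
have cross : 2 * (x * y) <= A * Y + B * X.
  have AY : 0 <= A * Y by exact: mulr_ge0.
  have BX : 0 <= B * X by exact: mulr_ge0.
  have sq : (x * y) ^+ 2 <= (A * Y) * (B * X).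
    rewrite exprMn (_ : A * Y * (B * X) = (A * X) * (B * Y)); last by ring.
    by apply: ler_pM; rewrite ?sqr_ge0.
  have [|xy0] := leP (x * y) 0; first by lra.
  have : (2 * (x * y)) ^+ 2 <= (A * Y + B * X) ^+ 2.
    have := sqr_ge0 (A * Y - B * X).
    move: sq AY BX; move: (A * Y) (B * X) (x * y) => p q r.
    by rewrite !expr2; lra.
  by rewrite ler_sqr ?nnegrE ?addr_ge0// mulr_ge0// ltW.
move: xA yB cross; rewrite !expr2; lra.
Qed.

Variables (D : set R) (u : nat -> R -> R) (K : R).
Hypothesis mD : measurable D.
Hypothesis mu_ : forall k, measurable_fun D (u k).
Hypothesis u0_int : mu.-integrable D (EFin \o (fun t => u 0%N t ^+ 2)).
Let d k t := u k.+1 t - u k t.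
Hypothesis d_int : forall k,
  (\int[mu]_(t in D) (d k t ^+ 2)%:E <= (K / 4 ^+ k)%:E)%E.

(* with these weights, the squared increments are [2 ^- k * w k], so Cauchy's
   inequality gives both pointwise convergence and domination wherever [W] is
   finite *)
Let w k t : R := 2 ^+ k * d k t ^+ 2.
Let w_ge0 k t : 0 <= w k t.
Proof. by apply: mulr_ge0; [exact: exprn_ge0|exact: sqr_ge0]. Qed.
Let W t : \bar R := (\sum_(0 <= k <oo) (w k t)%:E)%E.

Let md k : measurable_fun D (d k). Proof. exact: measurable_funB. Qed.
Let mw k : measurable_fun D (w k).
Proof. by apply: measurable_funM => //; exact: measurable_funX. Qed.

Let W_ge0 t : (0 <= W t)%E.
Proof. by apply: nneseries_ge0 => k _ _; rewrite lee_fin. Qed.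

Let mW : measurable_fun (D : set (measurableTypeR R)) W.
Proof.
apply: (ge0_emeasurable_sum (h := fun k t => (w k t)%:E) (P := xpredT)).
- by move=> k t _ _; rewrite lee_fin.
- by move=> k _; apply/measurable_EFinP; exact: mw.
Qed.

(** The weight [2 ^+ k] spends only half of the decay [4 ^- k], so the integrals of the [w k] still
    sum to at most [2 * K]. *)
Let W_int : mu.-integrable D W.
Proof.
apply/integrableP; split; first exact: mW.
under eq_integral do rewrite gee0_abs//.
have mw' k : measurable_fun (D : set (measurableTypeR R)) (fun t => (w k t)%:E).
  by apply/measurable_EFinP; exact: mw.
rewrite /W (@integral_nneseries _ _ _ mu D _ (fun k t => (w k t)%:E))//; last first.
  by move=> k t _; rewrite lee_fin.
apply: (@le_lt_trans _ _ (2 * K)%:E); last exact: ltry.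
have geo := @cvg_geometric_eseries_half R (2 * K) 0.
rewrite expr0 divr1 in geo; rewrite -(cvg_lim (@ereal_hausdorff R) geo).
apply: lee_nneseries.
  by move=> k _ _; apply: integral_ge0 => t _; rewrite lee_fin.
move=> k _.
have -> : (\int[mu]_(t in D) (w k t)%:E =
    (2 ^+ k)%:E * \int[mu]_(t in D) (d k t ^+ 2)%:E)%E.
  rewrite -ge0_integralZl_EFin//.
  - by move=> t _; rewrite lee_fin sqr_ge0.
  - by apply/measurable_EFinP; exact: (measurable_funX 2 (md k)).
apply: (le_trans (lee_wpmul2l _ (d_int k))); first by rewrite lee_fin exprn_ge0.
rewrite -EFinM lee_fin natrX addn1 exprS invfM.
have -> : (4 : R) = 2 * 2 by ring.
rewrite exprMn invfM.
have p0 : (2 : R) ^+ k != 0 by rewrite expf_neq0.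
by rewrite le_eqVlt; apply/orP; left; apply/eqP; field.
Qed.

(** Cauchy-Schwarz for the telescoping sum; the first factor is the sum of [2^-1 ^+ k] over
    [k < n]. *)
Let bound_sqr n t : (u n t - u 0%N t) ^+ 2 <= (2 - 2 * 2^-1 ^+ n) * \sum_(k < n) w k t.
Proof.
elim: n => [|n IH]; first by rewrite subrr expr0 big_ord0 mulr1 subrr mulr0 expr0n.
have -> : u n.+1 t - u 0%N t = (u n t - u 0%N t) + d n t by rewrite /d; ring.
have -> : 2 - 2 * 2^-1 ^+ n.+1 = (2 - 2 * 2^-1 ^+ n) + 2^-1 ^+ n :> R.
  by rewrite exprS; field.
have p1 : 2^-1 ^+ n <= 1 :> R by rewrite exprn_ile1// invf_le1// ler1n.
rewrite big_ord_recr /=; apply: cauchy_schwarz_step => //.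
- by lra.
- by rewrite sumr_ge0.
- by rewrite /w mulrA -exprMn mulVf// expr1n mul1r.
Qed.

Let sum_le_W n t : ((\sum_(k < n) w k t)%:E <= W t)%E.
Proof.
rewrite -(big_mkord xpredT (fun k => w k t)) -sumEFin.
by apply: nneseries_lim_ge => k _ _; rewrite lee_fin.
Qed.

Let u_sqr_le n t : ((u n t ^+ 2)%:E <= (2 * u 0%N t ^+ 2)%:E + 4%:E * W t)%E.
Proof.
apply: (@le_trans _ _ ((2 * u 0%N t ^+ 2)%:E + 4%:E * (\sum_(k < n) w k t)%:E)%E).
  rewrite -EFinM -EFinD lee_fin.
  have := bound_sqr n t; set S := \sum_(k < n) _.
  have S0 : 0 <= S by rewrite sumr_ge0.
  have p0 : 0 <= 2^-1 ^+ n :> R by rewrite exprn_ge0.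
  have := sqr_ge0 (2 * u 0%N t - u n t).
  have : 0 <= 2^-1 ^+ n * S by exact: mulr_ge0.
  by rewrite !expr2; lra.
by rewrite leeD2l// lee_pmul2l// ltr0n.
Qed.

(** Expanding [(1 - 2 ^+ k * |d k t|)^2 >= 0] gives [|d k t| <= 2^-1 ^+ k + w k t], which is
    summable. *)
Let u_cvg t : (W t < +oo)%E -> cvgn (u ^~ t).
Proof.
move=> Wt; have cw := nnseries_is_cvg (fun k => w_ge0 k t) Wt.
have cg : cvgn (series (geometric 1 2^-1 : nat -> R)).
  by apply: is_cvg_geometric_series; rewrite ger0_norm// invf_lt1// ltr1n.
have cd : cvgn (series (d ^~ t)).
  apply: normed_cvg; apply: (@series_le_cvg _ _ (geometric 1 2^-1 \+ w ^~ t)) => //.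
  - by move=> k; exact: normr_ge0.
  - by move=> k; apply: addr_ge0 => //; rewrite /geometric /= mul1r; apply: exprn_ge0; rewrite invr_ge0.
  - move=> k; rewrite /geometric /= mul1r.
    have p0 : 0 < 2 ^+ k :> R by rewrite exprn_gt0.
    have pV : 2^-1 ^+ k * 2 ^+ k = 1 :> R by rewrite -exprMn mulVf// expr1n.
    have q0 : 0 < 2^-1 ^+ k :> R by rewrite exprn_gt0// invr_gt0.
    have := sqr_ge0 (1 - 2 ^+ k * `|d k t|); rewrite /w -[d k t ^+ 2]real_normK ?num_real//.
    move: (2 ^+ k) (2^-1 ^+ k) (`|d k t|) p0 q0 pV => p q x p0 q0 pV H.
    have : 0 <= q * (1 - p * x) ^+ 2 by rewrite mulr_ge0// ltW.
    have -> : q * (1 - p * x) ^+ 2 = q - 2 * (q * p) * x + (q * p) * (p * x ^+ 2) by ring.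
    rewrite pV; have := mulr_ge0 (ltW p0) (sqr_ge0 x); lra.
  - have -> : series (geometric 1 2^-1 \+ w^~ t) =
        series (geometric 1 2^-1) \+ series (w^~ t).
      by apply/funext => n; rewrite /series /= -big_split.
    exact: is_cvgD.
have -> : u ^~ t = (fun n => u 0%N t + series (d ^~ t) n).
  by apply/funext => n; rewrite /series /= telescope_sumr// addrC subrK.
by apply: is_cvgD => //; exact: is_cvg_cst.
Qed.

(** The default 0 is taken where [W] is infinite, a null set by [W_int]. *)
Let v t : R := if (W t < +oo)%E then limn (u ^~ t) else 0.

Let mv : measurable_fun D v.
Proof.
pose f n t := if (W t < +oo)%E then u n t else 0.
apply: (measurable_fun_cvg (h := f)).
- move=> n; apply: measurable_fun_if => //.
  + apply: (measurable_fun_bool true).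
    have := measurable_lte mD mW (measurable_cst (+oo%E : \bar R)).
    congr measurable; apply/seteqP; split=> t //=.
  + by apply: measurable_funS (mu_ n) => // t [].
- move=> t _; rewrite /f /v; case: ifPn => [Wt|_]; last exact: cvg_cst.
  exact: u_cvg.
Qed.

Let dom t : \bar R := ((2 * u 0%N t ^+ 2)%:E + 4%:E * W t)%E.

Let dom_int : mu.-integrable D dom.
Proof.
have i0 := integrableM_cst 2 mD u0_int.
have i1 := @integrableZl _ _ _ mu D mD 4 W W_int.
exact: (@integrableD _ _ _ mu D mD _ _ i0 i1).
Qed.

Let v_int : mu.-integrable D (EFin \o (fun t => v t ^+ 2)).
Proof.
apply: le_integrable dom_int => //.
  by apply/measurable_EFinP; exact: (measurable_funX 2 mv).
move=> t _; have dom0 : (0 <= dom t)%E.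
  by rewrite adde_ge0 ?mule_ge0// lee_fin mulr_ge0 ?sqr_ge0.
rewrite [leRHS]gee0_abs// gee0_abs ?lee_fin ?sqr_ge0//=.
rewrite /v; case: ifPn => [Wt|_]; last by rewrite expr0n.
have Wfin : W t \is a fin_num by rewrite ge0_fin_numE.
have c2 : u n t ^+ 2 @[n --> \oo] --> limn (u ^~ t) ^+ 2.
  by rewrite expr2; under eq_fun do rewrite expr2; apply: cvgM; exact: u_cvg.
have domE : dom t = (2 * u 0%N t ^+ 2 + 4 * fine (W t))%:E.
  by rewrite /dom -[W t in LHS]fineK.
rewrite domE lee_fin -(cvg_lim (@Rhausdorff R) c2); apply: limr_le.
  by apply/cvg_ex; eexists; exact: c2.
by apply: nearW => n; rewrite -lee_fin -domE; exact: u_sqr_le.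
Qed.

(** Convergence is stated against a fixed [psi] because transforms are such pairings. Products are
    dominated by [dom t + psi t ^+ 2]. *)
Lemma square_integrable_limit : exists v : R -> R,
  [/\ measurable_fun D v, mu.-integrable D (EFin \o (fun t => v t ^+ 2)) &
    forall psi : R -> R, measurable_fun D psi ->
      mu.-integrable D (EFin \o (fun t => psi t ^+ 2)) ->
      \int[mu]_(t in D) (u k t * psi t) @[k --> \oo] -->
      \int[mu]_(t in D) (v t * psi t)].
Proof.
exists v; split => [//||psi mpsi psi_int]; first exact: v_int.
have g_int : mu.-integrable D (fun t => dom t + (psi t ^+ 2)%:E)%E.
  exact: (@integrableD _ _ _ mu D mD _ _ dom_int psi_int).
have mf k : measurable_fun (D : set (measurableTypeR R)) (fun t => (u k t * psi t)%:E).
  by apply/measurable_EFinP; exact: (measurable_funM (mu_ k) mpsi).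
have mvpsi : measurable_fun (D : set (measurableTypeR R)) (fun t => (v t * psi t)%:E).
  by apply/measurable_EFinP; exact: (measurable_funM mv mpsi).
have mg : measurable_fun (D : set (measurableTypeR R)) (fun t => (psi t ^+ 2)%:E).
  by apply/measurable_EFinP; exact: (measurable_funX 2 mpsi).
have conv : {ae mu, forall t, D t -> (u k t * psi t)%:E @[k --> \oo] --> (v t * psi t)%:E}.
  apply: (@filterS _ _ (ae_filter_ringOfSetsType mu) _ _ _
    (@integrable_ae _ _ _ mu D mD W W_int)).
  move=> t + Dt => /(_ Dt) Wfin; apply: cvg_EFin; first exact: nearW.
  have Wt : (W t < +oo)%E by rewrite -ge0_fin_numE.
  by rewrite /v Wt; apply: cvgMr_tmp; exact: u_cvg.
have dominated n t : D t -> (`|(u n t * psi t)%:E| <= dom t + (psi t ^+ 2)%:E)%E.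
  move=> _; apply: (@le_trans _ _ ((u n t ^+ 2)%:E + (psi t ^+ 2)%:E)%E); last first.
    by apply: leeD => //; exact: u_sqr_le.
  rewrite -EFinD lee_fin ler_norml.
  have := sqr_ge0 (u n t + psi t); have := sqr_ge0 (u n t - psi t).
  have := sqr_ge0 (u n t); have := sqr_ge0 (psi t).
  by rewrite !expr2 => ? ? ? ?; apply/andP; split; lra.
have [vpsi_int _ cv] := @dominated_convergence _ _ _ mu D mD _ _ _ mf mvpsi conv g_int
  (aeW mu (fun t n Dt => dominated n t Dt)).
rewrite /Rintegral; apply: fine_cvg; rewrite fineK//.
exact: (@integrable_fin_num _ _ _ mu D mD _ vpsi_int).
Qed.

End SquareIntegrableLimit.

(** * Fourier series of period pi / 2 *)

Section FourierSeries.
Context {R : realType}.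
Local Notation C := R[i].
Local Notation mu := (@lebesgue_measure R).
Local Notation I := (`[- (pi / 4), pi / 4]%classic : set R).
Local Notation transform phi w :=
  (cintegral I (fun t => phi t * cexp ('i * w * t%:C))).
Local Notation freq n := ((4 * n%:~R : R)%:C).

Lemma square_integrable_Re (D : set R) (phi : R -> C) : measurable D ->
  square_integrable D phi -> mu.-integrable D (EFin \o (fun t => Re (phi t) ^+ 2)).
Proof.
move=> mD /(square_integrableP phi mD)[m1 m2 fi].
apply: le_integrable_real fi => //; first exact: (measurable_funX 2 m1).
by move=> t _; rewrite ger0_norm ?sqr_ge0// lerDl sqr_ge0.
Qed.

Lemma square_integrable_Im (D : set R) (phi : R -> C) : measurable D ->
  square_integrable D phi -> mu.-integrable D (EFin \o (fun t => Im (phi t) ^+ 2)).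
Proof.
move=> mD /(square_integrableP phi mD)[m1 m2 fi].
apply: le_integrable_real fi => //; first exact: (measurable_funX 2 m2).
by move=> t _; rewrite ger0_norm ?sqr_ge0// lerDr sqr_ge0.
Qed.

Lemma integrableM_real (D : set R) (f g : R -> R) : measurable D ->
  measurable_fun D f -> measurable_fun D g ->
  mu.-integrable D (EFin \o (fun t => f t ^+ 2)) ->
  mu.-integrable D (EFin \o (fun t => g t ^+ 2)) ->
  mu.-integrable D (EFin \o (fun t => f t * g t)).
Proof.
move=> mD mf mg fi gi.
apply: le_integrable_real (integrableD_real mD fi gi) => //.
  exact: (measurable_funM mf mg).
move=> t _; rewrite ler_norml; apply/andP.
have := sqr_ge0 (f t - g t); have := sqr_ge0 (f t + g t).
have := sqr_ge0 (f t); have := sqr_ge0 (g t).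
by rewrite !sqrrD !sqrrN; split; nra.
Qed.

Lemma Re_cintegralM (D : set R) (phi psi : R -> C) : measurable D ->
  square_integrable D phi -> square_integrable D psi ->
  Re (cintegral D (fun t => phi t * psi t)) =
  \int[mu]_(t in D) (Re (phi t) * Re (psi t)) -
  \int[mu]_(t in D) (Im (phi t) * Im (psi t)).
Proof.
move=> mD fi gi; have [m1 m2 _] := fi; have [m3 m4 _] := gi.
rewrite -RintegralB//; last 2 first.
- by apply: integrableM_real => //; exact: square_integrable_Re.
- by apply: integrableM_real => //; exact: square_integrable_Im.
by apply: eq_Rintegral => t _; rewrite ReM.
Qed.

Lemma Im_cintegralM (D : set R) (phi psi : R -> C) : measurable D ->
  square_integrable D phi -> square_integrable D psi ->
  Im (cintegral D (fun t => phi t * psi t)) =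
  \int[mu]_(t in D) (Re (phi t) * Im (psi t)) +
  \int[mu]_(t in D) (Im (phi t) * Re (psi t)).
Proof.
move=> mD fi gi; have [m1 m2 _] := fi; have [m3 m4 _] := gi.
rewrite -RintegralD//; last 2 first.
- by apply: integrableM_real => //; [exact: square_integrable_Re|exact: square_integrable_Im].
- by apply: integrableM_real => //; [exact: square_integrable_Im|exact: square_integrable_Re].
by apply: eq_Rintegral => t _; rewrite ImM.
Qed.

Lemma cexp_freq (n : int) (t : R) :
  cexp ('i * freq n * t%:C) = cos (4 * n%:~R * t) +i* sin (4 * n%:~R * t).
Proof.
by rewrite /cexp -mulrA Re_imul Im_imul -rmorphM /= oppr0 expR0 !mul1r.
Qed.

(** Completeness of the Fourier nodes: the real and imaginary parts of [phi] meet the hypotheses of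
    [Rintegral_annihilated], which then applies to the parts of any exponential. *)
Lemma transform_eq0 (phi : R -> C) : square_integrable I phi ->
  (forall n : int, transform phi (freq n) = 0) ->
  forall z, transform phi z = 0.
Proof.
move=> phi_int phi0 z; have [m1 m2 _] := phi_int.
have mI : measurable I by [].
have ei w : square_integrable I (fun t => cexp ('i * w * t%:C)).
  exact: square_integrable_cexp.
have cI (g : R -> R) : continuous g -> measurable_fun I g.
  by move=> cg; exact: integrable_measurable (continuous_integrable_itv _ _ cg).
have [h1 h2] : cintegrable I (fun t => phi t * 1).
  apply: cintegrableM => //; apply: ccontinuous_square_integrable.
  exact: ccontinuous_cst.
have {}h1 : mu.-integrable I (EFin \o (fun t => Re (phi t))).
  by apply: (eq_integrable _ _ _ _ h1) => // t _ /=; rewrite mulr1.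
have {}h2 : mu.-integrable I (EFin \o (fun t => Im (phi t))).
  by apply: (eq_integrable _ _ _ _ h2) => // t _ /=; rewrite mulr1.
(* A complex coefficient mixes the cosine integral of one part with the sine integral of the other.
   Since the sine is odd, the frequencies [n] and [- n] together separate the four real
   integrals. *)
have coef (n : int) :
    [/\ \int[mu]_(t in I) (Re (phi t) * cos (4 * n%:~R * t)) = 0,
      \int[mu]_(t in I) (Re (phi t) * sin (4 * n%:~R * t)) = 0,
      \int[mu]_(t in I) (Im (phi t) * cos (4 * n%:~R * t)) = 0 &
      \int[mu]_(t in I) (Im (phi t) * sin (4 * n%:~R * t)) = 0].
  have ReE m : Re (transform phi (freq m)) =
      \int[mu]_(t in I) (Re (phi t) * cos (4 * m%:~R * t)) -
      \int[mu]_(t in I) (Im (phi t) * sin (4 * m%:~R * t)).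
    by rewrite Re_cintegralM//;
      congr (_ - _); apply: eq_Rintegral => t _; rewrite cexp_freq.
  have ImE m : Im (transform phi (freq m)) =
      \int[mu]_(t in I) (Re (phi t) * sin (4 * m%:~R * t)) +
      \int[mu]_(t in I) (Im (phi t) * cos (4 * m%:~R * t)).
    by rewrite Im_cintegralM//; congr (_ + _); apply: eq_Rintegral => t _;
      rewrite cexp_freq.
  have cosN (f : R -> R) : \int[mu]_(t in I) (f t * cos (4 * (- n)%:~R * t)) =
      \int[mu]_(t in I) (f t * cos (4 * n%:~R * t)).
    by apply: eq_Rintegral => t _; rewrite mulrNz mulrN mulNr cosN.
  have sinN (f : R -> R) : measurable_fun I f ->
      mu.-integrable I (EFin \o (fun t => f t ^+ 2)) ->
      \int[mu]_(t in I) (f t * sin (4 * (- n)%:~R * t)) =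
      - \int[mu]_(t in I) (f t * sin (4 * n%:~R * t)).
    move=> mf fi; rewrite -[RHS]mulN1r -Rintegral_scale//; last first.
      have [_ ms _] := ei (freq n).
      have fs := integrableM_real mI mf ms fi (square_integrable_Im mI (ei (freq n))).
      by apply: (eq_integrable _ _ _ _ fs) => // t _; rewrite /comp cexp_freq.
    by apply: eq_Rintegral => t _; rewrite mulrNz mulrN mulNr sinN mulrN mulN1r.
  move: (ReE n) (ReE (- n)) (ImE n) (ImE (- n)); rewrite !phi0 /= !cosN !sinN//; last 2 first.
  - exact: square_integrable_Re.
  - exact: square_integrable_Im.
  by move=> *; split; lra.
have zero (h : R -> R) (g : R -> R) : mu.-integrable I (EFin \o h) ->
    (forall n : int, \int[mu]_(t in I) (h t * cos (4 * n%:~R * t)) = 0) ->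
    (forall n : int, \int[mu]_(t in I) (h t * sin (4 * n%:~R * t)) = 0) ->
    measurable_fun I g -> \int[mu]_(t in I) (h t * g t) = 0.
  by move=> *; exact: Rintegral_annihilated.
have [m3 m4 _] := ei z.
apply: complexP; rewrite ?Re_cintegralM ?Im_cintegralM//=.
- by rewrite !zero ?subr0// => n; case: (coef n).
- by rewrite !zero ?addr0// => n; case: (coef n).
Qed.

(** The frequencies are negated because [transform] pairs without conjugation: its value at [freq n]
    then picks out [b n], up to the factor pi / 2. *)
Definition trig (r : seq int) (b : int -> C) (t : R) : C :=
  \sum_(n <- r) b n * cexp ('i * - freq n * t%:C).

Lemma ccontinuous_trig r b : ccontinuous (trig r b).
Proof.
apply: ccontinuous_sum => n; apply: ccontinuousM; first exact: ccontinuous_cst.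
exact: ccontinuous_cexp.
Qed.

Lemma square_integrable_trig r b : square_integrable I (trig r b).
Proof. exact: ccontinuous_square_integrable (ccontinuous_trig r b). Qed.

Lemma sin_intpi (k : int) : sin (k%:~R * pi) = 0 :> R.
Proof.
have H (n : nat) : sin (n%:R * pi) = 0 :> R.
  elim: n => [|n IH]; first by rewrite mul0r sin0.
  by rewrite -natr1 mulrDl mul1r sinDpi IH oppr0.
by case: k => n; rewrite ?NegzE ?mulrNz ?mulNr ?sinN -pmulrn H ?oppr0.
Qed.

Lemma orthogonality (m n : int) :
  transform (fun t => cexp ('i * - freq m * t%:C)) (freq n) =
  if m == n then (pi / 2)%:C else 0.
Proof.
have pi0 := @pi_gt0 R.
have E t : cexp ('i * - freq m * t%:C) * cexp ('i * freq n * t%:C) =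
    cexp ('i * freq (n - m) * t%:C).
  rewrite -cexpD; congr cexp; rewrite rmorphB /= mulrBr rmorphB /=; ring.
have -> : transform (fun t => cexp ('i * - freq m * t%:C)) (freq n) =
    cintegral I (fun t => cexp ('i * freq (n - m) * t%:C)).
  by apply: eq_cintegral => t _; exact: E.
have [->|neq] := eqVneq m n.
  rewrite subrr mulr0 rmorph0 mulr0.
  rewrite (_ : cintegral _ _ = cintegral I (fun=> 1)); last first.
    by apply: eq_cintegral => t _; rewrite mul0r cexp0.
  apply: complexP; rewrite /= Rintegral_cst//= lebesgue_measure_itv/= ?mul0r//.
  rewrite lte_fin mul1r; case: ifPn => H /=; last by exfalso; move/negP: H; apply; lra.
  lra.
rewrite cintegral_cexp; last 2 first.
- by lra.
- have i0 : 'i != 0 :> C by rewrite -abs2_gt0 /abs2 Re_i Im_i; lra.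
  rewrite mulf_neq0// -abs2_gt0 abs2_real exprn_even_gt0//=.
  by rewrite mulf_neq0// intr_eq0 subr_eq0 eq_sym.
rewrite !cexp_freq (_ : _ - _ = 0) ?mul0r//.
have -> : 4 * (n - m)%:~R * (pi / 4) = (n - m)%:~R * pi :> R by field.
have -> : 4 * (n - m)%:~R * - (pi / 4) = - ((n - m)%:~R * pi) :> R by field.
rewrite cosN sinN sin_intpi oppr0.
by rewrite subrr.
Qed.

Lemma transform_trig (r : seq int) (b : int -> C) (n : int) : uniq r ->
  transform (trig r b) (freq n) = if n \in r then b n * (pi / 2)%:C else 0.
Proof.
move=> ur.
have ei z : square_integrable I (fun t => cexp (z * t%:C)) by exact: square_integrable_cexp.
have -> : transform (trig r b) (freq n) = \sum_(m <- r) b m *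
    transform (fun t => cexp ('i * - freq m * t%:C)) (freq n).
  under [RHS]eq_bigr => m _ do (rewrite -cintegralZ//; last by apply: cintegrableM).
  rewrite -cintegral_sum//; last first.
    by move=> m; apply: cintegrableZ => //; apply: cintegrableM.
  apply: eq_cintegral => t _; rewrite /trig mulr_suml.
  by apply: eq_bigr => m _; rewrite mulrA.
under eq_bigr do rewrite orthogonality.
case: ifPn => [nr|nr].
  rewrite (bigD1_seq n)//= eqxx big1 ?addr0// => m /negPf mn.
  by rewrite mn mulr0.
rewrite big_seq big1// => m mr; rewrite ifF ?mulr0//.
by apply: contraNF nr => /eqP <-.
Qed.

Lemma energy_trig (r : seq int) (b : int -> C) : uniq r ->
  energy I (trig r b) = pi / 2 * \sum_(n <- r) abs2 (b n).
Proof.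
move=> ur; have fi := square_integrable_trig r b.
have ei z : square_integrable I (fun t => cexp (z * t%:C)) by exact: square_integrable_cexp.
have -> : energy I (trig r b) =
    Re (cintegral I (fun t => trig r b t * (trig r b t)^*)).
  by apply: eq_Rintegral => t _; rewrite mul_conj.
have -> : cintegral I (fun t => trig r b t * (trig r b t)^*) =
    \sum_(n <- r) (b n)^* * transform (trig r b) (freq n).
  under [RHS]eq_bigr => m _ do (rewrite -cintegralZ//; last by apply: cintegrableM).
  rewrite -cintegral_sum//; last first.
    by move=> m; apply: cintegrableZ => //; apply: cintegrableM.
  apply: eq_cintegral => t _; rewrite {2}/trig conj_sum mulr_sumr.
  apply: eq_bigr => m _; rewrite conjM conj_cexp mulrCA; congr (_ * (_ * cexp _)).
  apply: complexP; rewrite !ReImE /=; ring.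
rewrite mulr_sumr Re_sum big_seq [RHS]big_seq; apply: eq_bigr => n nr.
rewrite transform_trig// nr mulrA [_ * b n]mulrC mul_conj -rmorphM /=.
by rewrite mulrC.
Qed.

Definition int_enum (k : nat) : int := if odd k then Negz k./2 else Posz k./2.

Lemma int_enum_inj : injective int_enum.
Proof.
move=> j k; rewrite /int_enum; case: ifP => oj; case: ifP => ok // -[jk];
  by rewrite -(odd_double_half j) -(odd_double_half k) oj ok jk.
Qed.

Lemma int_enum_surj (n : int) : exists k, int_enum k = n.
Proof.
case: n => n; first by exists n.*2; rewrite /int_enum odd_double doubleK.
by exists n.*2.+1; rewrite /int_enum /= odd_double /= uphalf_double.
Qed.

(** Partial sums along [int_enum], thinned out to reach the geometric rate of
    [square_integrable_limit]; each transform value at a node is eventually constant along them. *)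
Lemma riesz_fischer (a : int -> C) (K : R) :
  (forall r : seq int, uniq r -> \sum_(n <- r) abs2 (a n) <= K) ->
  exists2 phi : R -> C, square_integrable I phi &
    forall n : int, transform phi (freq n) = a n.
Proof.
move=> aK; have p0 := @pi_gt0 R.
have mI : measurable I by [].
pose seg i l := map int_enum (iota i l).
have useg i l : uniq (seg i l) by rewrite map_inj_uniq ?iota_uniq//; exact: int_enum_inj.
pose s m : R := \sum_(n <- seg 0%N m) abs2 (a n).
have s_sup : has_sup (range s).
  by split; [exists (s 0%N), 0%N|exists K => _ [m _ <-]; exact: aK].
have sL m : s m <= sup (range s) by apply: sup_upper_bound => //; exists m.
have /choice[N HN] : forall k, exists N, sup (range s) - (4 ^+ k)^-1 < s N.
  move=> k; have [|_ [m _ <-] H] := @sup_adherent _ (range s) (4 ^+ k)^-1 _ s_sup.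
    by rewrite invr_gt0 exprn_gt0.
  by exists m.
have s_cat m l : s (m + l)%N = s m + \sum_(n <- seg m l) abs2 (a n).
  by rewrite /s /seg iotaD map_cat big_cat.
(* Since [M k >= N k], the coefficients beyond [M k] have square sum below [4 ^- k]. The successors
   force [k < M k], so that every index is eventually included. *)
pose M k := (\sum_(j < k.+1) (N j).+1)%N.
have MS k : M k.+1 = (M k + (N k.+1).+1)%N by rewrite /M big_ord_recr.
have NM k : (N k <= M k)%N.
  by rewrite /M big_ord_recr /= (leq_trans (leqnSn _))// leq_addl.
have kM k : (k < M k)%N.
  elim: k => [|k IH]; first by rewrite /M big_ord1.
  by rewrite MS addnS ltnS (leq_trans IH)// leq_addr.
pose b n : C := (2 / pi)%:C * a n.
pose u k t := trig (seg 0%N (M k)) b t.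
pose d k t := trig (seg (M k) (N k.+1).+1) b t.
have uS k t : u k.+1 t - u k t = d k t.
  by rewrite /u /d MS /trig /seg iotaD map_cat big_cat addrAC subrr add0r.
have d_energy k : energy I (d k) <= (2 / pi) / 4 ^+ k.
  rewrite energy_trig//.
  have -> : \sum_(n <- seg (M k) (N k.+1).+1) abs2 (b n) =
      (2 / pi) ^+ 2 * (s (M k.+1) - s (M k)).
    rewrite MS s_cat addrAC subrr add0r mulr_sumr.
    by apply: eq_bigr => n _; rewrite abs2M abs2_real.
  have pn0 : pi != 0 :> R by rewrite gt_eqF.
  have cE (p x : R) : p != 0 -> p / 2 * ((2 / p) ^+ 2 * x) = 2 / p * x.
    by move=> ?; field.
  rewrite cE//.
  rewrite ler_pM2l ?divr_gt0//.
  have := HN k; have := sL (M k.+1).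
  have : s (N k) <= s (M k).
    by rewrite -(subnKC (NM k)) s_cat lerDl sumr_ge0// => n _; exact: abs2_ge0.
  by lra.
have d_part (part : C -> R) : (forall z, part z ^+ 2 <= abs2 z) -> forall k,
    measurable_fun I (fun t => part (d k t)) ->
    (\int[mu]_(t in I) (part (d k t) ^+ 2)%:E <= ((2 / pi) / 4 ^+ k)%:E)%E.
  move=> part_le k mp; apply: (@le_trans _ _ (energy I (d k))%:E); last by rewrite lee_fin.
  have /(square_integrableP _ mI)[m1 m2 di] := square_integrable_trig (seg (M k) (N k.+1).+1) b.
  rewrite /energy /Rintegral fineK; last exact: (@integrable_fin_num _ _ _ mu I mI _ di).
  apply: ge0_le_integral => //.
  - by move=> t _; rewrite lee_fin sqr_ge0.
  - by apply/measurable_EFinP; exact: (measurable_funX 2 mp).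
  - by apply/measurable_EFinP; exact: (measurable_abs2 m1 m2).
  - by move=> t _; rewrite lee_fin.
have u_int k : square_integrable I (u k) by exact: square_integrable_trig.
have d_int k : square_integrable I (d k) by exact: square_integrable_trig.
have [v1 [mv1 v1i v1c]] : exists v : R -> R,
    [/\ measurable_fun I v, mu.-integrable I (EFin \o (fun t => v t ^+ 2)) &
    forall psi : R -> R, measurable_fun I psi ->
      mu.-integrable I (EFin \o (fun t => psi t ^+ 2)) ->
      \int[mu]_(t in I) (Re (u k t) * psi t) @[k --> \oo] -->
      \int[mu]_(t in I) (v t * psi t)].
  apply: (@square_integrable_limit R I (fun k t => Re (u k t)) (2 / pi)) => //.
  - by move=> k; case: (u_int k).
  - exact: square_integrable_Re.
  - move=> k; rewrite (_ : (fun t => _) = (fun t => (Re (d k t) ^+ 2)%:E)); last first.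
      by apply/funext => t; rewrite -uS ReD ReN.
    apply: d_part; last by case: (d_int k).
    by move=> z; rewrite lerDl sqr_ge0.
have [v2 [mv2 v2i v2c]] : exists v : R -> R,
    [/\ measurable_fun I v, mu.-integrable I (EFin \o (fun t => v t ^+ 2)) &
    forall psi : R -> R, measurable_fun I psi ->
      mu.-integrable I (EFin \o (fun t => psi t ^+ 2)) ->
      \int[mu]_(t in I) (Im (u k t) * psi t) @[k --> \oo] -->
      \int[mu]_(t in I) (v t * psi t)].
  apply: (@square_integrable_limit R I (fun k t => Im (u k t)) (2 / pi)) => //.
  - by move=> k; case: (u_int k).
  - exact: square_integrable_Im.
  - move=> k; rewrite (_ : (fun t => _) = (fun t => (Im (d k t) ^+ 2)%:E)); last first.
      by apply/funext => t; rewrite -uS ImD ImN.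
    apply: d_part; last by case: (d_int k).
    by move=> z; rewrite lerDr sqr_ge0.
pose phi t := v1 t +i* v2 t.
have phi_int : square_integrable I phi.
  by apply/square_integrableP => //; split=> //; exact: integrableD_real.
exists phi => // n.
have ei : square_integrable I (fun t => cexp ('i * freq n * t%:C)).
  exact: square_integrable_cexp.
have [m1 m2 _] := ei.
have i1 := square_integrable_Re mI ei; have i2 := square_integrable_Im mI ei.
have [j jn] := int_enum_surj n.
have trunc k : (j <= k)%N -> transform (u k) (freq n) = a n.
  move=> jk; rewrite transform_trig// ifT; last first.
    rewrite -jn /seg mem_map; last exact: int_enum_inj.
    by rewrite mem_iota /= add0n (leq_ltn_trans jk).
  have pn0 : pi != 0 :> R by rewrite gt_eqF.
  rewrite /b mulrAC -rmorphM /= (_ : 2 / pi * (pi / 2) = 1) ?mul1r//.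
  by rewrite mulrA divfK// divff.
apply: complexP.
- have c1 : Re (transform (u k) (freq n)) @[k --> \oo] --> Re (transform phi (freq n)).
    under eq_fun do rewrite Re_cintegralM//.
    by rewrite Re_cintegralM//; apply: cvgB; [exact: v1c|exact: v2c].
  have c2 : Re (transform (u k) (freq n)) @[k --> \oo] --> Re (a n).
    by apply: cvg_near_cst; exists j => // k jk; congr (Re _); exact: trunc.
  exact: (cvg_unique (@Rhausdorff R) c1 c2).
- have c1 : Im (transform (u k) (freq n)) @[k --> \oo] --> Im (transform phi (freq n)).
    under eq_fun do rewrite Im_cintegralM//.
    by rewrite Im_cintegralM//; apply: cvgD; [exact: v1c|exact: v2c].
  have c2 : Im (transform (u k) (freq n)) @[k --> \oo] --> Im (a n).
    by apply: cvg_near_cst; exists j => // k jk; congr (Im _); exact: trunc.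
  exact: (cvg_unique (@Rhausdorff R) c1 c2).
Qed.


End FourierSeries.

(** * Separation and the sine factor *)

Section Separation.
Context {R : realType}.
Local Notation C := R[i].
Local Notation al := (3 * (pi / 4) : R).
Local Notation freq n := ((4 * n%:~R : R)%:C).

Lemma cos_double (x : R) : cos (2 * x) = 1 - 2 * sin x ^+ 2.
Proof.
rewrite mulrC mulr_natr cos_mulr2n mulr2n.
by have := cos2Dsin2 x; lra.
Qed.

Lemma cos_double_intpi (x : R) (n : int) : cos (2 * (x + n%:~R * pi)) = cos (2 * x).
Proof.
rewrite !cos_double sinD sin_intpi mulr0 addr0 exprMn.
have := cos2Dsin2 (n%:~R * pi : R); rewrite sin_intpi expr0n addr0 => ->.
by rewrite mulr1.
Qed.

Lemma cos_double_le (eta r : R) : 0 <= 2 * eta -> eta <= r <= pi - eta ->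
  cos (2 * r) <= cos (2 * eta).
Proof.
move=> e0 /andP[r1 r2].
have p0 := @pi_gt0 R.
have H (x : R) : 2 * eta <= x <= pi -> cos x <= cos (2 * eta).
  move=> /andP[x1 x2]; rewrite leNgt; apply/negP.
  rewrite ltr_cos; first by lra.
  - by rewrite in_itv /=; apply/andP; split; lra.
  - by rewrite in_itv /=; apply/andP; split; lra.
have [h|h] := leP (2 * r) pi; first by apply: H; apply/andP; split; lra.
have -> : cos (2 * r) = cos (2 * (pi - r)).
  have := cos_double_intpi (- r) 1; rewrite mul1r [- r + pi]addrC => ->.
  by rewrite mulrN cosN.
by apply: H; apply/andP; split; lra.
Qed.

Lemma cexp_al_freq (n : int) :
  cexp (- ('i * freq n * al%:C)) = cexp ('i * freq n * al%:C).
Proof.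
rewrite (_ : - _ = 'i * freq n * (- al)%:C); last by rewrite rmorphN mulrN.
rewrite !cexp_freq mulrN cosN sinN.
have -> : 4 * n%:~R * al = (3 * n)%:~R * pi :> R by rewrite intrM; field.
by rewrite sin_intpi oppr0.
Qed.

Lemma abs2_cexp_freq (n : int) (t : R) : abs2 (cexp ('i * freq n * t%:C)) = 1.
Proof. by rewrite cexp_freq /abs2 /= cos2Dsin2. Qed.

(** With Y = al |Im w|, the squared modulus is e^{2Y} + e^{-2Y} - 2 cos(2 al Re w). High up the
    first term dominates; near the real axis the separation must come from the real part and keeps
    al Re w away from the multiples of pi. *)
Lemma abs2_sine_ge (Z : set C) (delta : R) : 0 < delta -> delta <= 1 ->
  (forall w (n : int), Z w -> delta ^+ 2 <= abs2 (w - (4 / 3 * n%:~R)%:C)) ->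
  exists2 kappa : R, 0 < kappa & forall w, Z w ->
    kappa * expR (2 * (al * `|Im w|)) <=
    abs2 (cexp ('i * w * al%:C) - cexp (- ('i * w * al%:C))).
Proof.
move=> d0 d1 sep; have p0 := @pi_gt0 R.
(* Below height [y0] one has [|Im w| < delta / 2], so [Re w] is still at distance at least
   [delta / 2] from the points 4 n / 3. Scaled by [al], that distance is [eta], equal in value to
   [y0]; [delta <= 1] yields [2 * eta < pi]. *)
pose y0 := al * (delta / 2).
have y00 : 0 < y0 by rewrite /y0; apply: mulr_gt0; lra.
pose eta := al * (delta / 2).
have eta_pi : 2 * eta < pi by rewrite /eta; nra.
pose sigma := 1 - cos (2 * eta).
have sigma0 : 0 < sigma.
  rewrite subr_gt0 -[ltRHS]cos0 ltr_cos; first by apply: mulr_gt0.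
  - by rewrite in_itv /= lexx ltW.
  - rewrite in_itv /=; apply/andP; split; last exact: ltW.
    by rewrite mulr_ge0// ltW.
pose k1 := (1 - expR (- (2 * y0))) ^+ 2.
have k10 : 0 < k1.
  rewrite exprn_even_gt0//= subr_eq0 eq_sym lt_eqF// -[ltRHS]expR0 ltr_expR.
  by rewrite oppr_lt0 mulr_gt0.
pose k2 := 2 * sigma * expR (- (2 * y0)).
have k20 : 0 < k2 by rewrite !mulr_gt0 ?expR_gt0.
exists (Num.min k1 k2); first by rewrite lt_min k10.
move=> w Zw; set Y := al * `|Im w|.
have Y0 : 0 <= Y by rewrite /Y; apply: mulr_ge0 => //; lra.
have -> : abs2 (cexp ('i * w * al%:C) - cexp (- ('i * w * al%:C))) =
    expR (2 * Y) + expR (- (2 * Y)) - 2 * cos (2 * (al * Re w)).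
  have := @abs2_cexp_pair R (-1) ('i * w * al%:C).
  rewrite rmorphN1 mulN1r => ->; last by rewrite sqrrN expr1n.
  rewrite Re_mulr_real Im_mulr_real Re_imul Im_imul mulN1r [Re w * al]mulrC.
  congr (_ - _); rewrite /Y; have [h|h] := ger0P (Im w).
  - by rewrite addrC; congr (expR _ + expR _); ring.
  - by congr (expR _ + expR _); ring.
have EE : expR (2 * Y) * expR (- (2 * Y)) = 1 by rewrite -expRD subrr expR0.
have E0 : 0 < expR (2 * Y) by exact: expR_gt0.
have [hY|hY] := leP y0 Y.
- apply: (@le_trans _ _ (k1 * expR (2 * Y))).
    by rewrite ler_wpM2r ?expR_ge0// ge_min lexx.
  apply: (@le_trans _ _ ((1 - expR (- (2 * Y))) ^+ 2 * expR (2 * Y))); last first.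
    have := cos_le1 (2 * (al * Re w)); move: (cos _) EE.
    move: (expR (2 * Y)) (expR (- _)) => p q c pq c1.
    rewrite (_ : (1 - q) ^+ 2 * p = p - 2 * (p * q) + (p * q) * q); last by ring.
    by rewrite pq; lra.
  rewrite ler_wpM2r ?expR_ge0// ler_sqr ?nnegrE ?subr_ge0 -?[leRHS]expR0 ?ler_expR.
  + by rewrite lerB// ler_expR lerN2 ler_pM2l.
  + by rewrite oppr_le0 mulr_ge0// ltW.
  + by rewrite oppr_le0 mulr_ge0.
- have imw : `|Im w| < delta / 2 by move: hY; rewrite /Y /y0 ltr_pM2l//; lra.
  have sepu (n : int) : (delta / 2) ^+ 2 <= (Re w - 4 / 3 * n%:~R) ^+ 2.
    have := sep w n Zw; rewrite /abs2 !ReImE /= oppr0 addr0.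
    have : Im w ^+ 2 <= (delta / 2) ^+ 2.
      rewrite -[Im w ^+ 2]real_normK ?num_real//.
      by apply: lerXn2r; rewrite ?nnegrE//; [lra|exact: ltW].
    by move: d0; rewrite !expr2; nra.
  pose n := Num.floor (al * Re w / pi).
  have /andP[n1 n2] := Num.Theory.floor_itv (al * Re w / pi).
  pose r := al * Re w - n%:~R * pi.
  have r0 : 0 <= r by rewrite /r subr_ge0 -ler_pdivlMr.
  have r1 : 0 <= pi - r.
    by move: (ltW n2); rewrite ler_pdivrMr// intrD /r /n; lra.
  have far (m : int) : eta ^+ 2 <= (al * Re w - m%:~R * pi) ^+ 2.
    have -> : al * Re w - m%:~R * pi = al * (Re w - 4 / 3 * m%:~R) by field.
    by rewrite /eta [leLHS]exprMn [leRHS]exprMn; apply: ler_wpM2l (sepu m); exact: sqr_ge0.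
  have e0 : 0 <= eta by exact: ltW.
  have er : eta <= r by have := far n; rewrite ler_sqr ?nnegrE.
  have er' : eta <= pi - r.
    have := far (n + 1); rewrite -[leRHS]sqrrN ler_sqr ?nnegrE//.
    + by rewrite intrD /r; lra.
    + by move: r1; rewrite intrD /r; lra.
  have := @cos_double_le eta r; rewrite -(cos_double_intpi r n) /r subrK => H.
  have {}H : cos (2 * (al * Re w)) <= cos (2 * eta).
    by apply: H; [lra|apply/andP; split; [exact: er|move: er'; rewrite /r; lra]].
  apply: (@le_trans _ _ (k2 * expR (2 * Y))).
    by rewrite ler_wpM2r ?expR_ge0// ge_min lexx orbT.
  (* As the two exponentials sum to at least 2, the modulus is at least [2 * sigma]; the exponential
     inside [k2] pays for [expR (2 * Y)] because [Y < y0]. *)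
  apply: (@le_trans _ _ (2 * sigma)).
    rewrite /k2 -mulrA -expRD ler_piMr//; first by rewrite mulr_ge0// ltW.
    by rewrite -[leRHS]expR0 ler_expR; lra.
  rewrite /sigma; move: H; move: (cos _) (cos _) => c1 c2 H.
  have := sqr_ge0 (1 - expR (- (2 * Y))); have := ltW E0.
  by move: EE; move: (expR (2 * Y)) (expR (- _)) => p q pq; nra.
Qed.

End Separation.

(** * Interleaving *)

Section Interleaving.
Context {R : realType}.
Local Notation C := R[i].
Local Notation I := (`[- (pi / 4), pi / 4]%classic : set R).
Local Notation E := (`[- pi, - (pi / 2)] `|` `[pi / 2, pi] : set R).
Local Notation al := (3 * (pi / 4) : R).
Local Notation freq n := ((4 * n%:~R : R)%:C).
Local Notation transform phi w :=
  (cintegral I (fun t => phi t * cexp ('i * w * t%:C))).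
Local Notation plus z := (cexp ('i * z * al%:C)).
Local Notation minus z := (cexp (- ('i * z * al%:C))).

Lemma transformD (phi psi : R -> C) (z : C) :
  square_integrable I phi -> square_integrable I psi ->
  transform (fun t => phi t + psi t) z = transform phi z + transform psi z.
Proof.
move=> fi gi; have ei := square_integrable_cexp ('i * z) (- (pi / 4)) (pi / 4).
rewrite -cintegralD//; try exact: cintegrableM.
by apply: eq_cintegral => t _; rewrite mulrDl.
Qed.

Lemma square_integrableB (phi psi : R -> C) :
  square_integrable I phi -> square_integrable I psi ->
  square_integrable I (fun t => phi t - psi t).
Proof.
move=> fi gi; have := square_integrableD _ fi (square_integrableZ (-1) _ gi).
rewrite (_ : (fun t => phi t + -1 * psi t) = (fun t => phi t - psi t)).
  by apply.
by apply/funext => t; rewrite mulN1r.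
Qed.

Lemma transformB (phi psi : R -> C) (z : C) :
  square_integrable I phi -> square_integrable I psi ->
  transform (fun t => phi t - psi t) z = transform phi z - transform psi z.
Proof.
move=> fi gi; have di := square_integrableB fi gi.
apply/eqP; rewrite eq_sym subr_eq -transformD//; apply/eqP.
by apply: eq_cintegral => t _; rewrite subrK.
Qed.

(** [NI] and [NE] stand for the kernel norms of PW_I and PW_E, which enter only through the
    inequalities assumed here. *)
Variables (Z : set C) (NI NE : C -> R) (K K' delta : R).
Hypothesis NI_ge0 : forall w, 0 <= NI w.
Hypothesis K_gt0 : 0 < K.
Hypothesis NI_ge : forall w,
  expR (2 * (pi / 4) * (`|Im w| + 1)) / (2 * (`|Im w| + 1)) <= K * NI w ^+ 2.
Hypothesis NI_real_le : forall x : R, NI x%:C ^+ 2 <= K'.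
Hypothesis NE_gt0 : forall w, 0 < NE w.
Hypothesis NE_le : forall w,
  NE w ^+ 2 <= 4 * expR (2 * (al * `|Im w|)) * NI w ^+ 2.
Hypothesis delta_gt0 : 0 < delta.
Hypothesis delta_le1 : delta <= 1.
Hypothesis separated : forall w (n : int), Z w ->
  delta ^+ 2 <= abs2 (w - (4 / 3 * n%:~R)%:C).
Hypothesis interpolation : forall a : C -> C, ell2 Z a ->
  exists! f : C -> C, PW I f /\ forall w, Z w -> f w / (NI w)%:C = a w.

Let NI_gt0 w : 0 < NI w.
Proof.
rewrite lt_def NI_ge0 andbT; apply: contraTneq (NI_ge w) => ->.
rewrite expr0n mulr0 -ltNge; apply: divr_gt0; first exact: expR_gt0.
by rewrite mulr_gt0// ltr_wpDl.
Qed.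

Let NI_neq0 w : (NI w)%:C != 0 :> C.
Proof. by rewrite -abs2_gt0 abs2_real exprn_gt0// NI_gt0. Qed.

Let NE_neq0 w : (NE w)%:C != 0 :> C.
Proof. by rewrite -abs2_gt0 abs2_real exprn_gt0. Qed.

Let interpolates (a : C -> C) : ell2 Z a -> exists2 phi : R -> C,
  square_integrable I phi & forall w, Z w -> transform phi w = a w * (NI w)%:C.
Proof.
move=> /interpolation[f [[[phi phi_int fE] fa] _]]; exists phi => // w Zw.
by rewrite -fE -(fa w Zw) divfK.
Qed.

(** The transform of [phi] and the zero function both interpolate the zero family. *)
Let uniqueness (phi : R -> C) : square_integrable I phi ->
  (forall w, Z w -> transform phi w = 0) -> forall z, transform phi z = 0.
Proof.
move=> phi_int phi0 z.
have [|f [_ fu]] := interpolation (a := fun=> 0).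
  by apply/ell2P; exists 0 => r _ _; rewrite big1// => w _; exact: abs20.
have fE : f = (fun z => transform phi z).
  by apply: fu; split=> [|w Zw]; [exists phi|rewrite phi0// mul0r].
rewrite -[LHS]/((fun z => transform phi z) z) -fE.
have -> // : f = (fun=> 0).
apply: fu; split=> [|w Zw]; last by rewrite mul0r.
exists (fun=> 0); first exact: ccontinuous_square_integrable (ccontinuous_cst 0).
move=> w; rewrite -[LHS](cintegral0 I); apply: eq_cintegral => t _.
by rewrite mul0r.
Qed.

Let Lam : set C := Z `|` [set freq n | n in [set: int]].

Let exists_interpolant (a : C -> C) : ell2 Lam a ->
  exists2 phi : R -> C, square_integrable E phi & forall w, Lam w ->
    cintegral E (fun t => phi t * cexp ('i * w * t%:C)) = a w * (NE w)%:C.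
Proof.
move=> /ell2P[A aA].
have [kappa kappa0 sine_ge] := abs2_sine_ge delta_gt0 delta_le1 separated.
(* At the nodes 4 n the two exponentials coincide with [plus], of modulus 1, so these are the values
   prescribed to g1 + g2. *)
pose g n : C := a (freq n) * (NE (freq n))%:C / plus (freq n).
have [r ur|psi psi_int psiE] := @riesz_fischer R g (4 * K' * A).
  apply: (@le_trans _ _ (4 * K' * \sum_(n <- r) abs2 (a (freq n)))).
    rewrite mulr_sumr; apply: ler_sum => n _.
    rewrite /g !abs2M abs2V abs2_cexp_freq invr1 mulr1 abs2_real mulrC.
    rewrite ler_wpM2r ?abs2_ge0//; apply: le_trans (NE_le _) _.
    by rewrite /= normr0 !mulr0 expR0 mulr1 ler_pM2l.
  have K'0 : 0 <= K' by apply: le_trans (NI_real_le 0); exact: sqr_ge0.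
  rewrite ler_wpM2l ?mulr_ge0//.
  have := aA (map (fun n : int => freq n) r); rewrite big_map; apply.
    rewrite map_inj_uniq// => m n [] /(mulfI _) H.
    by apply: (mulrIz _ (H _)); rewrite ?oner_neq0//.
  by move=> w /mapP[n _ ->]; right; exists n.
(* Substituting g2 = psi^ - g1, with psi^ the transform of [psi], into
   [minus w * g1 + plus w * g2 = a w * NE w] and solving for g1 gives [num w / s w]. *)
pose num w := plus w * transform psi w - a w * (NE w)%:C.
pose s w : C := plus w - minus w.
have [B bes] : exists B : R, forall (phi : R -> C) (r : seq C),
    square_integrable I phi -> uniq r -> (forall w, w \in r -> Z w) ->
    \sum_(w <- r) abs2 (transform phi w) / NI w ^+ 2 <= B * energy I phi.
  apply: (@bessel R (pi / 4) Z (fun w => NI w ^+ 2) K) => //.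
    by rewrite divr_ge0// ltW// pi_gt0.
  move=> b /interpolates[phi phi_int phiE]; exists phi => // w Zw.
  by rewrite phiE// sqrtr_sqr ger0_norm.
have s_neq0 w : Z w -> s w != 0.
  move=> Zw; rewrite -abs2_gt0; apply: lt_le_trans (sine_ge w Zw).
  by rewrite mulr_gt0// expR_gt0.
have [|phi1 phi1_int phi1E] := @interpolates (fun w => num w / s w / (NI w)%:C).
  (* The two terms of [num], each with the 2 of [abs2B]: the first is controlled by the Bessel
     bound, the second by the square sum of [a], with the 4 of [NE_le]. Dividing by the sine
     replaces e^{2 al |Im w|} by [1 / kappa]. *)
  apply/ell2P; exists (2 / kappa * (B * energy I psi) + 8 / kappa * A) => r ur rZ.
  apply: (@le_trans _ _ (2 / kappa * (\sum_(w <- r) abs2 (transform psi w) / NI w ^+ 2) +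
      8 / kappa * \sum_(w <- r) abs2 (a w))); last first.
    apply: lerD; first by rewrite ler_pM2l ?divr_gt0//; exact: bes.
    by rewrite ler_pM2l ?divr_gt0//; apply: aA => // w /rZ; left.
  rewrite 2!mulr_sumr -big_split /= big_seq [leRHS]big_seq.
  apply: ler_sum => w /rZ Zw; rewrite !abs2M !abs2V abs2_real.
  have := sine_ge w Zw; rewrite -/(s w); set e := expR _ => es.
  have e0 : 0 < e by exact: expR_gt0.
  have n0 : 0 < NI w ^+ 2 by rewrite exprn_gt0// NI_gt0.
  have s0 : 0 < abs2 (s w) by rewrite abs2_gt0; exact: s_neq0.
  have num_le : abs2 (num w) <=
      2 * (e * abs2 (transform psi w)) + 2 * (abs2 (a w) * (4 * e * NI w ^+ 2)).
    apply: (le_trans (abs2B _ _)); rewrite !abs2M abs2_real; apply: lerD.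
      rewrite ler_pM2l// ler_wpM2r ?abs2_ge0// abs2_cexp ler_expR ler_pM2l//.
      rewrite Re_mulr_real Re_imul [leRHS]mulrC; apply: ler_wpM2r.
        by have := @pi_gt0 R; lra.
      by rewrite -normrN ler_norm.
    by rewrite ler_pM2l// ler_wpM2l ?abs2_ge0//; exact: NE_le.
  rewrite ler_pdivrMr// ler_pdivrMr//.
  apply: (le_trans num_le).
  rewrite (_ : _ * NI w ^+ 2 * _ = (2 * abs2 (transform psi w) + 8 * abs2 (a w) * NI w ^+ 2) *
    (abs2 (s w) / kappa)); last by field; rewrite !gt_eqF.
  have ek : e <= abs2 (s w) / kappa by rewrite ler_pdivlMr// mulrC.
  rewrite (_ : _ + _ = (2 * abs2 (transform psi w) + 8 * abs2 (a w) * NI w ^+ 2) * e); last by ring.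
  by rewrite ler_wpM2l// addr_ge0 ?mulr_ge0 ?abs2_ge0// ltW.
pose phi2 t := psi t - phi1 t.
have phi2_int : square_integrable I phi2 by exact: square_integrableB.
exists (glue phi1 phi2); first exact: square_integrable_glue.
move=> w Lw; rewrite transform_bands; last exact: square_integrable_glue.
have -> : transform (fun t => glue phi1 phi2 (t - al)) w = transform phi1 w.
  by apply: eq_cintegral => t It; rewrite glue1.
have -> : transform (fun t => glue phi1 phi2 (t + al)) w = transform phi2 w.
  by apply: eq_cintegral => t It; rewrite glue2.
rewrite transformB//; case: Lw => [Zw|[n _ <-]].
- rewrite phi1E// divfK//.
  have -> : minus w * (num w / s w) + plus w * (transform psi w - num w / s w) =
    plus w * transform psi w - s w * (num w / s w) by rewrite /s; ring.
  by rewrite [s w * _]mulrC divfK ?s_neq0// /num subKr.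
- rewrite cexp_al_freq -mulrDr addrC subrK psiE /g mulrC divfK//.
  exact: cexp_neq0.
Qed.

(** The differences [d1], [d2] on the two bands have opposite transforms because of the nodes 4 n.
    At the points of [Z] what remains is the nonzero sine factor times the transform of [d2], so
    [uniqueness] applies. *)
Let bands_unique (phi psi : R -> C) :
  square_integrable E phi -> square_integrable E psi ->
  (forall w, Lam w -> cintegral E (fun t => phi t * cexp ('i * w * t%:C)) =
    cintegral E (fun t => psi t * cexp ('i * w * t%:C))) ->
  forall z, cintegral E (fun t => phi t * cexp ('i * z * t%:C)) =
    cintegral E (fun t => psi t * cexp ('i * z * t%:C)).
Proof.
move=> phi_int psi_int eqL z.
have [f1 f2] := square_integrable_bands phi_int.
have [g1 g2] := square_integrable_bands psi_int.
have [kappa kappa0 sine_ge] := abs2_sine_ge delta_gt0 delta_le1 separated.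
pose d1 t := phi (t - al) - psi (t - al).
pose d2 t := phi (t + al) - psi (t + al).
have d1i : square_integrable I d1 by exact: square_integrableB.
have d2i : square_integrable I d2 by exact: square_integrableB.
have diff w : cintegral E (fun t => phi t * cexp ('i * w * t%:C)) -
    cintegral E (fun t => psi t * cexp ('i * w * t%:C)) =
    minus w * transform d1 w + plus w * transform d2 w.
  by rewrite !transform_bands// !transformB//; ring.
have diff0 w : Lam w -> minus w * transform d1 w + plus w * transform d2 w = 0.
  by move=> /eqL H; rewrite -diff H subrr.
have sum0 w : transform d1 w + transform d2 w = 0.
  rewrite -transformD//; apply: transform_eq0; first exact: square_integrableD.
  move=> n; rewrite transformD//.
  have Ln : Lam (freq n) by right; exists n.
  have /eqP := diff0 (freq n) Ln.
  by rewrite cexp_al_freq -mulrDr mulf_eq0 (negPf (cexp_neq0 _)) => /eqP.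
have d1E w : transform d1 w = - transform d2 w.
  by apply/eqP; rewrite -addr_eq0 sum0.
have d20 : forall w, transform d2 w = 0.
  apply: uniqueness => // w Zw.
  have /eqP := diff0 w (or_introl Zw).
  rewrite d1E mulrN addrC -mulrBl mulf_eq0 => /orP[|/eqP//].
  rewrite -abs2_eq0 gt_eqF//; apply: lt_le_trans (sine_ge w Zw).
  by rewrite mulr_gt0// expR_gt0.
by apply/eqP; rewrite -subr_eq0 diff d1E d20 oppr0 !mulr0 addr0.
Qed.

Lemma interleaved_interpolation (a : C -> C) : ell2 Lam a ->
  exists! f : C -> C, PW E f /\ forall w, Lam w -> f w / (NE w)%:C = a w.
Proof.
move=> aL; have [phi phi_int phiE] := exists_interpolant aL.
exists (fun z => cintegral E (fun t => phi t * cexp ('i * z * t%:C))); split.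
  by split=> [|w Lw]; [exists phi|rewrite phiE// mulfK].
move=> f [[psi psi_int fE] fa]; apply/funext => z; rewrite fE.
apply: bands_unique => // w Lw; rewrite phiE// -fE.
by rewrite -(fa w Lw) divfK.
Qed.

End Interleaving.

Theorem theorem6 (R : realType) (H : R[i] -> R[i]) :
  entire H ->
  complete_interpolating `[- (pi / 4), pi / 4] (zero_set H) ->
  generating_function `[- (pi / 4), pi / 4] (zero_set H) H ->
  (0 < ereal_inf [set (Re `|w - (4 / 3 * n%:~R)%:C|)%:E
                 | w in zero_set H & n in [set: int]])%E ->
  complete_interpolating
    (`[- pi, - (pi / 2)] `|` `[pi / 2, pi])
    (zero_set H `|` [set (4 * n%:~R)%:C | n in [set: int]]).
Proof.
move=> _ cis _ sep a.
have [delta [d0 d1 sepd]] : exists delta : R, [/\ 0 < delta, delta <= 1 &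
    forall w (n : int), zero_set H w -> delta ^+ 2 <= abs2 (w - (4 / 3 * n%:~R)%:C)].
  move: sep; set S := [set _ | _ in _ & _ in _]; move=> sep.
  (* The infimum is [+oo] when [H] has no zeros; then 1 serves. The later minimum with 1 meets the
     requirement [delta <= 1] of [abs2_sine_ge]. *)
  have [d d0 dS] : exists2 d : R, 0 < d & (d%:E <= ereal_inf S)%E.
    case: (ereal_inf S) sep => [r||]//; first by rewrite lte_fin; exists r.
    by exists 1; rewrite ?leey.
  exists (Num.min d 1); split; first by rewrite lt_min d0 ltr01.
    by rewrite ge_min lexx orbT.
  move=> w n Zw; rewrite -sqr_Re_norm.
  have := le_trans dS (ereal_inf_lbound (_ : S (Re `|w - (4 / 3 * n%:~R)%:C|)%:E)).
  rewrite lee_fin => dn; apply: lerXn2r.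
  - by rewrite nnegrE le_min ler01 ltW.
  - by rewrite nnegrE (le_trans _ (dn _))// ?ltW//; exists w => //; exists n.
  - by rewrite ge_min dn//; exists w => //; exists n.
have [K K0 K_ge] := @PWnorm_kernel_ge R.
have [K' K'_ge] := @PWnorm_kernel_real_le R.
exact: (@interleaved_interpolation R (zero_set H)
  (fun w => PWnorm (PWkernel `[- (pi / 4), pi / 4]%classic w))
  (fun w => PWnorm (PWkernel (`[- pi, - (pi / 2)] `|` `[pi / 2, pi])%classic w))
  K K' delta (fun w => PWnorm_ge0 _) K0 K_ge K'_ge (@PWnorm_bands_gt0 R)
  (@PWnorm_bands_le R) d0 d1 sepd cis a).
Qed.
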